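(* Let $a,b,c\in\mathbb{C}$ be distinct, let $U=\mathbb{C}\setminus\{a,b,c\}$ and let $K$ be a compact set in $U$. Then there exist a constant $C$, depending only on $\sup_{w\in K}\{|w-a|,|w-b|,|w-c|\}$, $d(K,\{a,b,c\})$, $|a-b|$, $|b-c|$ and $|a-c|$, and a number $\varepsilon_0>0$ such that for every $0<\varepsilon<\varepsilon_0$ and all $a',b',c'\in\mathbb{C}$ with $H(\{a,b,c\},\{a',b',c'\})<\varepsilon$, one has $$|\rho_{a,b,c}(z)-\rho_{a',b',c'}(z)|<C\,\varepsilon\log\left(\frac1\varepsilon\right)\qquad\text{for all } z\in K.$$
   Context: All distances are Euclidean. For sets $A,B\subset\mathbb{C}$, $d(A,B)=\inf_{z\in A,\,w\in B}|z-w|$, and the Hausdorff distance is $H(A,B)=\inf\{r>0: A\subseteq N_r(B)\text{ and }B\subseteq N_r(A)\}$, where $N_r(A)$ is the set of points whose distance from $A$ is less than $r$. For a hyperbolic domain $A$ and $z\in A$, $\rho_A(z)$ denotes the hyperbolic density normalized to have curvature $-4$, i.e. $\rho_A(z)=1/|\pi'(0)|$, where $\pi$ is a holomorphic covering map from the unit disc $\mathbb{D}$ onto $A$ with $\pi(0)=z$. For distinct points $a,b,c$, $\rho_{a,b,c}$ denotes the hyperbolic density of the thrice punctured sphere $\hat{\mathbb{C}}\setminus\{a,b,c\}$, where $\hat{\mathbb{C}}=\mathbb{C}\cup\{\infty\}$. *)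

(* Defs.v *)
From HB Require Import structures.
From mathcomp Require Import all_boot all_order all_algebra.
From mathcomp Require Import all_classical all_reals all_analysis.
From mathcomp Require Import complex.

Set Implicit Arguments.
Unset Strict Implicit.
Unset Printing Implicit Defensive.

Import Order.TTheory GRing.Theory Num.Theory.
Import numFieldNormedType.Exports.

Local Open Scope classical_set_scope.
Local Open Scope ring_scope.

(* The regular module over [complex R] carries the Euclidean topology, and
   [derivable f w 1] on it is complex differentiability at [w]. *)
Notation Cplane R := (GRing.regular (complex R)).

(* [None] is the point at infinity. *)
Notation Csphere R := (one_point_compactification (Cplane R)).

(* The norm [`|z|] of [complex R] is complex-valued; [cabs] is its real form. *)
Notation cabs := Normc.normc.

Section Distances.
Variable R : realType.
Implicit Types (A B : set (Cplane R)) (r : R).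

(* [inf] is 0 on the empty set, so these are meaningful for nonempty [A] and
   [B] only. *)
Definition set_dist A B : R := inf [set cabs (z - w) | z in A & w in B].

Definition set_nbhd r A : set (Cplane R) := [set z | set_dist [set z] A < r].

Definition hausdorff_dist A B : R :=
  inf [set r | [/\ 0 < r, A `<=` set_nbhd r B & B `<=` set_nbhd r A]].

End Distances.

Section Coverings.
Variables X Y : topologicalType.
Implicit Types (p : X -> Y).

Definition homeo_between (S : set X) (V : set Y) p : Prop :=
  [/\ set_bij S V p,
      {within S, continuous p} &
      exists q : Y -> X,
        {within V, continuous q} /\ (forall x, S x -> q (p x) = x)].

(* Covering map from [D] onto [A], for [D] and [A] open: the sheets and the
   evenly covered neighbourhoods are taken open in the ambient spaces.
   The values of [p] outside [D] are irrelevant. *)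
Definition covering_map (D : set X) (A : set Y) p : Prop :=
  [/\ {within D, continuous p},
      p @` D = A &
      forall y, A y -> exists V : set Y,
        [/\ open V, V y, V `<=` A &
            exists F : set (set X),
              [/\ forall S, F S -> open S,
                  trivIset F id,
                  \bigcup_(S in F) S = D `&` p @^-1` V &
                  forall S, F S -> homeo_between S V p]]].

End Coverings.

Section HyperbolicDensity.
Variable R : realType.

Definition unit_disc : set (Cplane R) := [set w | cabs w < 1].

Definition chart_fin (x : Csphere R) : Cplane R :=
  if x is Some z then z else 0.

Definition chart_inf (x : Csphere R) : Cplane R :=
  if x is Some z then z^-1 else 0.

(* Holomorphy on an open set [D] of a map into the Riemann sphere. Continuity
   keeps [f] in the domain of the chart used, near the point considered. *)
Definition holomorphic_sphere (D : set (Cplane R))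
    (f : Cplane R -> Csphere R) : Prop :=
  forall w, D w ->
    [/\ {for w, continuous f},
        f w <> None -> derivable (chart_fin \o f) w 1 &
        f w = None -> derivable (chart_inf \o f) w 1].

Definition holomorphic_covering (A : set (Csphere R)) (z : Cplane R)
    (p : Cplane R -> Csphere R) : Prop :=
  [/\ covering_map unit_disc A p,
      holomorphic_sphere unit_disc p &
      p 0 = Some z].

(* The density of curvature -4 at a finite point [z] of a hyperbolic domain
   [A] of the sphere. The set below is then a singleton, all coverings based
   at [z] giving the same value; the default 0 is used when there is none. *)
Definition hyp_density (A : set (Csphere R)) (z : Cplane R) : R :=
  xget 0 [set r | exists p, holomorphic_covering A z p /\
                            r = 1 / cabs ('D_1 (chart_fin \o p) 0)].

Definition thrice_punctured_sphere (a b c : Cplane R) : set (Csphere R) :=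
  ~` [set Some a; Some b; Some c].

Definition rho3 (a b c z : Cplane R) : R :=
  hyp_density (thrice_punctured_sphere a b c) z.

End HyperbolicDensity.

(* Main.v *)
Require Import Defs.
From HB Require Import structures.
From mathcomp Require Import all_boot all_order all_algebra.
From mathcomp Require Import all_classical all_reals all_analysis.
From mathcomp Require Import complex.
From mathcomp Require Import ring lra.

Import Order.TTheory GRing.Theory Num.Theory.
Import numFieldNormedType.Exports.

Local Open Scope classical_set_scope.
Local Open Scope ring_scope.

Set Implicit Arguments.
Unset Strict Implicit.
Unset Printing Implicit Defensive.

(** The density of a thrice punctured sphere is Moebius covariant: if [T] maps
[a], [b], [c] to [oo], [0], [1], then [rho_{a,b,c} = |T'| * (sigma \o T)] with
[sigma] the density of [C \ {0, 1}]. Since [T] and [T'] depend on [a], [b], [c] in a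
Lipschitz way, it is enough that [sigma] is locally Lipschitz; this even gives
[O(eps)] instead of [O(eps * ln (1 / eps))]. Uniformization is not needed: if
some thrice punctured sphere has a holomorphic covering by the disc then, by
Moebius maps and automorphisms of the disc, they all have one for every base
point, and if none has, then all the densities are 0 by convention.

So let [P] be a covering of [C \ {0, 1}]. If [P w = y], then
[sigma y = 1 / ((1 - |w| ^ 2) * |P' w|)], whatever the covering and the choice of
[w]: two coverings with the same base point lift through each other, and
Schwarz's lemma compares their derivatives. The local Lipschitz property then
follows by taking [w] to be a holomorphic function of [y], a local inverse of [P].

The complex analysis that this requires (Goursat's theorem on rectangles, Cauchy's
formula, second order Taylor expansions, the maximum principle) is proved for
functions that are only assumed to be differentiable at each point. *)

(** Three obstacles shape the development. The constant may depend on five numbers only, not on [K]: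
    hence the estimate is made for all configurations whose distances lie between two bounds [m] and
    [M]. Normalization carries these into one compact subset of the plane minus [0] and [1], where
    local radii and Lipschitz constants become uniform. A covering is only known to be a local
    homeomorphism that is differentiable at each point, whereas the formula for the density and the
    differentiability of local inverses both divide by its derivative. That this derivative never
    vanishes has to be extracted from injectivity on a sheet, by a maximum principle that tolerates
    points of unknown regularity as long as a continuous factor vanishes there. Hausdorff closeness
    does not pair the points of the two triples. Each of [a], [b], [c] has a close point in the
    other triple; for small [eps] these are distinct, hence exhaust it, and a relabelling does not
    change the sphere. *)

(** * Modulus, limits and complex differentiability *)

Section ComplexPlane.
Variable R : realType.
Local Notation C := (Cplane R).
Implicit Types (x y z w c : C) (f g : C -> C).

Lemma cabsE z : ((cabs z)%:C)%C = `|z|.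
Proof. by rewrite normc_def; case: z. Qed.

Lemma cabs_ge0 z : 0 <= cabs z.
Proof. by rewrite -lecR cabsE; exact: (normr_ge0 z). Qed.

Lemma cabs0 : cabs (0 : C) = 0.
Proof. by rewrite -[0 : C]/(Complex 0 0) /= expr0n addr0 sqrtr0. Qed.

Lemma cabs1 : cabs (1 : C) = 1.
Proof. by rewrite -[1 : C]/(Complex 1 0) /= expr0n expr1n addr0 sqrtr1. Qed.

Lemma cabsM x y : cabs (x * y) = cabs x * cabs y.
Proof. exact: Normc.normcM. Qed.

Lemma cabsV x : cabs x^-1 = (cabs x)^-1.
Proof. exact: Normc.normcV. Qed.

Lemma cabsX x n : cabs (x ^+ n) = cabs x ^+ n.
Proof. by elim: n => [|n IH]; rewrite ?expr0 ?cabs1// !exprS cabsM IH. Qed.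

Lemma cabsN x : cabs (- x) = cabs x.
Proof. exact: normcN. Qed.

Lemma cabsB x y : cabs (x - y) = cabs (y - x).
Proof. by rewrite -cabsN opprB. Qed.

Lemma cabsD x y : cabs (x + y) <= cabs x + cabs y.
Proof. exact: le_normcD. Qed.

Lemma cabs_eq0 z : (cabs z == 0) = (z == 0).
Proof.
by apply/eqP/eqP => [/Normc.eq0_normc//|->]; rewrite cabs0.
Qed.

Lemma cabs_gt0 z : (0 < cabs z) = (z != 0).
Proof. by rewrite lt_def cabs_ge0 cabs_eq0 andbT. Qed.

Lemma cabs_triangle z x y : cabs (x - y) <= cabs (x - z) + cabs (z - y).
Proof. by apply: le_trans (cabsD _ _); rewrite addrA subrK. Qed.

Lemma ler_cabsB x y : cabs x - cabs y <= cabs (x - y).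
Proof. by have := cabsD (x - y) y; rewrite subrK; lra. Qed.

Lemma cabs_sqr z : cabs z ^+ 2 = complex.Re z ^+ 2 + complex.Im z ^+ 2.
Proof. by case: z => a b /=; rewrite sqr_sqrtr// addr_ge0// sqr_ge0. Qed.

Lemma Re_le_cabs z : `|complex.Re z| <= cabs z.
Proof.
rewrite -[leRHS]ger0_norm ?cabs_ge0// -ler_sqr// ?nnegrE//.
by rewrite !real_normK ?num_real// cabs_sqr lerDl sqr_ge0.
Qed.

Lemma Im_le_cabs z : `|complex.Im z| <= cabs z.
Proof.
rewrite -[leRHS]ger0_norm ?cabs_ge0// -ler_sqr// ?nnegrE//.
by rewrite !real_normK ?num_real// cabs_sqr lerDr sqr_ge0.
Qed.

Lemma cabs_real (k : R) : cabs (k%:C)%C = `|k|.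
Proof. by rewrite /= expr0n /= addr0 sqrtr_sqr. Qed.

Lemma cabs_imag (k : R) : cabs (Complex 0 k) = `|k|.
Proof. by rewrite /= expr0n /= add0r sqrtr_sqr. Qed.

Lemma cabs_le_ReIm z : cabs z <= `|complex.Re z| + `|complex.Im z|.
Proof.
have -> : z = ((complex.Re z)%:C)%C + Complex 0 (complex.Im z) :> C.
  by case: z => a b; congr Complex; rewrite /= ?addr0 ?add0r.
apply: le_trans (cabsD _ _) _.
by rewrite cabs_real cabs_imag /= addr0 add0r.
Qed.

Lemma nbhs_cabsP z (P : set C) : (\forall w \near z, P w) <->
  exists2 d : R, 0 < d & forall w, cabs (w - z) < d -> P w.
Proof.
split.
  move=> /nbhs_normP [e /= e0 H].
  move: e0; rewrite ltcE => /andP[/eqP /= Ie e1].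
  exists (complex.Re e) => // w h; apply: H.
  by rewrite /ball_/= -opprB normrN -cabsE ltcE /= Ie eqxx.
move=> [d d0 H]; apply/nbhs_normP; exists (d%:C)%C => /=; first by rewrite ltcR.
by move=> w /=; rewrite -opprB normrN -cabsE ltcR; exact: H.
Qed.

Lemma cvg_cabsP (T : Type) (F : set_system T) (FF : Filter F) (f : T -> C) c :
  f @ F --> c <-> forall e : R, 0 < e -> \forall t \near F, cabs (f t - c) < e.
Proof.
split => H.
  move=> e e0; apply: (H [set y | cabs (y - c) < e]).
  by apply/nbhs_cabsP; exists e.
move=> A /nbhs_cabsP[d d0 dA]; change (F (f @^-1` A)).
by apply: (filterS _ (H d d0)) => t /= ht; exact: dA.
Qed.

Lemma cvg_absP (T : Type) (F : set_system T) (FF : Filter F) (f : T -> R)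
    (l : R) :
  f @ F --> l <-> forall e : R, 0 < e -> \forall t \near F, `|f t - l| < e.
Proof.
split => H.
  by move=> e e0; move/cvgrPdist_lt : H => /(_ e e0); apply: filterS => t;
    rewrite distrC.
apply/cvgrPdist_lt => e e0; apply: (filterS _ (H e e0)) => t.
by rewrite distrC.
Qed.

Lemma cvg_cabs z : (fun w : C => cabs w) @ z --> cabs z.
Proof.
apply: (proj2 (cvg_absP (nbhs_filter z) _ _)) => e e0.
apply/nbhs_cabsP; exists e => // w wz.
rewrite ltr_norml; apply/andP; split.
  by have := ler_cabsB z w; rewrite cabsB; lra.
by have := ler_cabsB w z; lra.
Qed.


(** Convergence expressed with the real-valued modulus, since the norm of the plane is
    complex-valued; [cvg_cabsP] relates it to the filter convergence. *)
Definition cto (T : Type) (F : set_system T) (f : T -> C) (l : C) :=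
  forall e : R, 0 < e -> F (fun t => cabs (f t - l) < e).

Section Limits.
Context {T : Type} (F : set_system T) {FF : Filter F}.
Implicit Types (u v : T -> C) (l m : C).

Lemma cto_cst l : cto F (fun _ => l) l.
Proof. by move=> e e0; apply: (@filterE _ F FF) => t; rewrite subrr cabs0. Qed.

Lemma cto_eq_near u v l : (F (fun t => u t = v t)) -> cto F u l -> cto F v l.
Proof.
move=> uv ul e e0; have uve := @filterI _ F FF _ _ uv (ul e e0).
by apply: (@filterS _ F FF _ _ _ uve) => t [<-].
Qed.

Lemma ctoD u v l m : cto F u l -> cto F v m -> cto F (fun t => u t + v t) (l + m).
Proof.
move=> ul vm e e0; have e2 : 0 < e / 2 by lra.
have uv := @filterI _ F FF _ _ (ul _ e2) (vm _ e2); apply: (@filterS _ F FF _ _ _ uv) => t [h1 h2].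
have -> : u t + v t - (l + m) = (u t - l) + (v t - m) by ring.
by apply: le_lt_trans (cabsD _ _) _; lra.
Qed.

Lemma ctoN u l : cto F u l -> cto F (fun t => - u t) (- l).
Proof.
move=> ul e e0; apply: (@filterS _ F FF _ _ _ (ul _ e0)) => t h.
by rewrite -opprD cabsN.
Qed.

Lemma ctoB u v l m : cto F u l -> cto F v m -> cto F (fun t => u t - v t) (l - m).
Proof. by move=> ul /ctoN; exact: ctoD. Qed.

Lemma ctoM u v l m : cto F u l -> cto F v m -> cto F (fun t => u t * v t) (l * m).
Proof.
move=> ul vm e e0.
have l0 := cabs_ge0 l; have m0 := cabs_ge0 m.
pose k := cabs l + cabs m + 1.
have k0 : 0 < k by rewrite /k; lra.
(* With [d <= 1] the product of the two errors is at most [e / (2 * k)]; the three error terms then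
   add up to at most [e / 2]. *)
pose d := Num.min 1 (e / (2 * k)).
have ek0 : 0 < e / (2 * k) by apply: divr_gt0 => //; lra.
have d0 : 0 < d by rewrite lt_min ltr01 ek0.
have uv := @filterI _ F FF _ _ (ul _ d0) (vm _ d0); apply: (@filterS _ F FF _ _ _ uv) => t [].
rewrite !lt_min => /andP[h1 h2] /andP[h3 h4].
have -> : u t * v t - l * m = (u t - l) * (v t - m) + (l * (v t - m) + (u t - l) * m).
  by ring.
apply: le_lt_trans (cabsD _ _) _.
apply: (@le_lt_trans _ _ (e / (2 * k) * (1 + cabs l + cabs m))).
  have := cabsD (l * (v t - m)) ((u t - l) * m); rewrite !cabsM.
  have := cabs_ge0 (u t - l); have := cabs_ge0 (v t - m).
  set p := cabs (u t - l) in h1 h2 *; set q := cabs (v t - m) in h3 h4 *.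
  set E := e / (2 * k) in ek0 h2 h4 *.
  move=> q0 p0 H.
  have a1 : p * q <= E by nra.
  have a2 : cabs l * q <= cabs l * E by apply: ler_wpM2l => //; lra.
  have a3 : p * cabs m <= E * cabs m by apply: ler_wpM2r => //; lra.
  lra.
have -> : 1 + cabs l + cabs m = k by rewrite /k; ring.
have -> : e / (2 * k) * k = e / 2 by field; lra.
lra.
Qed.

Lemma ctoV u l : l != 0 -> cto F u l -> cto F (fun t => (u t)^-1) l^-1.
Proof.
rewrite -cabs_gt0 => l0 ul e e0.
(* The first entry keeps [|u t|] above [|l| / 2]; the second is [e] times the resulting lower bound
   for [|u t| |l|]. *)
pose d := Num.min (cabs l / 2) (e * (cabs l) ^+ 2 / 2).
have d0 : 0 < d.
  rewrite lt_min; apply/andP; split; first lra.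
  by rewrite divr_gt0// mulr_gt0// exprn_gt0.
apply: (@filterS _ F FF _ _ _ (ul _ d0)) => t; rewrite lt_min => /andP[h1 h2].
have ut : cabs l / 2 < cabs (u t).
  by have := ler_cabsB l (u t); rewrite cabsB; lra.
have ut0 : 0 < cabs (u t) by lra.
have -> : (u t)^-1 - l^-1 = (l - u t) / (u t * l).
  by field; rewrite -!cabs_gt0 l0 ut0.
rewrite cabsM cabsV cabsM cabsB ltr_pdivrMr ?mulr_gt0//.
apply: lt_trans h2 _.
have -> : e * cabs l ^+ 2 / 2 = (e * cabs l) * (cabs l / 2) by ring.
have -> : e * (cabs (u t) * cabs l) = (e * cabs l) * cabs (u t) by ring.
by rewrite ltr_pM2l// mulr_gt0.
Qed.

Lemma ctoX u l n : cto F u l -> cto F (fun t => u t ^+ n) (l ^+ n).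
Proof.
move=> ul; elim: n => [|n IH]; first exact: cto_cst.
by rewrite exprS; under eq_fun do rewrite exprS; exact: ctoM.
Qed.

End Limits.

Definition ccont f z := cto (nbhs z) f (f z).

Lemma ccontP f z : ccont f z <-> forall e : R, 0 < e ->
  exists2 d : R, 0 < d & forall w, cabs (w - z) < d -> cabs (f w - f z) < e.
Proof.
split => H e e0; first by have /nbhs_cabsP := H e e0.
by apply/nbhs_cabsP; exact: H.
Qed.

Lemma continuous_ccont f z : {for z, continuous f} <-> ccont f z.
Proof. exact: (cvg_cabsP (nbhs_filter z) f (f z)). Qed.

Lemma ccont_id z : ccont id z.
Proof. by move=> e e0; apply/nbhs_cabsP; exists e. Qed.

Lemma cto_comp (T : Type) (F : set_system T) (FF : Filter F) (u : T -> C) f l :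
  cto F u l -> ccont f l -> cto F (fun t => f (u t)) (f l).
Proof.
move=> ul fl e e0; have /nbhs_cabsP[d d0 H] := fl e e0.
by apply: (@filterS _ F FF _ _ _ (ul d d0)) => t; exact: H.
Qed.

Lemma ccont_near f z (P : set C) : ccont f z ->
  (\forall y \near f z, P y) -> \forall w \near z, P (f w).
Proof.
move=> cf /nbhs_cabsP[d d0 H].
by apply: filterS (cf d d0) => t; exact: H.
Qed.

Lemma ccont_neq0 f z : ccont f z -> f z != 0 -> \forall w \near z, f w != 0.
Proof.
move=> cf; rewrite -cabs_gt0 => fz.
apply: filterS (cf _ fz) => w h; rewrite -cabs_gt0.
by have := ler_cabsB (f z) (f w); rewrite cabsB; lra.
Qed.

(* Complex differentiability in Caratheodory's form: [phi] is the slope of [f]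
   at [z], continuously extended by the value [c] of the derivative. *)
Definition cder f z c := exists2 phi : C -> C,
  ccont phi z /\ phi z = c & forall w, f w = f z + phi w * (w - z).

(** Away from [z] the slope is replaced by the true difference quotient, so that the factorization
    is only required near [z]. *)
Lemma cder_near f z c (phi : C -> C) : cto (nbhs z) phi c ->
  (\forall w \near z, f w = f z + phi w * (w - z)) -> cder f z c.
Proof.
move=> cphi nf.
exists (fun w => if w == z then c else (f w - f z) / (w - z)); last first.
  move=> w; case: eqVneq => [->|wz]; first by rewrite subrr mulr0 addr0.
  by rewrite divfK ?subr_eq0// addrC subrK.
split; last by rewrite eqxx.
move=> e e0; have := @filterI _ (nbhs z) (nbhs_filter z) _ _ nf (cphi e e0).
apply: filterS => w [fw phiw]; rewrite eqxx.
case: eqVneq => [_|wz]; first by rewrite subrr cabs0.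
by rewrite fw (addrC (f z)) addrK mulfK ?subr_eq0.
Qed.

Lemma cder_eq_near f g z c : (\forall w \near z, f w = g w) ->
  cder f z c -> cder g z c.
Proof.
move=> fg [phi [cphi phiz] fphi]; apply: (@cder_near _ _ _ phi).
  by rewrite -phiz.
have fgz := nbhs_singleton fg.
by apply: filterS fg => w /= <-; rewrite -fgz.
Qed.

Lemma cder_cont f z c : cder f z c -> ccont f z.
Proof.
move=> [phi [cphi _] fE].
rewrite /ccont [f z](_ : _ = f z + phi z * (z - z)); last by rewrite -fE.
apply: (@cto_eq_near _ _ _ (fun w => f z + phi w * (w - z))).
  by apply: filterE => w; rewrite -fE.
apply: ctoD; first exact: cto_cst.
apply: ctoM => //; apply: ctoB; first exact: ccont_id.
exact: cto_cst.
Qed.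

Lemma cder_unique f z c c' : cder f z c -> cder f z c' -> c = c'.
Proof.
move=> [phi [cphi <-] fE] [psi [cpsi <-] fE'].
apply/eqP; rewrite -subr_eq0 -cabs_eq0 eq_le cabs_ge0 andbT.
apply/ler_addgt0Pl => e e0; rewrite addr0.
have /nbhs_cabsP := @ctoB _ _ (nbhs_filter z) _ _ _ _ cphi cpsi _ e0.
move=> [d d0 H].
pose w := z + ((d / 2)%:C)%C.
have wz : w - z = ((d / 2)%:C)%C by rewrite /w addrC addKr.
have cwz : cabs (w - z) = d / 2 by rewrite wz cabs_real ger0_norm//; lra.
have := H w; rewrite cwz => /(_ ltac:(lra)).
suff -> : phi w = psi w by rewrite subrr sub0r cabsN; lra.
have wz0 : w - z != 0 by rewrite -cabs_gt0 cwz; lra.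
apply: (mulIf wz0); apply: (addrI (f z)).
by rewrite -fE -fE'.
Qed.

Lemma cder_cst k z : cder (fun=> k) z 0.
Proof.
exists (fun=> 0); last by move=> w; rewrite mul0r addr0.
by split => //; exact: cto_cst.
Qed.

Lemma cder_id z : cder id z 1.
Proof.
exists (fun=> 1); last by move=> w; rewrite mul1r addrC subrK.
by split => //; exact: cto_cst.
Qed.

Lemma cderD f g z a b : cder f z a -> cder g z b ->
  cder (fun w => f w + g w) z (a + b).
Proof.
move=> [p [cp <-] fE] [q [cq <-] gE]; exists (fun w => p w + q w).
  by split => //; exact: ctoD.
by move=> w; rewrite (fE w) (gE w); ring.
Qed.

Lemma cderN f z a : cder f z a -> cder (fun w => - f w) z (- a).
Proof.
move=> [p [cp <-] fE]; exists (fun w => - p w).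
  by split => //; exact: ctoN.
by move=> w; rewrite (fE w); ring.
Qed.

Lemma cderB f g z a b : cder f z a -> cder g z b ->
  cder (fun w => f w - g w) z (a - b).
Proof. by move=> fa /cderN; exact: cderD. Qed.

Lemma cderM f g z a b : cder f z a -> cder g z b ->
  cder (fun w => f w * g w) z (a * g z + f z * b).
Proof.
move=> df dg; have cg := cder_cont dg.
move: df dg => [p [cp <-] fE] [q [cq <-] gE].
exists (fun w => p w * g w + f z * q w).
  split => //; apply: ctoD; first exact: ctoM.
  by apply: ctoM => //; exact: cto_cst.
by move=> w; rewrite (fE w) (gE w); ring.
Qed.

Lemma cderV f z a : f z != 0 -> cder f z a ->
  cder (fun w => (f w)^-1) z (- a / f z ^+ 2).
Proof.
move=> fz0 df; have cf := cder_cont df.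
move: df => [p [cp <-] fE].
apply: (@cder_near _ _ _ (fun w => - p w / (f w * f z))).
  rewrite expr2; apply: ctoM; first exact: ctoN.
  apply: ctoV; first by rewrite mulf_neq0.
  by apply: ctoM => //; exact: cto_cst.
apply: filterS (ccont_neq0 cf fz0) => w fw0.
have -> : - p w / (f w * f z) * (w - z) = (f z - f w) / (f w * f z).
  by rewrite (fE w); field; rewrite fz0 -fE.
by field; rewrite fz0.
Qed.

Lemma cder_comp f g z a b : cder f z a -> cder g (f z) b ->
  cder (fun w => g (f w)) z (b * a).
Proof.
move=> df dg; have cf := cder_cont df.
move: df dg => [p [cp <-] fE] [q [cq <-] gE].
exists (fun w => q (f w) * p w).
  split => //; apply: ctoM => //.
  exact: cto_comp cf cq.
by move=> w; rewrite (gE (f w)) {2}(fE w); ring.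
Qed.

(** Comparing the slopes of [f] and [h] gives [p (g w) * (g w - g z) = q w * (w - z)], and
    continuity of [g] keeps [p (g w)] away from 0. With [h] the identity this differentiates local
    inverses; in general it differentiates lifts through a covering. *)
Lemma cder_lift f g h z a b : cder f (g z) a -> a != 0 -> cder h z b ->
  ccont g z -> (\forall w \near z, f (g w) = h w) -> cder g z (b / a).
Proof.
move=> [p [cp pa] fE] a0 [q [cq qb] hE] cg fgh.
have fghz := nbhs_singleton fgh.
have cpg : cto (nbhs z) (fun w => p (g w)) a by rewrite -pa; exact: cto_comp cg cp.
apply: (@cder_near _ _ _ (fun w => q w / p (g w))).
  by apply: ctoM; [rewrite -qb|exact: ctoV].
have pg0 : \forall w \near z, p (g w) != 0.
  by apply: ccont_neq0; [rewrite /ccont pa|rewrite pa].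
apply: filterS (filterI fgh pg0) => w [h1 h2].
have : p (g w) * (g w - g z) = q w * (w - z).
  have := fE (g w); rewrite h1 hE -fghz => /addrI ->; by [].
move=> E; rewrite mulrAC -E mulrAC divff// mul1r.
by rewrite addrC subrK.
Qed.

(** The difference quotient in the form to which [derivable f z 1] and ['D_1 f z] unfold. *)
Let dquot f z (h : C) : C := (h : complex R)^-1 *: ((f \o shift z) ((h : complex R) *: (1 : C)) - f z).

Lemma cder_cvg f z c :
  dquot f z @ (dnbhs (0 : C)) --> c <-> cder f z c.
Proof.
split.
  move=> /(cvg_cabsP (dnbhs_filter _)) H.
  pose phi w : C := if w == z then c else (f w - f z) / (w - z).
  apply: (@cder_near _ _ _ phi); last first.
    apply: filterE => w; rewrite /phi; case: eqVneq => [->|wz].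
      by rewrite subrr mulr0 addr0.
    by rewrite divfK ?subr_eq0// addrC subrK.
  move=> e e0; have := H e e0 => /nbhs_cabsP[d d0 {}H].
  apply/nbhs_cabsP; exists d => // w wz; rewrite /phi.
  case: eqVneq => [_|wz0]; first by rewrite subrr cabs0.
  have := H (w - z); rewrite subr0 subr_eq0 => /(_ wz wz0).
  rewrite /dquot /= /shift /=.
  have -> : ((w - z : C) *: (1 : C) + z) = w by rewrite -[_ *: _]/(_ * _) mulr1 subrK.
  by rewrite -[_ *: _]/(_ * _) mulrC.
move=> [phi [cphi <-] fE].
apply: (proj2 (@cvg_cabsP _ (dnbhs (0 : C)) (dnbhs_filter _) _ _)).
move=> e e0; have /nbhs_cabsP[d d0 H] := cphi e e0.
change (nbhs (0 : C) (fun h : C => h != 0 -> cabs (dquot f z h - phi z) < e)).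
apply/nbhs_cabsP; exists d => // h; rewrite subr0 => hd h0.
rewrite /dquot /= /shift /=.
have -> : ((h : C) *: (1 : C) + z) = h + z by rewrite -[_ *: _]/(_ * _) mulr1.
rewrite fE addrK (addrC (f z)) addrK -[_ *: _]/(_ * _) mulrCA mulVf// mulr1.
by apply: H; rewrite addrK.
Qed.

Lemma derivable_cder f z : derivable f z 1 <-> exists c, cder f z c.
Proof.
split.
  by move=> /cvg_ex[c /cder_cvg]; exists c.
by move=> [c /cder_cvg H]; apply/cvg_ex; exists c.
Qed.

Lemma derive_cder f z c : cder f z c -> 'D_1 f z = c.
Proof. by move=> /cder_cvg H; apply/cvg_lim. Qed.

End ComplexPlane.

(** * Integrals of complex-valued functions over segments *)

Section SegmentIntegral.
Variable R : realType.
Local Notation C := (Cplane R).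
Local Notation mu := (@lebesgue_measure R).
Implicit Types (a b : R) (g : R -> C) (k : C).

(** Full neighbourhoods in the real line are taken even at the endpoints: the integrands are
    restrictions of functions that are continuous at these points in the plane. *)
Definition cont_on a b g := forall t : R, a <= t <= b -> cto (nbhs t) g (g t).

Definition cint a b g : C :=
  Complex (\int[mu]_(t in `[a, b]) complex.Re (g t))
          (\int[mu]_(t in `[a, b]) complex.Im (g t)).

Lemma cont_on_sub a b a' b' g : a <= a' -> b' <= b ->
  cont_on a b g -> cont_on a' b' g.
Proof. by move=> aa bb cg t tab; apply: cg; lra. Qed.

Lemma cont_on_cst a b k : cont_on a b (fun=> k).
Proof. by move=> t _; exact: (@cto_cst _ _ _ (nbhs_filter t)). Qed.

Lemma cont_onB a b g1 g2 : cont_on a b g1 -> cont_on a b g2 ->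
  cont_on a b (fun t => g1 t - g2 t).
Proof.
move=> c1 c2 t tab; apply: (@ctoB _ _ _ (nbhs_filter t)); first exact: c1.
exact: c2.
Qed.

Lemma cont_onZ a b k g : cont_on a b g -> cont_on a b (fun t => k * g t).
Proof.
move=> cg t tab; apply: (@ctoM _ _ _ (nbhs_filter t)); last exact: cg.
exact: (@cto_cst _ _ _ (nbhs_filter t)).
Qed.

(** Only the Lipschitz bound on [p] matters, so that real and imaginary parts are treated
    together. *)
Lemma contRe_integrable (p : C -> R) a b g :
  (forall z w : C, `|p z - p w| <= cabs (z - w)) ->
  cont_on a b g -> mu.-integrable `[a, b] (EFin \o (fun t => p (g t))).
Proof.
move=> pl cg; apply: continuous_compact_integrable; first exact: segment_compact.
apply: continuous_in_subspaceT => t; rewrite inE/= in_itv/= => tab.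
apply: (proj2 (cvg_absP (nbhs_filter t) _ _)) => e e0.
have := cg t tab _ e0.
apply: (@filterS _ _ (nbhs_filter t)) => s.
by apply: le_lt_trans; exact: pl.
Qed.

Lemma Re_integrable a b g : cont_on a b g ->
  mu.-integrable `[a, b] (EFin \o (fun t => complex.Re (g t))).
Proof.
apply: contRe_integrable => z w; apply: le_trans (Re_le_cabs _).
by case: z w => [? ?] [? ?] /=.
Qed.

Lemma Im_integrable a b g : cont_on a b g ->
  mu.-integrable `[a, b] (EFin \o (fun t => complex.Im (g t))).
Proof.
apply: contRe_integrable => z w; apply: le_trans (Im_le_cabs _).
by case: z w => [? ?] [? ?] /=.
Qed.

Let mI a b : @measurable _ (measurableTypeR R) `[a, b]%classic.
Proof. exact: measurable_itv. Qed.

Lemma eq_cint a b g1 g2 : (forall t : R, a <= t <= b -> g1 t = g2 t) ->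
  cint a b g1 = cint a b g2.
Proof.
move=> e; congr Complex; apply: eq_Rintegral => t.
  by rewrite inE/= in_itv/= => /e ->.
by rewrite inE/= in_itv/= => /e ->.
Qed.

Lemma cintD a b g1 g2 : cont_on a b g1 -> cont_on a b g2 ->
  cint a b (fun t => g1 t + g2 t) = cint a b g1 + cint a b g2.
Proof.
move=> c1 c2; rewrite /cint.
rewrite -[RHS]/(Complex (_ + _) (_ + _)).
rewrite -(RintegralD (mI a b) (Re_integrable c1) (Re_integrable c2)).
rewrite -(RintegralD (mI a b) (Im_integrable c1) (Im_integrable c2)).
by congr Complex; apply: eq_Rintegral => t _; case: (g1 t) (g2 t) => [? ?] [? ?].
Qed.

Lemma cintZ a b k g : cont_on a b g ->
  cint a b (fun t => k * g t) = k * cint a b g.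
Proof.
move=> cg; case: k => kr ki; rewrite /cint.
rewrite -[RHS]/(Complex (kr * _ - ki * _) (kr * _ + ki * _)).
have iR := Re_integrable cg; have iI := Im_integrable cg.
have intZ (l : R) h : mu.-integrable `[a, b] (EFin \o h) ->
    mu.-integrable `[a, b] (EFin \o (fun t => l * h t)).
  by move=> ih; have := integrableZl (mI a b) l ih; exact: eq_integrable.
rewrite -!(RintegralZl _ (mI a b))//.
rewrite -(RintegralB (mI a b) (intZ kr _ iR) (intZ ki _ iI)).
rewrite -(RintegralD (mI a b) (intZ kr _ iI) (intZ ki _ iR)).
by congr Complex; apply: eq_Rintegral => t _; case: (g t) => [? ?].
Qed.

Lemma cintB a b g1 g2 : cont_on a b g1 -> cont_on a b g2 ->
  cint a b (fun t => g1 t - g2 t) = cint a b g1 - cint a b g2.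
Proof.
move=> c1 c2; rewrite -[in RHS]mulN1r -cintZ// -cintD//; last exact: cont_onZ.
by apply: eq_cint => t _; rewrite mulN1r.
Qed.

Lemma mu_itv a b : a <= b -> fine (mu `[a, b]%classic) = b - a.
Proof.
move=> ab; rewrite lebesgue_measure_itv/= lte_fin; case: ltP => //= ba.
by rewrite (le_anti (introT andP (conj ab ba))) subrr.
Qed.

Lemma cint_cst a b k : a <= b -> cint a b (fun=> k) = ((b - a)%:C)%C * k.
Proof.
move=> ab; rewrite /cint !Rintegral_cst ?mu_itv//; try exact: mI.
by case: k => ? ?; congr Complex => /=; ring.
Qed.

(** The factor 2 comes from bounding real and imaginary parts separately; a crude constant is
    harmless in all the uses. *)
Lemma cint_le a b g (M : R) : a <= b -> cont_on a b g ->
  (forall t : R, a <= t <= b -> cabs (g t) <= M) ->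
  cabs (cint a b g) <= 2 * (b - a) * M.
Proof.
move=> ab cg gM.
have aux (p : C -> R) : (forall z, `|p z| <= cabs z) ->
    mu.-integrable `[a, b] (EFin \o (fun t => p (g t))) ->
    `|\int[mu]_(t in `[a, b]) p (g t)| <= (b - a) * M.
  move=> pc ip; apply: le_trans (le_normr_Rintegral (mI a b) ip) _.
  rewrite -(mu_itv ab) mulrC -Rintegral_cst; last exact: mI.
  apply: le_Rintegral; first exact: mI.
  - exact: (integrable_norm ip).
  - apply: continuous_compact_integrable; first exact: segment_compact.
    by apply: continuous_subspaceT => t; exact: cst_continuous.
  - move=> t; rewrite /= in_itv/= => tab.
    exact: le_trans (pc _) (gM t tab).
apply: le_trans (cabs_le_ReIm _) _ => /=.
have h1 := aux _ (@Re_le_cabs R) (Re_integrable cg).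
have h2 := aux _ (@Im_le_cabs R) (Im_integrable cg).
by move: h1 h2; clear; lra.
Qed.

Lemma cint_split a c b g : a <= c -> c <= b -> cont_on a b g ->
  cint a b g = cint a c g + cint c b g.
Proof.
move=> ac cb cg.
have aux (h : R -> R) : mu.-integrable `[a, b] (EFin \o h) ->
    \int[mu]_(t in `[a, b]) h t =
    \int[mu]_(t in `[a, c]) h t + \int[mu]_(t in `[c, b]) h t.
  move=> ih; rewrite -(@Rintegral_itv_obnd_cbnd _ c (BRight b) h); last first.
    apply: (integrableS _ _ _ ih); [exact: mI|exact: measurable_itv|].
    move=> t /=; rewrite !in_itv/=; lra.
  rewrite -(@Rintegral_itvB _ h (BLeft a) (BRight b) c ih) ?bnd_simp//.
  by rewrite addrC subrK.
rewrite /cint -[RHS]/(Complex (_ + _) (_ + _)).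
by rewrite (aux _ (Re_integrable cg)) (aux _ (Im_integrable cg)).
Qed.

End SegmentIntegral.

(** * Integrals along the boundary of a rectangle, and bisection of rectangles *)

Section Goursat.
Variable R : realType.
Local Notation C := (Cplane R).
Implicit Types (x y w h : R) (f g : C -> C) (z k c : C).

Lemma cto_Complexl (t y : R) : cto (nbhs t) (fun s : R => Complex s y : C) (Complex t y).
Proof.
move=> e e0; apply/nbhs_normP; exists e => //= s; rewrite /ball_/= distrC => st.
change (cabs (Complex (s - t) (y - y)) < e); rewrite subrr.
by rewrite -[Complex _ 0]/((s - t)%:C)%C cabs_real.
Qed.

Lemma cto_Complexr (x t : R) : cto (nbhs t) (fun s : R => Complex x s : C) (Complex x t).
Proof.
move=> e e0; apply/nbhs_normP; exists e => //= s; rewrite /ball_/= distrC => st.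
by change (cabs (Complex (x - x) (s - t)) < e); rewrite subrr cabs_imag.
Qed.

Definition in_rect x y w h (z : C) : Prop :=
  x <= complex.Re z <= x + w /\ y <= complex.Im z <= y + h.

Definition in_sides x y w h (z : C) : Prop := in_rect x y w h z /\
  [\/ complex.Re z = x, complex.Re z = x + w, complex.Im z = y
    | complex.Im z = y + h].

Lemma ccont_hline f (a b y : R) :
  (forall t : R, a <= t <= b -> ccont f (Complex t y)) ->
  cont_on a b (fun t : R => f (Complex t y)).
Proof.
move=> cf t tab.
exact: (@cto_comp _ _ _ (nbhs_filter t) _ f _ (@cto_Complexl t y) (cf t tab)).
Qed.

Lemma ccont_vline f (a b x : R) :
  (forall t : R, a <= t <= b -> ccont f (Complex x t)) ->
  cont_on a b (fun t : R => f (Complex x t)).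
Proof.
move=> cf t tab.
exact: (@cto_comp _ _ _ (nbhs_filter t) _ f _ (@cto_Complexr x t) (cf t tab)).
Qed.

(* Integral of [f] along the positively oriented boundary of
   [x, x + w] x [y, y + h]. *)
Definition rint f x y w h : C :=
  cint x (x + w) (fun t : R => f (Complex t y) - f (Complex t (y + h))) +
  (Complex 0 1 : C) *
  cint y (y + h) (fun t : R => f (Complex (x + w) t) - f (Complex x t)).

Definition cont_sides f x y w h := forall z, in_sides x y w h z -> ccont f z.

Local Ltac rect_arith :=
  by split => /=; rewrite ?lexx ?andbT ?lerDl //; try lra.

Section Sides.
Variables (x y w h : R).
Hypotheses (w0 : 0 <= w) (h0 : 0 <= h).

Lemma cont_bottom f : cont_sides f x y w h ->
  cont_on x (x + w) (fun t : R => f (Complex t y)).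
Proof.
move=> cf; apply: ccont_hline => t tab; apply: cf; split.
  rect_arith.
by constructor 3.
Qed.

Lemma cont_top f : cont_sides f x y w h ->
  cont_on x (x + w) (fun t : R => f (Complex t (y + h))).
Proof.
move=> cf; apply: ccont_hline => t tab; apply: cf; split.
  rect_arith.
by constructor 4.
Qed.

Lemma cont_left f : cont_sides f x y w h ->
  cont_on y (y + h) (fun t : R => f (Complex x t)).
Proof.
move=> cf; apply: ccont_vline => t tab; apply: cf; split.
  rect_arith.
by constructor 1.
Qed.

Lemma cont_right f : cont_sides f x y w h ->
  cont_on y (y + h) (fun t : R => f (Complex (x + w) t)).
Proof.
move=> cf; apply: ccont_vline => t tab; apply: cf; split.
  rect_arith.
by constructor 2.
Qed.

Let cont_h f : cont_sides f x y w h ->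
  cont_on x (x + w) (fun t : R => f (Complex t y) - f (Complex t (y + h))).
Proof. by move=> cf; apply: cont_onB; [exact: cont_bottom|exact: cont_top]. Qed.

Let cont_v f : cont_sides f x y w h ->
  cont_on y (y + h) (fun t : R => f (Complex (x + w) t) - f (Complex x t)).
Proof. by move=> cf; apply: cont_onB; [exact: cont_right|exact: cont_left]. Qed.

Lemma eq_rint f g : (forall z, in_sides x y w h z -> f z = g z) ->
  rint f x y w h = rint g x y w h.
Proof.
move=> fg; congr (_ + _ * _); apply: eq_cint => t tab; congr (_ - _); apply: fg;
  split; try rect_arith.
- by constructor 3.
- by constructor 4.
- by constructor 2.
- by constructor 1.
Qed.

Lemma rintD f g : cont_sides f x y w h -> cont_sides g x y w h ->
  rint (fun z => f z + g z) x y w h = rint f x y w h + rint g x y w h.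
Proof.
move=> cf cg; rewrite /rint.
rewrite (eq_cint (g2 := fun t : R => (f (Complex t y) - f (Complex t (y + h)))
  + (g (Complex t y) - g (Complex t (y + h))))); last by move=> t _; ring.
rewrite [X in _ + _ * X](eq_cint (g2 := fun t : R =>
  (f (Complex (x + w) t) - f (Complex x t))
  + (g (Complex (x + w) t) - g (Complex x t)))); last by move=> t _; ring.
by rewrite (cintD (cont_h cf) (cont_h cg)) (cintD (cont_v cf) (cont_v cg)); ring.
Qed.

Lemma rintZ k f : cont_sides f x y w h ->
  rint (fun z => k * f z) x y w h = k * rint f x y w h.
Proof.
move=> cf; rewrite /rint.
rewrite (eq_cint (g2 := fun t : R =>
  k * (f (Complex t y) - f (Complex t (y + h))))); last by move=> t _; ring.
rewrite [X in _ + _ * X](eq_cint (g2 := fun t : R =>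
  k * (f (Complex (x + w) t) - f (Complex x t)))); last by move=> t _; ring.
by rewrite (cintZ _ (cont_h cf)) (cintZ _ (cont_v cf)); ring.
Qed.

(** One factor 2 comes from [cint_le], the other from the difference of the values on opposite
    sides. *)
Lemma rint_le f (M : R) : cont_sides f x y w h ->
  (forall z, in_sides x y w h z -> cabs (f z) <= M) ->
  cabs (rint f x y w h) <= 4 * (w + h) * M.
Proof.
move=> cf fM; apply: le_trans (cabsD _ _) _.
have tri a b : cabs (f a) <= M -> cabs (f b) <= M -> cabs (f a - f b) <= 2 * M.
  move=> h1 h2; apply: le_trans (cabsD _ _) _; rewrite cabsN; move: h1 h2.
  by set p := cabs _; set q := cabs _; lra.
rewrite cabsM cabs_imag normr1 mul1r.
have H1 : cabs (cint x (x + w) (fun t : R => f (Complex t y) - f (Complex t (y + h))))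
   <= 2 * (x + w - x) * (2 * M).
  apply: cint_le; [by rewrite lerDl|exact: cont_h|].
  move=> t tab; apply: tri; apply: fM; split; try rect_arith.
    by constructor 3.
  by constructor 4.
have H2 : cabs (cint y (y + h) (fun t : R => f (Complex (x + w) t) - f (Complex x t)))
   <= 2 * (y + h - y) * (2 * M).
  apply: cint_le; [by rewrite lerDl|exact: cont_v|].
  move=> t tab; apply: tri; apply: fM; split; try rect_arith.
    by constructor 2.
  by constructor 1.
apply: le_trans (lerD H1 H2) _; rewrite !(addrC _ w) !(addrC _ h) !addrK.
by rewrite le_eqVlt; apply/orP; left; apply/eqP; ring.
Qed.

(** The horizontal sides contribute [- c * i h] over a length [w], the vertical ones [c * w] over a
    length [h], multiplied by [i]; the two cancel. *)
Lemma rint_affine k c : rint (fun z => k + c * z) x y w h = 0.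
Proof.
rewrite /rint.
rewrite (eq_cint (g2 := fun=> - c * Complex 0 h)); last first.
  move=> t _; have -> : (Complex t (y + h) : C) = Complex t y + Complex 0 h.
    by rewrite -[RHS]/(Complex (t + 0) (y + h)) addr0.
  by ring.
rewrite [X in _ + _ * X](eq_cint (g2 := fun=> c * (w%:C)%C)); last first.
  move=> t _; have -> : (Complex (x + w) t : C) = Complex x t + (w%:C)%C.
    by rewrite -[RHS]/(Complex (x + w) (t + 0)) addr0.
  by ring.
rewrite !cint_cst ?lerDl// !(addrC _ w) !(addrC _ h) !addrK.
have -> : (Complex 0 h : C) = Complex 0 1 * (h%:C)%C.
  by rewrite -[RHS]/(Complex (0 * h - 1 * 0) (0 * 0 + 1 * h)); congr Complex; ring.
by ring.
Qed.

End Sides.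

Lemma rint_splitx f x y w1 w2 h : 0 <= w1 -> 0 <= w2 -> 0 <= h ->
  cont_sides f x y w1 h -> cont_sides f (x + w1) y w2 h ->
  rint f x y (w1 + w2) h = rint f x y w1 h + rint f (x + w1) y w2 h.
Proof.
move=> w10 w20 h0 c1 c2; rewrite /rint !addrA.
rewrite (@cint_split _ x (x + w1)) ?lerDl//; last first.
  have cb1 := cont_bottom h0 c1; have ct1 := cont_top h0 c1.
  have cb2 := cont_bottom h0 c2; have ct2 := cont_top h0 c2.
  move=> t tab; case: (leP t (x + w1)) => tw.
    by apply: (cont_onB cb1 ct1); lra.
  by apply: (cont_onB cb2 ct2); lra.
have cl1 := cont_left w10 c1; have cr1 := cont_right w10 c1.
have cl2 := cont_left w20 c2; have cr2 := cont_right w20 c2.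
rewrite [X in _ + _ * X](eq_cint (g2 := fun t : R =>
  (f (Complex (x + w1) t) - f (Complex x t)) +
  (f (Complex (x + w1 + w2) t) - f (Complex (x + w1) t)))); last first.
  by move=> t _; ring.
rewrite (cintD (cont_onB cr1 cl1) (cont_onB cr2 cl2)).
by ring.
Qed.

Lemma rint_splity f x y w h1 h2 : 0 <= w -> 0 <= h1 -> 0 <= h2 ->
  cont_sides f x y w h1 -> cont_sides f x (y + h1) w h2 ->
  rint f x y w (h1 + h2) = rint f x y w h1 + rint f x (y + h1) w h2.
Proof.
move=> w0 h10 h20 c1 c2; rewrite /rint !addrA.
rewrite [X in _ * X](@cint_split _ y (y + h1)) ?lerDl//; last first.
  have cb1 := cont_left w0 c1; have ct1 := cont_right w0 c1.
  have cb2 := cont_left w0 c2; have ct2 := cont_right w0 c2.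
  move=> t tab; case: (leP t (y + h1)) => tw.
    by apply: (cont_onB ct1 cb1); lra.
  by apply: (cont_onB ct2 cb2); lra.
have cl1 := cont_bottom h10 c1; have cr1 := cont_top h10 c1.
have cl2 := cont_bottom h20 c2; have cr2 := cont_top h20 c2.
rewrite (eq_cint (g2 := fun t : R =>
  (f (Complex t y) - f (Complex t (y + h1))) +
  (f (Complex t (y + h1)) - f (Complex t (y + h1 + h2))))); last first.
  by move=> t _; ring.
rewrite (cintD (cont_onB cl1 cr1) (cont_onB cl2 cr2)).
by ring.
Qed.

Lemma lt_divr_pow2 (w d : R) : 0 < d -> exists n : nat, forall m, (n <= m)%N ->
  w / 2 ^+ m < d.
Proof.
move=> d0; have [n wn] : exists n : nat, w / d < n%:R.
  exists (Num.truncn `|w / d|).+1; apply: le_lt_trans (ler_norm _) _.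
  exact: truncnS_gt.
exists n => m nm; rewrite ltr_pdivrMr ?exprn_gt0//.
rewrite -ltr_pdivrMl// mulrC; apply: lt_le_trans wn _.
rewrite -natrX ler_nat; apply: leq_trans nm _.
exact/ltnW/ltn_expl.
Qed.

(** Otherwise some quarter fails, then a quarter of it, and so on; the failing rectangles shrink to
    a point, where the local hypothesis is contradicted. This is the compactness argument of
    Cousin's lemma, with the tag point inside the small rectangle. It also serves intervals, as
    rectangles of height 0. *)
Lemma rect_bisect (P : R -> R -> R -> R -> Prop) x y w h : 0 <= w -> 0 <= h ->
  (forall x' y' w' h', 0 <= w' -> 0 <= h' ->
    x <= x' -> y <= y' -> x' + (w' + w') <= x + w -> y' + (h' + h') <= y + h ->
    P x' y' w' h' -> P (x' + w') y' w' h' ->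
    P x' (y' + h') w' h' -> P (x' + w') (y' + h') w' h' ->
    P x' y' (w' + w') (h' + h')) ->
  (forall a b, x <= a <= x + w -> y <= b <= y + h -> exists2 d : R, 0 < d &
    forall x' y' w' h', 0 <= w' -> 0 <= h' ->
    x <= x' -> y <= y' -> x' + w' <= x + w -> y' + h' <= y + h ->
    x' <= a <= x' + w' -> y' <= b <= y' + h' -> w' < d -> h' < d ->
    P x' y' w' h') ->
  P x y w h.
Proof.
move=> w0 h0 quarter loc; apply: contrapT => nP.
pose W n := w / 2 ^+ n; pose H n := h / 2 ^+ n.
have W2 n : W n = W n.+1 + W n.+1 by rewrite /W exprS; field; exact: expf_neq0.
have H2 n : H n = H n.+1 + H n.+1 by rewrite /H exprS; field; exact: expf_neq0.
have W0 n : 0 <= W n by rewrite divr_ge0// exprn_ge0.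
have H0 n : 0 <= H n by rewrite divr_ge0// exprn_ge0.
pose inv n (p : R * R) := [/\ x <= p.1, p.1 + W n <= x + w, y <= p.2,
  p.2 + H n <= y + h & ~ P p.1 p.2 (W n) (H n)].
pose step n (p q : R * R) := [/\ p.1 <= q.1, q.1 + W n.+1 <= p.1 + W n,
  p.2 <= q.2 & q.2 + H n.+1 <= p.2 + H n].
(* [F] selects a failing quarter of a failing rectangle. Only lower left corners are recorded: the
   sizes [W n] and [H n] are determined by the generation [n]. *)
have [F FP] : {F : nat * (R * R) -> R * R & forall np, inv np.1 np.2 ->
    inv np.1.+1 (F np) /\ step np.1 np.2 (F np)}.
  apply: (@choice _ _ (fun np q => inv np.1 np.2 ->
    inv np.1.+1 q /\ step np.1 np.2 q)).
  move=> [n [p1 p2]] /=.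
  have [[/= i1 i2 i3 i4 i5]|ni] := pselect (inv n (p1, p2)); last by exists (0, 0) => /ni.
  have Wn := W0 n.+1; have Hn := H0 n.+1.
  move: i2 i4 i5; rewrite /inv /step/= (W2 n) (H2 n) => i2 i4 i5.
  have [P1|P1] := pselect (P p1 p2 (W n.+1) (H n.+1)); last first.
    by exists (p1, p2) => _; split; split => //=; clear -i1 i2 i3 i4 Wn Hn; lra.
  have [P2|P2] := pselect (P (p1 + W n.+1) p2 (W n.+1) (H n.+1)); last first.
    exists (p1 + W n.+1, p2) => _.
    by split; split => //=; clear -i1 i2 i3 i4 Wn Hn; lra.
  have [P3|P3] := pselect (P p1 (p2 + H n.+1) (W n.+1) (H n.+1)); last first.
    exists (p1, p2 + H n.+1) => _.
    by split; split => //=; clear -i1 i2 i3 i4 Wn Hn; lra.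
  have [P4|P4] := pselect (P (p1 + W n.+1) (p2 + H n.+1) (W n.+1) (H n.+1)); last first.
    exists (p1 + W n.+1, p2 + H n.+1) => _.
    by split; split => //=; clear -i1 i2 i3 i4 Wn Hn; lra.
  by exfalso; apply: i5; exact: quarter.
pose fix s n := if n is m.+1 then F (m, s m) else (x, y).
have sinv n : inv n (s n).
  elim: n => [|n IH]; last by have [] := FP (n, s n) IH.
  by rewrite /inv /W /H /= expr0 !divr1; split.
have sstep n : step n (s n) (s n.+1) by have [] := FP (n, s n) (sinv n).
have smono n m : (n <= m)%N -> [/\ (s n).1 <= (s m).1,
    (s m).1 + W m <= (s n).1 + W n, (s n).2 <= (s m).2 &
    (s m).2 + H m <= (s n).2 + H n].
  move=> /subnK <-; elim: (m - n)%N => [|k [a1 a2 a3 a4]]; first by rewrite add0n.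
  have [b1 b2 b3 b4] := sstep (k + n)%N; rewrite addSn.
  by split; [exact: le_trans a1 b1|exact: le_trans b2 a2|
             exact: le_trans a3 b3|exact: le_trans b4 a4].
(* Applied to each coordinate: the supremum of the left ends of nested intervals lies in all of
   them. *)
have limit (u : nat -> R) (V : nat -> R) : (forall n, 0 <= V n) ->
    (forall n m, (n <= m)%N -> u n <= u m /\ u m + V m <= u n + V n) ->
    exists a, forall n, u n <= a <= u n + V n.
  move=> V0 uV; exists (sup (range u)) => n.
  have ub m : ubound (range u) (u m + V m).
    move=> _ [k _ <-]; case: (leqP k m) => km.
      have [h1 _] := uV k m km; have := V0 m; move: h1; clear; lra.
    have [_ h1] := uV m k (ltnW km); have := V0 k; move: h1; clear; lra.
  apply/andP; split.
    by apply: ub_le_sup; [exists (u n + V n); exact: ub|exists n].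
  by apply: ge_sup; [exists (u n), n|exact: ub].
have [a aP] : exists a, forall n, (s n).1 <= a <= (s n).1 + W n.
  by apply: limit => // n m /smono[].
have [b bP] : exists b, forall n, (s n).2 <= b <= (s n).2 + H n.
  by apply: limit => // n m /smono[].
have := aP 0%N; have := bP 0%N; rewrite /W /H /= expr0 !divr1 => yb xa.
have [d d0 dP] := loc a b xa yb.
have [n1 n1P] := lt_divr_pow2 w d0; have [n2 n2P] := lt_divr_pow2 h d0.
pose n := maxn n1 n2.
have [i1 i2 i3 i4 i5] := sinv n; apply: i5; apply: dP => //.
- by apply: n1P; rewrite leq_maxl.
- by apply: n2P; rewrite leq_maxr.
Qed.

End Goursat.

(** * Goursat's theorem and isolated exceptional points *)

Section CauchyFormula.
Variable R : realType.
Local Notation C := (Cplane R).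
Implicit Types (x y w h a b d : R) (f g : C -> C) (z k c p q : C).

Lemma in_rect_sub x y w h x' y' w' h' z : x <= x' -> y <= y' ->
  x' + w' <= x + w -> y' + h' <= y + h ->
  in_rect x' y' w' h' z -> in_rect x y w h z.
Proof. by move=> ? ? ? ? [? ?]; split; lra. Qed.

Lemma dist_in_rect x y w h p q : in_rect x y w h p -> in_rect x y w h q ->
  cabs (p - q) <= w + h.
Proof.
move=> [p1 p2] [q1 q2]; apply: le_trans (cabs_le_ReIm _) _.
have -> : complex.Re (p - q) = complex.Re p - complex.Re q.
  by case: (p) (q) => ? ? [? ?].
have -> : complex.Im (p - q) = complex.Im p - complex.Im q.
  by case: (p) (q) => ? ? [? ?].
by apply: lerD; rewrite ler_norml; lra.
Qed.

(** The bound [e * (w + h) ^ 2] is quadratic in the size, hence adds up exactly over four quarters.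
    On a small rectangle around a point, [f] is affine up to an error [e / 4 * (w' + h')], the
    affine part integrates to 0, and the boundary estimate supplies the other factor
    [4 * (w' + h')]. *)
Theorem goursat f x y w h : 0 <= w -> 0 <= h ->
  (forall z, in_rect x y w h z -> exists c, cder f z c) ->
  rint f x y w h = 0.
Proof.
move=> w0 h0 df.
have cf z : in_rect x y w h z -> ccont f z by move=> /df[c /cder_cont].
suff H (e : R) : 0 < e -> cabs (rint f x y w h) <= e * (w + h) ^+ 2.
  apply/eqP; rewrite -cabs_eq0 eq_le cabs_ge0 andbT.
  apply/ler_addgt0Pl => e e0; rewrite addr0.
  have k0 : 0 < (w + h) ^+ 2 + 1 by rewrite ltr_wpDl ?sqr_ge0.
  apply: le_trans (H (e / ((w + h) ^+ 2 + 1)) _) _; first exact: divr_gt0.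
  rewrite -mulrA ler_piMr//; first exact: ltW.
  by rewrite ler_pdivrMl// mulr1 lerDl.
move=> e0; apply: (@rect_bisect _
  (fun x y w h => cabs (rint f x y w h) <= e * (w + h) ^+ 2)) => //.
  move=> x' y' w' h' w'0 h'0 xx yy xw yh.
  have cs x1 y1 : x <= x1 -> y <= y1 -> x1 + w' <= x + w ->
      y1 + h' <= y + h -> cont_sides f x1 y1 w' h'.
    by move=> ? ? ? ? z [/in_rect_sub H _]; apply: cf; exact: H.
  have c1 : cont_sides f x' y' w' h' by apply: cs; lra.
  have c2 : cont_sides f (x' + w') y' w' h' by apply: cs; lra.
  have c3 : cont_sides f x' (y' + h') w' h' by apply: cs; lra.
  have c4 : cont_sides f (x' + w') (y' + h') w' h' by apply: cs; lra.
  have hh : 0 <= h' + h' by lra.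
  have d1 : cont_sides f x' y' w' (h' + h').
    by move=> z [/in_rect_sub H _]; apply: cf; apply: H; lra.
  have d2 : cont_sides f (x' + w') y' w' (h' + h').
    by move=> z [/in_rect_sub H _]; apply: cf; apply: H; lra.
  rewrite (rint_splitx w'0 w'0 hh d1 d2) (rint_splity w'0 h'0 h'0 c1 c3).
  rewrite (rint_splity w'0 h'0 h'0 c2 c4) => p1 p2 p3 p4.
  apply: le_trans (cabsD _ _) _; apply: le_trans (lerD (cabsD _ _) (cabsD _ _)) _.
  have -> : e * (w' + w' + (h' + h')) ^+ 2 = e * (w' + h') ^+ 2 + e * (w' + h') ^+ 2
    + (e * (w' + h') ^+ 2 + e * (w' + h') ^+ 2) by ring.
  exact: lerD (lerD p1 p3) (lerD p2 p4).
move=> a b xa yb; have zin : in_rect x y w h (Complex a b) by [].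
have [c [phi [cphi phic] fE]] := df _ zin.
have e4 : 0 < e / 4 by lra.
have /ccontP/(_ _ e4)[d d0 dP] := cphi.
(* Both sides below [d / 2] put the whole rectangle within [d] of the point. *)
exists (d / 2); first lra.
move=> x' y' w' h' w'0 h'0 xx yy xw yh xa' yb' wd hd.
pose k := f (Complex a b) - c * Complex a b.
have inr z : in_rect x' y' w' h' z -> in_rect x y w h z by exact: in_rect_sub.
have z'in : in_rect x' y' w' h' (Complex a b) by [].
have ca : cont_sides (fun z => k + c * z) x' y' w' h'.
  move=> z _; apply: (@ctoD _ _ _ (nbhs_filter z)).
    exact: (@cto_cst _ _ _ (nbhs_filter z)).
  apply: (@ctoM _ _ _ (nbhs_filter z)); last exact: ccont_id.
  exact: (@cto_cst _ _ _ (nbhs_filter z)).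
have cs : cont_sides f x' y' w' h' by move=> z [zr _]; apply: cf; exact: inr.
pose r z := f z - (k + c * z).
have cr : cont_sides r x' y' w' h'.
  by move=> z zr; apply: (@ctoB _ _ _ (nbhs_filter z)); [exact: cs|exact: ca].
have -> : rint f x' y' w' h' = rint r x' y' w' h'.
  rewrite (eq_rint w'0 h'0 (g := fun z => r z + (k + c * z))); last first.
    by move=> z _; rewrite /r subrK.
  by rewrite rintD// rint_affine// addr0.
have rE z : r z = (phi z - c) * (z - Complex a b) by rewrite /r /k fE; ring.
apply: le_trans (rint_le w'0 h'0 (M := e / 4 * (w' + h')) cr _) _; last first.
  have -> : 4 * (w' + h') * (e / 4 * (w' + h')) = e * (w' + h') ^+ 2 by field.
  exact: lexx.
move=> z [zr _]; rewrite rE cabsM.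
have zd := dist_in_rect zr z'in.
apply: ler_pM; rewrite ?cabs_ge0//.
rewrite -phic; apply/ltW/dP; apply: le_lt_trans zd _; lra.
Qed.

Lemma cder_cont_sides f x y w h :
  (forall z, in_sides x y w h z -> exists c, cder f z c) -> cont_sides f x y w h.
Proof. by move=> df z /df[c /cder_cont]. Qed.

(** The strips on the left, on the right, below and above are cut off in turn; each misses the
    exceptional point, so Goursat's theorem applies to it. The sums of lengths are nested in the
    order in which the cuts are made. *)
Lemma rint_ring g a b d w1 w2 h1 h2 :
  0 < d -> 0 <= w1 -> 0 <= w2 -> 0 <= h1 -> 0 <= h2 ->
  (forall z, in_rect (a - d - w1) (b - d - h1) (w1 + ((d + d) + w2))
      (h1 + ((d + d) + h2)) z -> z != Complex a b -> exists c, cder g z c) ->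
  rint g (a - d - w1) (b - d - h1) (w1 + ((d + d) + w2)) (h1 + ((d + d) + h2)) =
  rint g (a - d) (b - d) (d + d) (d + d).
Proof.
move=> d0 w10 w20 h10 h20 dg.
have off z : complex.Re z <> a \/ complex.Im z <> b -> z != Complex a b.
  by move=> ab; apply/eqP => zE; move: ab; rewrite zE => -[].
have cs x' y' w' h' : 0 <= w' -> 0 <= h' ->
    a - d - w1 <= x' -> b - d - h1 <= y' ->
    x' + w' <= a + d + w2 -> y' + h' <= b + d + h2 ->
    x' != a -> x' + w' != a -> y' != b -> y' + h' != b ->
    cont_sides g x' y' w' h'.
  move=> w'0 h'0 i1 i2 i3 i4 /eqP n1 /eqP n2 /eqP n3 /eqP n4.
  apply: cder_cont_sides => z [zr zs]; apply: dg.
    by apply: in_rect_sub zr; lra.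
  by apply: off; case: zs => ->; [left|left|right|right].
have gs x' y' w' h' : 0 <= w' -> 0 <= h' ->
    a - d - w1 <= x' -> b - d - h1 <= y' ->
    x' + w' <= a + d + w2 -> y' + h' <= b + d + h2 ->
    [\/ x' + w' < a, a < x', y' + h' < b | b < y'] ->
    rint g x' y' w' h' = 0.
  move=> w'0 h'0 i1 i2 i3 i4 n.
  apply: goursat => // z zr; apply: dg.
    by apply: in_rect_sub zr; lra.
  apply: off; case: zr => z1 z2.
  by case: n => n; [left|left|right|right] => E; move: z1 z2; rewrite E; lra.
have ne (u v : R) : u < v \/ v < u -> u != v.
  by move=> [|] uv; [rewrite lt_eqF|rewrite gt_eqF].
have dd : 0 <= d + d by lra.
have Wr : 0 <= d + d + w2 by lra.
have Hr : 0 <= d + d + h2 by lra.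
have H0 : 0 <= h1 + (d + d + h2) by lra.
have -> : rint g (a - d - w1) (b - d - h1) (w1 + (d + d + w2)) (h1 + (d + d + h2)) =
    rint g (a - d) (b - d - h1) (d + d + w2) (h1 + (d + d + h2)).
  rewrite rint_splitx//; last 2 first.
  - by apply: cs => //; try (apply: ne); lra.
  - by apply: cs => //; try (apply: ne); lra.
  rewrite [X in X + _]gs ?add0r ?subrK//; try lra.
  by constructor 1; lra.
have -> : rint g (a - d) (b - d - h1) (d + d + w2) (h1 + (d + d + h2)) =
    rint g (a - d) (b - d - h1) (d + d) (h1 + (d + d + h2)).
  rewrite rint_splitx//; last 2 first.
  - by apply: cs => //; try (apply: ne); lra.
  - by apply: cs => //; try (apply: ne); lra.
  rewrite [X in _ + X]gs ?addr0//; try lra.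
  by constructor 2; lra.
have -> : rint g (a - d) (b - d - h1) (d + d) (h1 + (d + d + h2)) =
    rint g (a - d) (b - d) (d + d) (d + d + h2).
  rewrite rint_splity//; last 2 first.
  - by apply: cs => //; try (apply: ne); lra.
  - by apply: cs => //; try (apply: ne); lra.
  rewrite [X in X + _]gs ?add0r ?subrK//; try lra.
  by constructor 3; lra.
rewrite rint_splity//; last 2 first.
- by apply: cs => //; try (apply: ne); lra.
- by apply: cs => //; try (apply: ne); lra.
rewrite [X in _ + X]gs ?addr0//; try lra.
by constructor 4; lra.
Qed.

Definition in_interior x y w h (z : C) : Prop :=
  x < complex.Re z < x + w /\ y < complex.Im z < y + h.

Lemma rint_around g x y w h p : in_interior x y w h p ->
  (forall z, in_rect x y w h z -> z != p -> exists c, cder g z c) ->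
  exists2 d : R, 0 < d & forall d', 0 < d' -> d' <= d ->
    (forall z, in_rect (complex.Re p - d') (complex.Im p - d') (d' + d') (d' + d') z ->
      in_rect x y w h z) /\
    rint g x y w h =
    rint g (complex.Re p - d') (complex.Im p - d') (d' + d') (d' + d').
Proof.
case: p => a b [/= xa yb] dg.
exists (Num.min (Num.min (a - x) (x + w - a)) (Num.min (b - y) (y + h - b))).
  by rewrite !lt_min !subr_gt0; case/andP: xa => -> ->; case/andP: yb => -> ->.
move=> d' d'0; rewrite !le_min => /andP[/andP[i1 i2] /andP[i3 i4]].
split; first by move=> z; apply: in_rect_sub => /=; lra.
have := @rint_ring g a b d' (a - d' - x) (x + w - a - d') (b - d' - y) (y + h - b - d') d'0.
have -> : a - d' - (a - d' - x) = x by ring.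
have -> : b - d' - (b - d' - y) = y by ring.
have -> : a - d' - x + (d' + d' + (x + w - a - d')) = w by ring.
have -> : b - d' - y + (d' + d' + (y + h - b - d')) = h by ring.
by apply => //; lra.
Qed.

(** The boundary may be shrunk to an arbitrarily small square about [p], whose length tends to 0
    while [g] stays bounded. *)
Lemma rint_removable g x y w h p (M r : R) : in_interior x y w h p ->
  (forall z, in_rect x y w h z -> z != p -> exists c, cder g z c) ->
  0 < r -> (forall z, cabs (z - p) < r -> z != p -> cabs (g z) <= M) ->
  rint g x y w h = 0.
Proof.
move=> pin dg r0 gM; have [d d0 dP] := rint_around pin dg.
have [xp yp] := pin.
apply/eqP; rewrite -cabs_eq0 eq_le cabs_ge0 andbT.
apply/ler_addgt0Pl => e e0; rewrite addr0.
have M0 : 0 < `|M| + 1 by rewrite ltr_wpDl.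
(* The square of half side [s] has its points within [4 * s < r] of [p], and the boundary estimate
   on it is [16 * s * (|M| + 1)]. *)
pose s := Num.min (Num.min d (r / 8)) (e / (16 * (`|M| + 1))).
have s0 : 0 < s by rewrite !lt_min d0 !divr_gt0//= ?mulr_gt0.
have [sd [sr se]] : s <= d /\ s <= r / 8 /\ s * (16 * (`|M| + 1)) <= e.
  have : s <= s by []; rewrite {2}/s !le_min => /andP[/andP[-> ->]].
  by rewrite ler_pdivlMr ?mulr_gt0.
have dsmall : forall z, in_rect (complex.Re p - s) (complex.Im p - s) (s + s) (s + s) z ->
   cabs (z - p) <= s + s + (s + s).
  move=> z zr; apply: dist_in_rect zr _; split; lra.
have pE : p = Complex (complex.Re p) (complex.Im p) by case: (p).
have cs : cont_sides g (complex.Re p - s) (complex.Im p - s) (s + s) (s + s).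
  apply: cder_cont_sides => z [zr zs]; apply: dg.
    by have [inr _] := dP s s0 sd; exact: inr.
  by apply/eqP => zE; move: zs; rewrite zE => -[] ?; lra.
have [_ ->] := dP s s0 sd.
have ss0 : 0 <= s + s by lra.
apply: le_trans (rint_le ss0 ss0 (M := `|M| + 1) cs _) _; last first.
  apply: le_trans se; rewrite le_eqVlt; apply/orP; left; apply/eqP; ring.
move=> z [zr zs]; apply: le_trans (gM z _ _) _.
- by apply: le_lt_trans (dsmall z zr) _; lra.
- by apply/eqP => zE; move: zs; rewrite zE => -[] ?; lra.
- by apply: le_trans (ler_norm _) _; rewrite lerDl.
Qed.

End CauchyFormula.

(** * Cauchy's formula *)

Section Taylor.
Variable R : realType.
Local Notation C := (Cplane R).
Implicit Types (x y w h a b d : R) (f g : C -> C) (z k c p q : C).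

Lemma Im_add p q : complex.Im (p + q) = complex.Im p + complex.Im q.
Proof. by case: p q => ? ? [? ?]. Qed.

Lemma Im_sub p q : complex.Im (p - q) = complex.Im p - complex.Im q.
Proof. by case: p q => ? ? [? ?]. Qed.

Lemma Re_sub p q : complex.Re (p - q) = complex.Re p - complex.Re q.
Proof. by case: p q => ? ? [? ?]. Qed.

Lemma Im_muli p : complex.Im ((Complex 0 1 : C) * p) = complex.Re p.
Proof. by case: p => ? ?; rewrite /= mul0r mul1r add0r. Qed.

(** On a short interval of length [w'] both integrals are within [e / 2 * w'] of the same constant
    times [w']; bisection adds these errors up. *)
Lemma cint_shift a b d (g : R -> C) : a <= b -> cont_on (a + d) (b + d) g ->
  cint (a + d) (b + d) g = cint a b (fun t => g (t + d)).
Proof.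
move=> ab cg.
have cgs : cont_on a b (fun t => g (t + d)).
  move=> t tab e e0; have := cg (t + d) ltac:(lra) e e0.
  move=> /nbhs_normP[r /= r0 rP]; apply/nbhs_normP; exists r => //= s.
  rewrite /ball_/= => st; apply: rP; rewrite /ball_/=.
  by have -> : t + d - (s + d) = t - s by ring.
suff H (e : R) : 0 < e ->
    cabs (cint (a + d) (a + (b - a) + d) g - cint a (a + (b - a)) (fun t => g (t + d)))
    <= e * (b - a).
  apply/eqP; rewrite -subr_eq0 -cabs_eq0 eq_le cabs_ge0 andbT.
  apply/ler_addgt0Pl => e e0; rewrite addr0.
  have k0 : 0 < b - a + 1 by rewrite ltr_wpDl// subr_ge0.
  have abE : a + (b - a) = b by ring.
  have := H (e / (b - a + 1)) (divr_gt0 e0 k0); rewrite !abE => /le_trans; apply.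
  by rewrite -mulrA ler_piMr ?(ltW e0)// ler_pdivrMl// mulr1 lerDl.
move=> e0; apply: (@rect_bisect _ (fun x y w h =>
  cabs (cint (x + d) (x + w + d) g - cint x (x + w) (fun t => g (t + d))) <= e * w)
  a 0 (b - a) 0) => //; first by rewrite subr_ge0.
  move=> x' y' w' h' w'0 _ xx _ xw _.
  have i1 : x' + d <= x' + w' + d by lra.
  have i2 : x' + w' + d <= x' + (w' + w') + d by lra.
  have i3 : x' <= x' + w' by lra.
  have i4 : x' + w' <= x' + (w' + w') by lra.
  have c1 : cont_on (x' + d) (x' + (w' + w') + d) g by apply: cont_on_sub cg; lra.
  have c2 : cont_on x' (x' + (w' + w')) (fun t => g (t + d)).
    by apply: cont_on_sub cgs; lra.
  rewrite (cint_split i1 i2 c1) (cint_split i3 i4 c2).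
  have -> : x' + w' + w' = x' + (w' + w') by ring.
  move=> p1 p2 _ _.
  rewrite opprD addrACA mulrDr; apply: le_trans (cabsD _ _) _.
  exact: lerD p1 p2.
move=> t t2 tab _; have e4 : 0 < e / 4 by lra.
have /nbhs_normP[r r0 rP] := cg (t + d) ltac:(lra) _ e4.
exists r; first exact: r0.
move=> x' y' w' h' w'0 _ xx _ xw _ xt _ wr _.
have near s : x' <= s <= x' + w' -> cabs (g (s + d) - g (t + d)) <= e / 4.
  move=> xs; apply/ltW/rP; rewrite /ball_/= ltr_norml; lra.
have c1 : cont_on (x' + d) (x' + w' + d) g by apply: cont_on_sub cg; lra.
have c2 : cont_on x' (x' + w') (fun t => g (t + d)).
  by apply: cont_on_sub cgs; lra.
have cc u v := @cont_on_cst R u v (g (t + d)).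
have b1 : cabs (cint (x' + d) (x' + w' + d) (fun s => g s - g (t + d))) <=
    2 * (x' + w' + d - (x' + d)) * (e / 4).
  apply: cint_le; [by lra|exact: cont_onB|].
  by move=> s xs; have := near (s - d); rewrite subrK; apply; lra.
have b2 : cabs (cint x' (x' + w') (fun s => g (s + d) - g (t + d))) <=
    2 * (x' + w' - x') * (e / 4).
  by apply: cint_le; [by lra|exact: cont_onB|].
move: b1 b2; rewrite (cintB c1 (cc _ _)) (cintB c2 (cc _ _)).
rewrite !cint_cst; [|lra|lra].
have -> : x' + w' + d - (x' + d) = w' by ring.
have -> : x' + w' - x' = w' by ring.
set u := cint _ _ _; set v := cint _ _ _; set l := _ * g _ => b1 b2.
have -> : u - v = (u - l) - (v - l) by ring.
apply: le_trans (cabsD _ _) _; rewrite cabsN; apply: le_trans (lerD b1 b2) _.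
have -> : 2 * w' * (e / 4) + 2 * w' * (e / 4) = e * w' by field.
exact: lexx.
Qed.

Lemma rint_shift f x y w h a b : 0 <= w -> 0 <= h ->
  cont_sides f (x + a) (y + b) w h ->
  rint f (x + a) (y + b) w h = rint (fun z => f (z + Complex a b)) x y w h.
Proof.
move=> w0 h0 cf; rewrite /rint.
have E1 : x + a + w = x + w + a by ring.
have E2 : y + b + h = y + h + b by ring.
have cb := cont_onB (cont_bottom h0 cf) (cont_top h0 cf).
have cl := cont_onB (cont_right w0 cf) (cont_left w0 cf).
move: cb cl; rewrite !E1 !E2 => cb cl.
by rewrite (cint_shift _ cb) ?lerDl// (cint_shift _ cl) ?lerDl.
Qed.

Lemma cint_Im_ge a b (g : R -> C) (m : R) : a <= b -> cont_on a b g ->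
  (forall t, a <= t <= b -> m <= complex.Im (g t)) ->
  m * (b - a) <= complex.Im (cint a b g).
Proof.
move=> ab cg gm; rewrite -(mu_itv ab) -Rintegral_cst; last exact: measurable_itv.
apply: le_Rintegral; first exact: measurable_itv.
- apply: continuous_compact_integrable; first exact: segment_compact.
  by apply: continuous_subspaceT => t; exact: cst_continuous.
- exact: Im_integrable.
- by move=> t; rewrite /= in_itv/=; exact: gm.
Qed.

(* This is [2 i pi], but only [kap != 0] matters. *)
Definition kap : C := rint (fun z => z^-1) (0 - 1) (0 - 1) (1 + 1) (1 + 1).

Lemma cderV_sub p z : z != p -> exists c, cder (fun z => (z - p)^-1) z c.
Proof.
move=> zp; eexists; apply: (@cderV _ (fun z => z - p)).
  by rewrite subr_eq0.
exact: (cderB (cder_id z) (cder_cst p z)).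
Qed.

(** The square of half side [d] and the unit one in [kap] can both be shrunk to a common smaller
    square. *)
Lemma rint_inv d : 0 < d ->
  rint (fun z => z^-1) (0 - d) (0 - d) (d + d) (d + d) = kap.
Proof.
have inv0 z : z != 0 -> exists c, cder (fun z => z^-1) z c.
  by move=> z0; have [c cP] := cderV_sub z0; exists c;
    move: cP; under eq_fun do rewrite subr0.
have around s : 0 < s -> exists2 d : R, 0 < d & forall d', 0 < d' -> d' <= d ->
    rint (fun z => z^-1) (0 - s) (0 - s) (s + s) (s + s) =
    rint (fun z => z^-1) (0 - d') (0 - d') (d' + d') (d' + d').
  move=> s0; have int0 : in_interior (0 - s) (0 - s) (s + s) (s + s) 0.
    by split => /=; lra.
  have [d1 d10 dP] := rint_around int0 (fun z _ => @inv0 z).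
  exists d1; first exact: d10.
  move=> d' d'0 d'd; have [_ E] := dP d' d'0 d'd.
  have R0 : complex.Re (0 : C) = 0 by [].
  have I0 : complex.Im (0 : C) = 0 by [].
  by rewrite R0 I0 in E; rewrite E.
move=> d0; have [d1 d10 d1P] := around d d0.
have [d2 d20 d2P] := around 1 ltr01.
have m0 : 0 < Num.min d1 d2 by rewrite lt_min d10 d20.
have m1 : Num.min d1 d2 <= d1 by rewrite ge_min lexx.
have m2 : Num.min d1 d2 <= d2 by rewrite ge_min lexx orbT.
have e1 := d1P _ m0 m1.
have e2 := d2P _ m0 m2.
exact: (etrans e1 (esym e2)).
Qed.

(** The imaginary part is positive: on each pair of opposite sides the integrand contributes
    [2 / (t ^ 2 + 1)], which is at least 1 for [|t| <= 1]. *)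
Lemma kap_neq0 : kap != 0.
Proof.
suff H : 0 < complex.Im kap by apply/eqP => k0; move: H; rewrite k0 /= ltxx.
have cs : cont_sides (fun z : C => z^-1) (0 - 1) (0 - 1) (1 + 1) (1 + 1).
  apply: cder_cont_sides => z [_ zs].
  have z0 : z != 0 by apply/eqP => z0; move: zs; rewrite z0 /= => -[]; lra.
  by have [c cP] := cderV_sub z0; exists c; move: cP; under eq_fun do rewrite subr0.
have h11 : (0 : R) <= 1 + 1 by lra.
have cb := cont_onB (cont_bottom h11 cs) (cont_top h11 cs).
have cl := cont_onB (cont_right h11 cs) (cont_left h11 cs).
have invE (s t : R) : (Complex s t : C)^-1 =
  Complex (s / (s ^+ 2 + t ^+ 2)) (- (t / (s ^+ 2 + t ^+ 2))) by [].
have aux (t : R) : 0 - 1 <= t <= 0 - 1 + (1 + 1) -> 1 / 2 <= (t ^+ 2 + 1)^-1.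
  move=> t1; rewrite -[leRHS]div1r ler_pdivlMr ?ltr_wpDl ?sqr_ge0//.
  have : t ^+ 2 <= 1 by rewrite expr2; nra.
  lra.
have a1 : (0 : R) - 1 <= 0 - 1 + (1 + 1) by lra.
have b1 := @cint_Im_ge _ _ _ 1 a1 cb.
have cli := cont_onZ (Complex 0 1) cl.
have b2 := @cint_Im_ge _ _ _ 1 a1 cli.
rewrite /kap /rint -(cintZ _ cl).
rewrite Im_add.
apply: addr_gt0.
  apply: lt_le_trans (b1 _); first by rewrite mul1r; lra.
  move=> t tt; rewrite !invE Im_sub [complex.Im _]/= [in X in _ <= _ - X]/=.
  have -> : (0 - 1 + (1 + 1) : R) = 1 by ring.
  have -> : (0 - 1 : R) = -1 by ring.
  rewrite sqrrN expr1n; have := aux t tt; set u := (t ^+ 2 + 1)^-1; lra.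
apply: lt_le_trans (b2 _); first by rewrite mul1r; lra.
move=> t tt; rewrite !invE Im_muli Re_sub [complex.Re _]/= [in X in _ <= _ - X]/=.
have -> : (0 - 1 + (1 + 1) : R) = 1 by ring.
have -> : (0 - 1 : R) = -1 by ring.
rewrite sqrrN expr1n (addrC 1); have := aux t tt; set u := (t ^+ 2 + 1)^-1; lra.
Qed.

Lemma rint_inv_sub x y w h p : in_interior x y w h p ->
  rint (fun z => (z - p)^-1) x y w h = kap.
Proof.
move=> pin; have [d d0 dP] := rint_around pin (fun z _ => @cderV_sub p z).
have [_ ->] := dP d d0 (lexx d).
have dd : 0 <= d + d by lra.
have pE : p = Complex (complex.Re p) (complex.Im p) by case: (p).
have cs : cont_sides (fun z => (z - p)^-1) (0 - d + complex.Re p)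
    (0 - d + complex.Im p) (d + d) (d + d).
  apply: cder_cont_sides => z [_ zs]; apply: cderV_sub.
  by apply/eqP => zE; move: zs; rewrite zE => -[]; lra.
have := rint_shift dd dd cs; rewrite -pE.
have -> : 0 - d + complex.Re p = complex.Re p - d by ring.
have -> : 0 - d + complex.Im p = complex.Im p - d by ring.
move=> ->; rewrite -(rint_inv d0); apply: eq_rint => // z _.
by rewrite addrK.
Qed.

Theorem cauchy_formula f x y w h p : in_interior x y w h p ->
  (forall z, in_rect x y w h z -> exists c, cder f z c) ->
  rint (fun z => f z * (z - p)^-1) x y w h = kap * f p.
Proof.
move=> pin df; have [x1 y1] := pin.
have w0 : 0 <= w by lra.
have h0 : 0 <= h by lra.
have pr : in_rect x y w h p by split; lra.
have pns z : in_sides x y w h z -> z != p.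
  by move=> [_ zs]; apply/eqP => zE; move: zs; rewrite zE => -[] ?; lra.
have ci : cont_sides (fun z => (z - p)^-1) x y w h.
  by apply: cder_cont_sides => z /pns; exact: cderV_sub.
have cf : cont_sides f x y w h by move=> z [/df[c /cder_cont]].
have cfi : cont_sides (fun z => f z * (z - p)^-1) x y w h.
  by move=> z zs; apply: (@ctoM _ _ _ (nbhs_filter z)); [exact: cf|exact: ci].
have : rint (fun z => (f z - f p) * (z - p)^-1) x y w h = 0.
  have [c [phi [cphi phic] fE]] := df p pr.
  have /ccontP/(_ _ ltr01)[r r0 rP] := cphi.
  apply: (@rint_removable _ _ _ _ _ _ p (cabs c + 1) r) => //.
    move=> z /df[c1 c1P] /cderV_sub[c2 c2P]; eexists.
    exact: (cderM (cderB c1P (cder_cst (f p) z)) c2P).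
  move=> z zr zp; rewrite fE addrC addKr mulfK ?subr_eq0//.
  have := rP z zr; rewrite phic; have := ler_cabsB (phi z) c; lra.
rewrite (eq_rint w0 h0 (g := fun z => f z * (z - p)^-1 + (- f p) * (z - p)^-1)).
  have cz : cont_sides (fun z => (- f p) * (z - p)^-1) x y w h.
    move=> z zs; apply: (@ctoM _ _ _ (nbhs_filter z)); last exact: ci.
    exact: (@cto_cst _ _ _ (nbhs_filter z)).
  rewrite (rintD w0 h0 cfi cz) (rintZ w0 h0 _ ci) (rint_inv_sub pin).
  by move=> /eqP; rewrite mulNr subr_eq0 mulrC => /eqP.
by move=> z _; ring.
Qed.

Lemma rect_bounded f x y w h : 0 <= w -> 0 <= h ->
  (forall z, in_rect x y w h z -> ccont f z) ->
  exists M : R, forall z, in_rect x y w h z -> cabs (f z) <= M.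
Proof.
move=> w0 h0 cf; apply: (@rect_bisect _ (fun x y w h =>
  exists M : R, forall z, in_rect x y w h z -> cabs (f z) <= M)) => //.
  move=> x' y' w' h' _ _ _ _ _ _ [M1 M1P] [M2 M2P] [M3 M3P] [M4 M4P].
  exists (Num.max (Num.max M1 M2) (Num.max M3 M4)) => z [zx zy].
  rewrite !le_max.
  have [xw|xw] := leP (complex.Re z) (x' + w');
    have [yh|yh] := leP (complex.Im z) (y' + h').
  - by rewrite M1P//; split; lra.
  - by rewrite M3P ?orbT//; split; lra.
  - by rewrite M2P ?orbT//; split; lra.
  - by rewrite M4P ?orbT//; split; lra.
move=> a b xa yb; have zin : in_rect x y w h (Complex a b) by [].
have /ccontP/(_ _ ltr01)[d d0 dP] := cf _ zin.
exists (d / 2); first lra.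
move=> x' y' w' h' w'0 h'0 xx yy xw yh xa' yb' wd hd.
exists (cabs (f (Complex a b)) + 1) => z zr.
have z'in : in_rect x' y' w' h' (Complex a b) by [].
have zd := dist_in_rect zr z'in.
have := dP z (le_lt_trans zd _).
have := ler_cabsB (f z) (f (Complex a b)) => h1 /(_ ltac:(lra)); lra.
Qed.

End Taylor.

(** * Second order Taylor expansions from Cauchy's formula *)

Section LocalTaylor.
Variable R : realType.
Local Notation C := (Cplane R).
Implicit Types (f g : C -> C) (z c p q : C) (k l : nat).

Definition hol_near f z := \forall w \near z, exists c, cder f w c.

Section Square.
Variables (f : C -> C) (z0 : C) (s M : R).
Hypothesis s0 : 0 < s.
Let x := complex.Re z0 - s.
Let y := complex.Im z0 - s.
Let w := s + s.
Hypothesis df : forall z, in_rect x y w w z -> exists c, cder f z c.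
Hypothesis fM : forall z, in_rect x y w w z -> cabs (f z) <= M.

Let w0 : 0 <= w. Proof. by rewrite addr_ge0// ltW. Qed.

Let near_center p : cabs (p - z0) < s / 2 ->
  `|complex.Re p - complex.Re z0| < s / 2 /\ `|complex.Im p - complex.Im z0| < s / 2.
Proof.
move=> ps; rewrite -Re_sub -Im_sub.
by split; [exact: le_lt_trans (Re_le_cabs _) ps|exact: le_lt_trans (Im_le_cabs _) ps].
Qed.

Let center_interior p : cabs (p - z0) < s / 2 -> in_interior x y w w p.
Proof.
move=> /near_center[]; rewrite !ltr_norml /in_interior /x /y /w => h1 h2.
have s1 := s0; split; lra.
Qed.

(** The points [p] and [q] are kept within [s / 2] of the centre so that the kernels [1 / (z - p)]
    are bounded by [2 / s] on the sides. *)
Let sides_dist p z : cabs (p - z0) < s / 2 -> in_sides x y w w z ->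
  s / 2 <= cabs (z - p).
Proof.
move=> /near_center[]; rewrite !ltr_norml => h1 h2 [_ zs]; have s1 := s0.
have re := Re_le_cabs (z - p); have im := Im_le_cabs (z - p).
move: re im; rewrite Re_sub Im_sub !ler_norml /x /y /w in zs * => re im.
by case: zs => E; rewrite E in re im; lra.
Qed.

(** The Cauchy integrand with a pole of order [k] at [p] and of order [l] at [q]: all coefficients
    and remainders below are integrals of it. *)
Let Phi p q k l z : C := f z * ((z - p)^-1) ^+ k * ((z - q)^-1) ^+ l.

Let inv_le p z : cabs (p - z0) < s / 2 -> in_sides x y w w z ->
  cabs (z - p)^-1 <= 2 / s.
Proof.
move=> ps zs; rewrite cabsV -[2 / s]invf_div lef_pV2.
- exact: sides_dist.
- by rewrite posrE; apply: lt_le_trans (sides_dist ps zs); rewrite divr_gt0.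
- by rewrite posrE divr_gt0.
Qed.

Let Phi_le p q k l z : cabs (p - z0) < s / 2 -> cabs (q - z0) < s / 2 ->
  in_sides x y w w z -> cabs (Phi p q k l z) <= M * (2 / s) ^+ (k + l).
Proof.
move=> ps qs zs; rewrite !cabsM !cabsX exprD mulrA.
have s2 : 0 <= 2 / s by rewrite divr_ge0// ltW.
apply: ler_pM; rewrite ?mulr_ge0 ?exprn_ge0 ?cabs_ge0//.
  apply: ler_pM; rewrite ?exprn_ge0 ?cabs_ge0//; first by case: zs => /fM.
  by apply: lerXn2r; rewrite ?nnegrE ?cabs_ge0// inv_le.
by apply: lerXn2r; rewrite ?nnegrE ?cabs_ge0// inv_le.
Qed.

Let pos_neq p z : s / 2 <= cabs (z - p) -> z - p != 0.
Proof. by move=> h; rewrite -cabs_gt0; apply: lt_le_trans h; rewrite divr_gt0. Qed.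

Let Phi_cont p q k l : cabs (p - z0) < s / 2 -> cabs (q - z0) < s / 2 ->
  cont_sides (Phi p q k l) x y w w.
Proof.
move=> ps qs z zs.
have inv u : cabs (u - z0) < s / 2 -> cto (nbhs z) (fun z => (z - u)^-1) (z - u)^-1.
  move=> us; apply: (@ctoV _ _ _ (nbhs_filter z)); first exact/pos_neq/sides_dist.
  apply: (@ctoB _ _ _ (nbhs_filter z)); first exact: ccont_id.
  exact: (@cto_cst _ _ _ (nbhs_filter z)).
apply: (@ctoM _ _ _ (nbhs_filter z)); last first.
  by apply: (@ctoX _ _ _ (nbhs_filter z)); exact: inv.
apply: (@ctoM _ _ _ (nbhs_filter z)); last first.
  by apply: (@ctoX _ _ _ (nbhs_filter z)); exact: inv.
by case: zs => /df[c /cder_cont].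
Qed.

Let L g : C := (kap R)^-1 * rint g x y w w.
Let L_Phi_le p q k l : cabs (p - z0) < s / 2 -> cabs (q - z0) < s / 2 ->
  cabs (L (Phi p q k l)) <= cabs (kap R)^-1 * (4 * (w + w) * (M * (2 / s) ^+ (k + l))).
Proof.
move=> ps qs; rewrite cabsM ler_wpM2l ?cabs_ge0//.
by apply: rint_le => //; [exact: Phi_cont|move=> z; exact: Phi_le].
Qed.

Let LD g1 g2 : cont_sides g1 x y w w -> cont_sides g2 x y w w ->
  L (fun z => g1 z + g2 z) = L g1 + L g2.
Proof. by move=> c1 c2; rewrite /L rintD// mulrDr. Qed.

Let LZ c g : cont_sides g x y w w -> L (fun z => c * g z) = c * L g.
Proof. by move=> cg; rewrite /L rintZ// mulrCA. Qed.

Let cZ c g : cont_sides g x y w w -> cont_sides (fun z => c * g z) x y w w.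
Proof.
move=> cg z zs; apply: (@ctoM _ _ _ (nbhs_filter z)); last exact: cg.
exact: (@cto_cst _ _ _ (nbhs_filter z)).
Qed.

Let cD g1 g2 : cont_sides g1 x y w w -> cont_sides g2 x y w w ->
  cont_sides (fun z => g1 z + g2 z) x y w w.
Proof.
by move=> c1 c2 z zs; apply: (@ctoD _ _ _ (nbhs_filter z)); [exact: c1|exact: c2].
Qed.

Let L4 g1 g2 g3 g4 c2 c3 c4 : cont_sides g1 x y w w -> cont_sides g2 x y w w ->
  cont_sides g3 x y w w -> cont_sides g4 x y w w ->
  L (fun z => g1 z + (c2 * g2 z + (c3 * g3 z + c4 * g4 z))) =
  L g1 + (c2 * L g2 + (c3 * L g3 + c4 * L g4)).
Proof.
move=> h1 h2 h3 h4.
rewrite (LD h1 (cD (cZ c2 h2) (cD (cZ c3 h3) (cZ c4 h4)))).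
rewrite (LD (cZ c2 h2) (cD (cZ c3 h3) (cZ c4 h4))) (LD (cZ c3 h3) (cZ c4 h4)).
by rewrite (LZ c2 h2) (LZ c3 h3) (LZ c4 h4).
Qed.

Let f_L p q : cabs (q - z0) < s / 2 -> f q = L (Phi p q 0 1).
Proof.
move=> qs; rewrite /L (eq_rint w0 w0 (g := fun z => f z * (z - q)^-1)).
  by rewrite (cauchy_formula (center_interior qs))// mulKf// kap_neq0.
by move=> z _; rewrite /Phi expr0 mulr1 expr1.
Qed.

(** The integral formula for the Taylor coefficient of order [n] at [p], that is the [n]-th
    derivative divided by the factorial of [n]. *)
Definition cauchy_coef n p : C := L (Phi p p n.+1 0).

Let L_coef n p q : L (Phi p q n.+1 0) = cauchy_coef n p.
Proof. by rewrite /L; congr (_ * _); apply: eq_rint => // z _; rewrite /Phi !expr0. Qed.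

(** With [u = z - p] and [h = q - p] this integrates the identity [1 / (u - h) = 1 / u + h / u ^ 2 +
    h ^ 2 / u ^ 3 + h ^ 3 / (u ^ 3 (u - h))]. *)
Lemma cauchy_expansion0 p q : cabs (p - z0) < s / 2 -> cabs (q - z0) < s / 2 ->
  f q - f p - cauchy_coef 1 p * (q - p) - cauchy_coef 2 p * (q - p) ^+ 2 =
  (q - p) ^+ 3 * L (Phi p q 3 1).
Proof.
move=> ps qs; have C := fun k l => @Phi_cont p q k l ps qs.
have -> : f p = L (Phi p q 1 0).
  by rewrite L_coef (f_L p ps) /L; congr (_ * _); apply: eq_rint => // z _;
    rewrite /Phi !expr0 !expr1; ring.
rewrite (f_L p qs) -(L_coef 1 p q) -(L_coef 2 p q).
have -> : L (Phi p q 0 1) = L (fun z => Phi p q 1 0 z + ((q - p) * Phi p q 2 0 z +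
   ((q - p) ^+ 2 * Phi p q 3 0 z + (q - p) ^+ 3 * Phi p q 3 1 z))).
  rewrite /L; congr (_ * _); apply: eq_rint => // z zs.
  have zp := pos_neq (sides_dist ps zs); have zq := pos_neq (sides_dist qs zs).
  by rewrite /Phi !expr0 !expr1; field; rewrite zp zq.
rewrite (L4 _ _ _ (C 1%N 0%N) (C 2%N 0%N) (C 3%N 0%N) (C 3%N 1%N)).
move: (L (Phi p q 1 0)) (L (Phi p q 2 0)) (L (Phi p q 3 0)) (L (Phi p q 3 1)).
by move=> u1 u2 u3 u4; ring.
Qed.

(** The corresponding identity for the squared kernel is [1 / (u - h) ^ 2 = 1 / u ^ 2 + 2 h / u ^ 3
    + h ^ 2 / (u ^ 2 (u - h) ^ 2) + 2 h ^ 2 / (u ^ 3 (u - h))]. *)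
Lemma cauchy_expansion1 p q : cabs (p - z0) < s / 2 -> cabs (q - z0) < s / 2 ->
  cauchy_coef 1 q - cauchy_coef 1 p - 2 * cauchy_coef 2 p * (q - p) =
  (q - p) ^+ 2 * (L (Phi p q 2 2) + 2 * L (Phi p q 3 1)).
Proof.
move=> ps qs; have C := fun k l => @Phi_cont p q k l ps qs.
rewrite -(L_coef 1 p q) -(L_coef 2 p q).
have -> : cauchy_coef 1 q = L (fun z => Phi p q 2 0 z + ((2 * (q - p)) * Phi p q 3 0 z +
   ((q - p) ^+ 2 * Phi p q 2 2 z + (2 * (q - p) ^+ 2) * Phi p q 3 1 z))).
  rewrite /cauchy_coef /L; congr (_ * _); apply: eq_rint => // z zs.
  have zp := pos_neq (sides_dist ps zs); have zq := pos_neq (sides_dist qs zs).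
  by rewrite /Phi !expr0 !expr1; field; rewrite zp zq.
rewrite (L4 _ _ _ (C 2%N 0%N) (C 3%N 0%N) (C 2%N 2%N) (C 3%N 1%N)).
move: (L (Phi p q 2 0)) (L (Phi p q 3 0)) (L (Phi p q 2 2)) (L (Phi p q 3 1)).
by move=> u1 u2 u3 u4; ring.
Qed.

Lemma square_taylor : exists B, forall p q,
  cabs (p - z0) < s / 2 -> cabs (q - z0) < s / 2 ->
  [/\ cabs (f q - f p - cauchy_coef 1 p * (q - p) - cauchy_coef 2 p * (q - p) ^+ 2)
      <= B * cabs (q - p) ^+ 3,
      cabs (cauchy_coef 1 q - cauchy_coef 1 p - 2 * cauchy_coef 2 p * (q - p))
      <= B * cabs (q - p) ^+ 2,
      cabs (cauchy_coef 1 p) <= B & cabs (cauchy_coef 2 p) <= B].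
Proof.
pose E n := cabs (kap R)^-1 * (4 * (w + w) * (M * (2 / s) ^+ n)).
have bound p q k l : cabs (p - z0) < s / 2 -> cabs (q - z0) < s / 2 ->
    cabs (L (Phi p q k l)) <= `|E (k + l)%N|.
  by move=> ps qs; apply: le_trans (ler_norm _); exact: L_Phi_le.
have lra0 (u a b c : R) : u <= `|c| -> u <= `|a| + `|b| + 3 * `|c|.
  by have := normr_ge0 a; have := normr_ge0 b; have := normr_ge0 c; lra.
have lra1 (u v a b c : R) : u <= `|c| -> v <= `|c| ->
    u + 2 * v <= `|a| + `|b| + 3 * `|c|.
  by have := normr_ge0 a; have := normr_ge0 b; have := normr_ge0 c; lra.
have lra2 (u a b c : R) : u <= `|a| -> u <= `|a| + `|b| + 3 * `|c|.
  by have := normr_ge0 a; have := normr_ge0 b; have := normr_ge0 c; lra.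
have lra3 (u a b c : R) : u <= `|b| -> u <= `|a| + `|b| + 3 * `|c|.
  by have := normr_ge0 a; have := normr_ge0 b; have := normr_ge0 c; lra.
exists (`|E 2| + `|E 3| + 3 * `|E 4|) => p q ps qs.
have b31 : cabs (L (Phi p q 3 1)) <= `|E 4| := bound p q 3%N 1%N ps qs.
have b22 : cabs (L (Phi p q 2 2)) <= `|E 4| := bound p q 2%N 2%N ps qs.
have b20 : cabs (cauchy_coef 1 p) <= `|E 2| := bound p p 2%N 0%N ps ps.
have b30 : cabs (cauchy_coef 2 p) <= `|E 3| := bound p p 3%N 0%N ps ps.
split.
- rewrite (cauchy_expansion0 ps qs) cabsM cabsX mulrC.
  apply: ler_wpM2r; first by rewrite exprn_ge0 ?cabs_ge0.
  exact: (lra0 _ _ _ _ b31).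
- rewrite (cauchy_expansion1 ps qs) cabsM cabsX mulrC.
  apply: ler_wpM2r; first by rewrite exprn_ge0 ?cabs_ge0.
  apply: le_trans (cabsD _ _) _; rewrite cabsM.
  have -> : cabs (2 : C) = 2.
    by rewrite -[2 : C]/(Complex (1 + 1) (0 + 0)) addr0 cabs_real ger0_norm//.
  exact: (lra1 _ _ _ _ _ b22 b31).
- exact: (lra2 _ _ _ _ b20).
- exact: (lra3 _ _ _ _ b30).
Qed.

End Square.

(** [D1] and [D2] are the first derivative and half of the second, but are only described by
    expansions that are uniform in both points; the second expansion is what makes [D1]
    differentiable later. *)
Theorem local_taylor f z0 : hol_near f z0 ->
  exists (r B : R) (D1 D2 : C -> C), [/\ 0 < r, 0 <= B & forall p q,
  cabs (p - z0) < r -> cabs (q - z0) < r ->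
  [/\ cabs (f q - f p - D1 p * (q - p) - D2 p * (q - p) ^+ 2)
      <= B * cabs (q - p) ^+ 3,
      cabs (D1 q - D1 p - 2 * D2 p * (q - p)) <= B * cabs (q - p) ^+ 2,
      cabs (D1 p) <= B & cabs (D2 p) <= B]].
Proof.
(* The square of half side [rho / 8] has its points within [4 * s = rho / 2] of the centre. *)
move=> /nbhs_cabsP[rho rho0 df]; pose s := rho / 8.
have s0 : 0 < s by rewrite divr_gt0.
have ss0 : 0 <= s + s by lra.
have z0in : in_rect (complex.Re z0 - s) (complex.Im z0 - s) (s + s) (s + s) z0.
  by split; lra.
have {}df z : in_rect (complex.Re z0 - s) (complex.Im z0 - s) (s + s) (s + s) z ->
    exists c, cder f z c.
  move=> zr; apply: df; apply: le_lt_trans (dist_in_rect zr z0in) _.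
  by rewrite /s; lra.
have [M fM] := rect_bounded ss0 ss0 (fun z zr => let: ex_intro c h := df z zr in cder_cont h).
have [B BP] := square_taylor s0 df fM.
exists (s / 2), B, (cauchy_coef f z0 s 1), (cauchy_coef f z0 s 2).
split => //; first lra.
have [_ _ h _] := BP z0 z0 ltac:(rewrite subrr cabs0; lra) ltac:(rewrite subrr cabs0; lra).
exact: le_trans (cabs_ge0 _) h.
Qed.

Theorem hol_near_deriv f z0 : hol_near f z0 ->
  exists (r B : R) (D1 D2 : C -> C), [/\ 0 < r, 0 <= B &
  forall p, cabs (p - z0) < r ->
    [/\ cder f p (D1 p), cder D1 p (D2 p), cabs (D1 p) <= B
      & forall q, cabs (q - z0) < r ->
        cabs (f q - f p) <= B * cabs (q - p) /\
        cabs (D1 q - D1 p) <= B * cabs (q - p)]].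
Proof.
move=> /local_taylor[r [B [D1 [D2 [r0 B0 H]]]]].
(* Two points within [1/2] of [z0] are at distance at most 1, so that powers of the distance are
   dominated by the distance itself. *)
pose r' := Num.min r (1/2).
have r'0 : 0 < r' by rewrite lt_min r0 divr_gt0.
have r'r p : cabs (p - z0) < r' -> cabs (p - z0) < r /\ cabs (p - z0) < 1 / 2.
  by rewrite lt_min => /andP[].
(* A quadratic bound on the remainder forces [a] to be the derivative; it is applied both to [f] and
   to [D1]. *)
have quad g a p (K : R) : cabs (p - z0) < r' -> (forall q, cabs (q - z0) < r ->
    cabs (g q - g p - a * (q - p)) <= K * cabs (q - p) ^+ 2) -> cder g p a.
  move=> pr gq.
  have K0 : 0 < `|K| + 1 by rewrite ltr_wpDl.
  apply: (@cder_near _ _ _ _ (fun q => if q == p then a else (g q - g p) / (q - p))).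
    move=> e e0; apply/nbhs_cabsP.
    exists (Num.min (r - cabs (p - z0)) (e / (`|K| + 1))).
      by rewrite lt_min subr_gt0 divr_gt0// andbT; have [] := r'r p pr.
    move=> q; rewrite lt_min => /andP[q1 q2].
    case: eqVneq => [_|qp]; first by rewrite subrr cabs0.
    have qp0 : q - p != 0 by rewrite subr_eq0.
    have qpp : 0 < cabs (q - p) by rewrite cabs_gt0.
    have -> : (g q - g p) / (q - p) - a = (g q - g p - a * (q - p)) / (q - p) by field.
    rewrite cabsM cabsV ltr_pdivrMr//.
    have qr : cabs (q - z0) < r by have := cabs_triangle p q z0; lra.
    apply: le_lt_trans (gq q qr) _.
    rewrite expr2 mulrA ltr_pM2r//.
    apply: (@le_lt_trans _ _ (`|K| * cabs (q - p))).
      by rewrite ler_pM2r// ler_norm.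
    apply: (@le_lt_trans _ _ ((`|K| + 1) * cabs (q - p))).
      by rewrite ler_pM2r// lerDl.
    by rewrite mulrC -ltr_pdivlMr.
  apply: filterE => q; case: eqVneq => [->|qp]; first by rewrite subrr mulr0 addr0.
  by rewrite divfK ?subr_eq0// addrC subrK.
exists r', (4 * B), D1, (fun p => 2 * D2 p); split => //; first lra.
move=> p pr'; have [pr p1] := r'r p pr'.
split.
(* One factor of the cubic remainder is absorbed by [|q - p| <= 2 * r]; the other [B] bounds the
   quadratic coefficient. *)
- apply: (@quad _ _ _ (B * (r + r) + B)) => // q qr.
  have [h1 _ _ h4] := H p q pr qr.
  have -> : f q - f p - D1 p * (q - p) =
    (f q - f p - D1 p * (q - p) - D2 p * (q - p) ^+ 2) + D2 p * (q - p) ^+ 2 by ring.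
  apply: le_trans (cabsD _ _) _; rewrite (cabsM (D2 p)) cabsX.
  apply: le_trans (lerD h1 (lexx _)) _.
  rewrite mulrDl (exprS _ 2) mulrA; apply: lerD.
    apply: ler_wpM2r; first by rewrite exprn_ge0 ?cabs_ge0.
    apply: ler_wpM2l => //.
    by have := cabs_triangle z0 q p; rewrite (cabsB z0); lra.
  by apply: ler_wpM2r; rewrite ?exprn_ge0 ?cabs_ge0.
- by apply: (@quad _ _ _ B) => // q qr; have [] := H p q pr qr.
- by have [_ _ h _] := H p p pr pr; lra.
move=> q qr'; have [qr q1] := r'r q qr'.
have [h1 h2 h3 h4] := H p q pr qr.
have pq1 : cabs (q - p) <= 1.
  have := cabs_triangle z0 q p; rewrite (cabsB z0); lra.
have pq0 := cabs_ge0 (q - p).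
set t := cabs (q - p) in pq1 pq0 *.
split.
- have -> : f q - f p = (f q - f p - D1 p * (q - p) - D2 p * (q - p) ^+ 2) +
    (D1 p * (q - p) + D2 p * (q - p) ^+ 2) by ring.
  apply: le_trans (cabsD _ _) _.
  apply: le_trans (lerD h1 (cabsD _ _)) _; rewrite (cabsM (D1 p)) (cabsM (D2 p)) cabsX -/t.
  have a1 : cabs (D1 p) * t <= B * t by rewrite ler_wpM2r.
  have a2 : cabs (D2 p) * t ^+ 2 <= B * t ^+ 2 by rewrite ler_wpM2r ?exprn_ge0.
  have a3 : B * t ^+ 2 <= B * t by rewrite ler_wpM2l// expr2; nra.
  have a4 : B * t ^+ 3 <= B * t ^+ 2 by rewrite ler_wpM2l// exprS ler_piMl ?exprn_ge0.
  have a5 : 0 <= B * t by rewrite mulr_ge0.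
  by move: a1 a2 a3 a4 a5; set u1 := cabs _ * _; set u2 := cabs _ * _; lra.
- have -> : D1 q - D1 p = (D1 q - D1 p - 2 * D2 p * (q - p)) + 2 * D2 p * (q - p) by ring.
  apply: le_trans (cabsD _ _) _.
  apply: le_trans (lerD h2 (lexx _)) _; rewrite !cabsM -/t.
  have -> : cabs (2 : C) = 2.
    by rewrite -[2 : C]/(Complex (1 + 1) (0 + 0)) addr0 cabs_real ger0_norm//.
  have a2 : cabs (D2 p) * t <= B * t by rewrite ler_wpM2r.
  have a3 : B * t ^+ 2 <= B * t by rewrite ler_wpM2l// expr2; nra.
  have a5 : 0 <= B * t by rewrite mulr_ge0.
  by rewrite -mulrA; move: a2 a3 a5; set u2 := cabs _ * _; lra.
Qed.

End LocalTaylor.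

(** * Compactness in the plane and the maximum principle *)

Section MaximumPrinciple.
Variable R : realType.
Local Notation C := (Cplane R).
Implicit Types (f g u : C -> C) (z w c p q : C) (K : set C).

Lemma closed_cabsP K : (forall z, ~ K z ->
  exists2 d : R, 0 < d & forall w, cabs (w - z) < d -> ~ K w) -> closed K.
Proof.
move=> H; rewrite -openC openE => z /H zd; apply/nbhs_cabsP.
by case: zd => d d0 dP; exists d.
Qed.

Definition cdisc (z : C) (r : R) : set C := [set w | cabs (w - z) <= r].

Lemma cdisc_closed z r : closed (cdisc z r).
Proof.
apply: closed_cabsP => w /negP; rewrite -ltNge => wr.
exists (cabs (w - z) - r); first by rewrite subr_gt0.
move=> w' h; apply/negP; rewrite -ltNge.
have := cabs_triangle w' w z; rewrite (cabsB w w'); lra.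
Qed.

Lemma rect_compact (x y w h : R) : compact [set z : C | in_rect x y w h z].
Proof.
have -> : [set z : C | in_rect x y w h z] =
    (fun p : R * R => Complex p.1 p.2 : C) @` (`[x, x + w] `*` `[y, y + h]).
  apply/seteqP; split.
    move=> [a b] /= [xa yb]; exists (a, b) => //=.
  move=> _ [[a b] [/= xa yb] <-]; rewrite ?in_itv/= in xa yb.
  by split.
apply: continuous_compact; last first.
  by apply: compact_setX; exact: segment_compact.
apply: continuous_subspaceT => -[a b].
apply: (proj2 (cvg_cabsP (nbhs_filter (a, b)) _ _)) => e e0.
exists (ball a (e / 2), ball b (e / 2)).
  by split; apply: nbhsx_ballx; rewrite divr_gt0.
move=> [s t] [/= sa tb].
have {sa} sa : `|a - s| < e / 2 := sa.
have {tb} tb : `|b - t| < e / 2 := tb.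
change (cabs (Complex s t - Complex a b : C) < e).
apply: le_lt_trans (cabs_le_ReIm _) _.
rewrite Re_sub Im_sub /= distrC (distrC t); lra.
Qed.

Lemma cdisc_compact z r : compact (cdisc z r).
Proof.
apply: (@subclosed_compact _ _ [set w | in_rect (complex.Re z - r)
  (complex.Im z - r) (r + r) (r + r) w]).
- exact: cdisc_closed.
- exact: rect_compact.
move=> w wz /=; have re := le_trans (Re_le_cabs _) wz.
have im := le_trans (Im_le_cabs _) wz.
move: re im; rewrite Re_sub Im_sub !ler_norml /in_rect => re im.
split; lra.
Qed.

Lemma ccont_cvg_cabs f z : ccont f z -> (fun w => cabs (f w)) @ z --> cabs (f z).
Proof.
move=> cf; apply: (proj2 (cvg_absP (nbhs_filter z) _ _)) => e e0.
apply: filterS (cf e e0) => w h; rewrite ltr_norml; apply/andP; split.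
  by have := ler_cabsB (f z) (f w); rewrite cabsB; lra.
by have := ler_cabsB (f w) (f z); lra.
Qed.

Lemma compact_max (phi : C -> R) K : compact K -> K !=set0 ->
  (forall z, K z -> phi @ z --> phi z) ->
  exists2 z, K z & forall w, K w -> phi w <= phi z.
Proof.
move=> cK K0 cphi.
have [z zK zP] : exists2 c, c \in K & forall t, t \in K -> phi t <= phi c.
  apply: compact_EVT_max => //.
  by apply: continuous_in_subspaceT => z; rewrite inE => /cphi.
by exists z; [rewrite inE in zK|move=> w wK; apply: zP; rewrite inE].
Qed.

(** Parseval's identity for the fourth roots of unity: the monomials of degree 0, 1 and 2 are
    orthogonal on the four points, so all cross terms cancel. *)
Lemma quad_sum (c0 c1 c2 : C) (t : R) :
  let P (h : C) : C := c0 + c1 * h + c2 * h ^+ 2 in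
  cabs (P (Complex t 0)) ^+ 2 + cabs (P (Complex (- t) 0)) ^+ 2 +
  cabs (P (Complex 0 t)) ^+ 2 + cabs (P (Complex 0 (- t))) ^+ 2 =
  4 * (cabs c0 ^+ 2 + cabs c1 ^+ 2 * t ^+ 2 + cabs c2 ^+ 2 * t ^+ 4).
Proof.
case: c0 c1 c2 => [a0 b0] [a1 b1] [a2 b2] P.
rewrite !cabs_sqr /P.
have E (s r : R) : (Complex a0 b0 : C) + Complex a1 b1 * Complex s r +
    Complex a2 b2 * (Complex s r) ^+ 2 =
  Complex (a0 + (a1 * s - b1 * r) + (a2 * (s * s - r * r) - b2 * (s * r + r * s)))
    (b0 + (a1 * r + b1 * s) + (a2 * (s * r + r * s) + b2 * (s * s - r * r))).
  by rewrite expr2.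
by rewrite !E; simpl complex.Re; simpl complex.Im; ring.
Qed.

(* By [quad_sum], the average of [|f| ^ 2] over the four points [z +- t],
   [z +- i t] is at least [|f z| ^ 2] up to an error [O(t ^ 3)], whereas the
   average of [|w| ^ 2] exceeds [|z| ^ 2] by [t ^ 2]. *)
Lemma subharmonic_no_max f z (r del : R) : hol_near f z -> 0 < r -> 0 < del ->
  ~ (forall w, cabs (w - z) < r ->
      cabs (f w) ^+ 2 + del * cabs w ^+ 2 <= cabs (f z) ^+ 2 + del * cabs z ^+ 2).
Proof.
move=> /local_taylor[r1 [B [D1 [D2 [r10 B0 H]]]]] r0 del0 mx.
have H0 : cabs (z - z) < r1 by rewrite subrr cabs0.
pose c0 := f z; pose c1 := D1 z; pose c2 := D2 z.
pose N := cabs c0 + cabs c1 + cabs c2.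
have N0 : 0 <= N by rewrite /N !addr_ge0 ?cabs_ge0.
pose P (h : C) : C := c0 + c1 * h + c2 * h ^+ 2.
(* The entry 1 allows [N] to bound the quadratic polynomial; the last entry makes the error
   [2 * N * B * t ^ 3] smaller than the gain [del * t ^ 2]. *)
pose T := Num.min (Num.min r r1) (Num.min 1 (del / (2 * N * B + 1))).
have NB0 : 0 < 2 * N * B + 1 by rewrite ltr_wpDl ?mulr_ge0.
have T0 : 0 < T by rewrite !lt_min r0 r10 ltr01 divr_gt0.
pose t := T / 2.
have t0 : 0 < t by rewrite divr_gt0.
have tT : t < T by rewrite /t; lra.
have [tr [tr1 [t1 td]]] : t < r /\ t < r1 /\ t < 1 /\ t * (2 * N * B + 1) < del.
  move: tT; rewrite !lt_min => /andP[/andP[-> ->] /andP[-> ]].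
  by rewrite ltr_pdivlMr.
have est h : cabs h = t -> cabs (P h) ^+ 2 - 2 * N * B * t ^+ 3 <= cabs (f (z + h)) ^+ 2.
  move=> ht; have hz : z + h - z = h by rewrite addrC addKr.
  have [] := H z (z + h) H0 ltac:(by rewrite hz ht).
  rewrite hz ht => E _ _ _.
  have PN : cabs (P h) <= N.
    have cc0 := cabs_ge0 c0; have cc1 := cabs_ge0 c1; have cc2 := cabs_ge0 c2.
    apply: le_trans (cabsD _ _) _; apply: lerD.
      apply: le_trans (cabsD _ _) _; apply: lerD; first exact: lexx.
      by rewrite cabsM ht ler_piMr// ltW.
    by rewrite cabsM cabsX ht ler_piMr// exprn_ile1// ltW.
  have tri : cabs (P h) - B * t ^+ 3 <= cabs (f (z + h)).
    have := ler_cabsB (P h) (P h - f (z + h)).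
    have -> : P h - (P h - f (z + h)) = f (z + h) by ring.
    have -> : P h - f (z + h) = - (f (z + h) - f z - D1 z * h - D2 z * h ^+ 2).
      by rewrite /P /c0 /c1 /c2; ring.
    by rewrite cabsN; move: E; set e := cabs _; lra.
  have Bt : 0 <= B * t ^+ 3 by rewrite mulr_ge0// exprn_ge0// ltW.
  have p0 := cabs_ge0 (P h); have f0 := cabs_ge0 (f (z + h)).
  rewrite -[_ * B * _]mulrA; move: PN tri Bt p0 f0.
  move: (B * t ^+ 3) (cabs (P h)) (cabs (f (z + h))) (N) => b a v n; clear.
  move=> an ab b0 a0 v0; rewrite !expr2; case: (leP b a) => ba; nra.
have tt0 : t = `|t| by rewrite ger0_norm// ltW.
have h1 : cabs (Complex t 0 : C) = t by rewrite -[Complex _ _]/(t%:C)%C cabs_real -tt0.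
have h2 : cabs (Complex (- t) 0 : C) = t.
  by rewrite -[Complex _ _]/((- t)%:C)%C cabs_real normrN -tt0.
have h3 : cabs (Complex 0 t : C) = t by rewrite cabs_imag -tt0.
have h4 : cabs (Complex 0 (- t) : C) = t by rewrite cabs_imag normrN -tt0.
have ineq h : cabs h = t -> cabs (P h) ^+ 2 - 2 * N * B * t ^+ 3 + del * cabs (z + h) ^+ 2
    <= cabs c0 ^+ 2 + del * cabs z ^+ 2.
  move=> ht; apply: le_trans (mx (z + h) _); last by rewrite addrC addKr ht.
  by rewrite lerD2r est.
have S := lerD (lerD (ineq _ h1) (ineq _ h2)) (lerD (ineq _ h3) (ineq _ h4)).
have Q := quad_sum c0 c1 c2 t.
(* The polynomial is now [z + h] itself: the average of its squared modulus is [|z| ^ 2 + t ^ 2]. *)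
have Q2 := quad_sum z 1 0 t; have e02 : (0 : R) ^+ 2 = 0 by rewrite expr0n.
rewrite cabs1 cabs0 e02 mul0r addr0 expr1n mul1r in Q2.
have zh (h : C) : z + 1 * h + 0 * h ^+ 2 = z + h by ring.
rewrite /= !zh in Q2; rewrite /= in Q.
have c10 : 0 <= cabs c1 ^+ 2 * t ^+ 2 by rewrite mulr_ge0 ?exprn_ge0 ?cabs_ge0// ltW.
have c20 : 0 <= cabs c2 ^+ 2 * t ^+ 4 by rewrite mulr_ge0 ?exprn_ge0 ?cabs_ge0// ltW.
have td3 : t ^+ 2 * (t * (2 * N * B)) <= t ^+ 2 * (t * (2 * N * B + 1)).
  by rewrite ler_wpM2l ?exprn_ge0 ?ltW// ltr_pM2l// ltrDl.
have td2 : t ^+ 2 * (t * (2 * N * B + 1)) < t ^+ 2 * del by rewrite ltr_pM2l// exprn_gt0.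
have t3 : 2 * N * B * t ^+ 3 = t ^+ 2 * (t * (2 * N * B)) by ring.
rewrite t3 in S; move: S Q Q2 c10 c20 td3 td2; rewrite /P.
move: (t ^+ 2 * (t * (2 * N * B))) (t ^+ 2 * (t * (2 * N * B + 1))) => E1 E2.
move: (cabs (c0 + c1 * Complex t 0 + _)) (cabs (c0 + c1 * Complex (- t) 0 + _))
  (cabs (c0 + c1 * Complex 0 t + _)) (cabs (c0 + c1 * Complex 0 (- t) + _)) => p1 p2 p3 p4.
move: (cabs (z + Complex t 0)) (cabs (z + Complex (- t) 0))
  (cabs (z + Complex 0 t)) (cabs (z + Complex 0 (- t))) => q1 q2 q3 q4.
move: (cabs c0) (cabs c1 ^+ 2 * t ^+ 2) (cabs c2 ^+ 2 * t ^+ 4) (cabs z) => a0 a1 a2 a3.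
move: (t ^+ 2) => tt; clear -del0.
move=> S Q Q2 c1p c2p d1 d2.
have : del * (q1 ^+ 2 + q2 ^+ 2 + q3 ^+ 2 + q4 ^+ 2) = del * (4 * (a3 ^+ 2 + tt)).
  by rewrite Q2.
lra.
Qed.

(** If the bound failed at [z1], then [|f| ^ 2 + del * |z| ^ 2] would, for small [del], attain its
    maximum over [K] where [|f| > m]. This excludes [B] and the zeros of [f], and an interior
    maximum is impossible. Points where [f] vanishes need no regularity, which is what the version
    with a factor exploits. *)
Theorem maximum_principle K (B : set C) f (m : R) : compact K -> 0 <= m ->
  (forall z, K z -> ccont f z) ->
  (forall z, K z -> B z -> cabs (f z) <= m) ->
  (forall z, K z -> ~ B z -> f z = 0 \/ hol_near f z /\ \forall w \near z, K w) ->
  forall z, K z -> cabs (f z) <= m.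
Proof.
move=> cK m0 cf fB fI z1 z1K; rewrite leNgt; apply/negP => z1m.
have [A AK A0] : exists2 A : R, (forall z, K z -> cabs z <= A) & 0 < A.
  have [z zK zP] := @compact_max (fun z => cabs z) K cK (ex_intro _ z1 z1K)
    (fun z _ => @cvg_cabs R z).
  exists (cabs z + 1); last by rewrite ltr_wpDl ?cabs_ge0.
  by move=> w /zP h; apply: le_trans h _; rewrite lerDl.
(* Chosen so that the perturbation, at most [del * A ^ 2] on [K], uses only half of the gap between
   [|f z1| ^ 2] and [m ^ 2]. *)
pose del := (cabs (f z1) ^+ 2 - m ^+ 2) / (2 * A ^+ 2).
have sq : m ^+ 2 < cabs (f z1) ^+ 2 by rewrite ltrXn2r ?nnegrE ?cabs_ge0.
have A2 : 0 < A ^+ 2 by rewrite exprn_gt0.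
have del0 : 0 < del by rewrite divr_gt0 ?subr_gt0// mulr_gt0.
have delA : del * A ^+ 2 < cabs (f z1) ^+ 2 - m ^+ 2.
  have -> : del * A ^+ 2 = (cabs (f z1) ^+ 2 - m ^+ 2) / 2.
    by rewrite /del; field; rewrite gt_eqF.
  by lra.
have cu z : K z -> (fun z => cabs (f z) ^+ 2 + del * cabs z ^+ 2) @ z -->
    cabs (f z) ^+ 2 + del * cabs z ^+ 2.
  move=> zK; have FF := nbhs_filter z.
  have c1 := ccont_cvg_cabs (cf z zK); have c2 := @cvg_cabs R z.
  have cM (a b : C -> R) (l l' : R) : a @ z --> l -> b @ z --> l' ->
      (fun w => a w * b w) @ z --> l * l' by exact: (@cvgM R C (nbhs z) FF).
  have := @cvgD R R C (nbhs z) FF _ _ _ _ (cM _ _ _ _ c1 c1)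
    (cM _ _ _ _ (@cvg_cst R del C (nbhs z) FF) (cM _ _ _ _ c2 c2)).
  by [].
have [z zK zP] := @compact_max _ K cK (ex_intro _ z1 z1K) cu.
have zz1 := zP _ z1K.
have z2A : cabs z ^+ 2 <= A ^+ 2 by rewrite lerXn2r ?nnegrE ?cabs_ge0 ?AK// ltW.
have dz1 : 0 <= del * cabs z1 ^+ 2 by rewrite mulr_ge0 ?exprn_ge0 ?cabs_ge0// ltW.
have dz2 : del * cabs z ^+ 2 <= del * A ^+ 2 by rewrite ler_pM2l.
have mz : m ^+ 2 < cabs (f z) ^+ 2 by lra.
have mz' : m < cabs (f z) by rewrite -(ltr_pXn2r (n := 2)) ?nnegrE ?cabs_ge0.
have [/(fB _ zK)|nB] := pselect (B z); first by rewrite leNgt mz'.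
have [fz0|[hf nK]] := fI z zK nB.
  by move: mz'; rewrite fz0 cabs0 ltNge m0.
have [r r0 rP] : exists2 r : R, 0 < r & forall w, cabs (w - z) < r -> K w by exact/nbhs_cabsP.
exact: (subharmonic_no_max hf r0 del0 (fun w h => zP w (rP w h))).
Qed.

(** If [a / m] exceeded 1 its powers would grow at least linearly, by Bernoulli's inequality, and
    outgrow [H]. *)
Lemma root_limit (a m H : R) : 0 <= a -> 0 <= m ->
  (forall n, a ^+ n <= H * m ^+ n) -> a <= m.
Proof.
move=> a0 m0 h; rewrite leNgt; apply/negP => ma.
have [m00|mp] := eqVneq m 0.
  by have := h 1%N; rewrite m00 expr0n /= mulr0 expr1; lra.
have {}mp : 0 < m by rewrite lt_def mp m0.
have q1 : 0 < a / m - 1 by rewrite subr_gt0 ltr_pdivlMr// mul1r.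
have bern n : 1 + n%:R * (a / m - 1) <= (a / m) ^+ n.
  elim: n => [|n IH]; first by rewrite mul0r addr0 expr0.
  rewrite exprS; have am : 0 <= a / m by rewrite divr_ge0.
  apply: le_trans (ler_wpM2l am IH); rewrite -natr1.
  have n0 : 0 <= n%:R :> R by [].
  move: (n%:R : R) (a / m) n0 => N q n0; rewrite -subr_ge0.
  have -> : q * (1 + N * (q - 1)) - (1 + (N + 1) * (q - 1)) = N * (q - 1) ^+ 2 by ring.
  by rewrite mulr_ge0 ?sqr_ge0.
have [n nP] : exists n : nat, H / (a / m - 1) < n%:R.
  exists (Num.truncn `|H / (a / m - 1)|).+1; apply: le_lt_trans (ler_norm _) _.
  exact: truncnS_gt.
have := h n; rewrite leNgt => /negP; apply.
rewrite -ltr_pdivlMr ?exprn_gt0// -expr_div_n.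
apply: lt_le_trans (bern n); rewrite ltr_wpDl//.
by rewrite -ltr_pdivrMr.
Qed.

(* The factor [h] kills the points where [u] is not known to be differentiable;
   it is removed by applying the maximum principle to [h * u ^+ n]. *)
Theorem maximum_principle_factor K (B : set C) u (h : C -> C) (m : R) : compact K -> 0 <= m ->
  (forall z, K z -> ccont u z) -> (forall z, K z -> ccont h z) ->
  (forall z, K z -> B z -> cabs (u z) <= m) ->
  (forall z, K z -> ~ B z -> h z = 0 \/
    [/\ hol_near h z, hol_near u z & \forall w \near z, K w]) ->
  forall z, K z -> h z != 0 -> cabs (u z) <= m.
Proof.
move=> cK m0 cu ch uB hI z zK hz.
have [H HP] : exists H : R, forall z, K z -> cabs (h z) <= H.
  have [w wK wP] := @compact_max (fun z => cabs (h z)) K cK (ex_intro _ z zK)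
    (fun z zK => ccont_cvg_cabs (ch z zK)).
  by exists (cabs (h w)).
have H0 : 0 <= H by apply: le_trans (cabs_ge0 _) (HP z zK).
have hz0 : 0 < cabs (h z) by rewrite cabs_gt0.
(* With [|h| <= H] on [K], the maximum principle yields [|h z| |u z| ^ n <= H m ^ n] for every [n];
   taking roots removes the constant. *)
apply: (@root_limit _ _ (H / cabs (h z))); rewrite ?cabs_ge0// => n.
rewrite mulrAC ler_pdivlMr// mulrC -cabsX -cabsM.
apply: (@maximum_principle K B (fun z => h z * u z ^+ n)) => //.
- by rewrite mulr_ge0// exprn_ge0.
- move=> w wK; apply: (@ctoM _ _ _ (nbhs_filter w)); first exact: ch.
  by apply: (@ctoX _ _ _ (nbhs_filter w)); exact: cu.
- move=> w wK wB; rewrite cabsM cabsX; apply: ler_pM;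
    rewrite ?exprn_ge0 ?cabs_ge0 ?HP//.
  by rewrite lerXn2r ?nnegrE ?cabs_ge0// uB.
- move=> w wK wB; have [->|[hh hu nK]] := hI w wK wB; first by left; rewrite mul0r.
  right; split => //; apply: filterS (filterI hh hu) => q [[c hc] [d ud]].
  have [e eP] : exists e, cder (fun z => u z ^+ n) q e.
    elim: n => [|n [e eP]].
      by exists 0; under eq_fun do rewrite expr0; exact: cder_cst.
    by eexists; under eq_fun do rewrite exprS; exact: (cderM ud eP).
  by eexists; exact: (cderM hc eP).
Qed.

End MaximumPrinciple.

(** * Schwarz's lemma and the derivative of an injective function *)

Section SchwarzAndInverse.
Variable R : realType.
Local Notation C := (Cplane R).
Implicit Types (f g u : C -> C) (z w c p q : C) (r : R).

(** Carries a bound on difference quotients, known off [z], to the derivative, which is the value of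
    the slope at [z]. *)
Lemma cto_le u z (m : R) : ccont u z ->
  (\forall w \near z, w != z -> cabs (u w) <= m) -> cabs (u z) <= m.
Proof.
move=> cu /nbhs_cabsP[d d0 dP]; apply/ler_addgt0Pl => e e0.
have /ccontP/(_ _ e0)[d' d'0 d'P] := cu.
pose t := Num.min d d' / 2.
have m0 : 0 < Num.min d d' by rewrite lt_min d0 d'0.
have t0 : 0 < t by rewrite divr_gt0.
have [td td'] : t < d /\ t < d'.
  have : t < Num.min d d' by rewrite /t; move: m0; set M := Num.min _ _; lra.
  by rewrite lt_min => /andP[].
pose w := z + (t%:C)%C.
have wz : cabs (w - z) = t by rewrite /w addrC addKr cabs_real ger0_norm// ltW.
have w1 : w != z by rewrite -subr_eq0 -cabs_gt0 wz.
have h1 := dP w; rewrite wz in h1; have {}h1 := h1 td w1.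
have h2 := d'P w; rewrite wz in h2; have {}h2 := h2 td'.
have := ler_cabsB (u z) (u w); rewrite cabsB; lra.
Qed.

Lemma cder_quotient f z c : cder f z c -> exists phi : C -> C,
  [/\ ccont phi z, phi z = c, forall w, f w = f z + phi w * (w - z)
    & forall w, w != z -> phi w = (f w - f z) / (w - z)].
Proof.
move=> [phi [cphi phic] fE]; exists phi; split => // w wz.
by rewrite (fE w) addrC addKr mulfK ?subr_eq0.
Qed.

Lemma near_neq z w : w != z -> \forall q \near w, q != z.
Proof.
rewrite -subr_eq0 -cabs_gt0 => wz; apply/nbhs_cabsP; exists (cabs (w - z)) => // q.
apply: contraTneq => ->; by rewrite cabsB ltxx.
Qed.

Lemma quotient_cder f z c w (phi : C -> C) : w != z ->
  (forall w, w != z -> phi w = (f w - f z) / (w - z)) ->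
  cder f w c -> exists d, cder phi w d.
Proof.
move=> wz phiE fw; have [d dP] := cderV_sub wz.
eexists; apply: (@cder_eq_near _ (fun q => (f q - f z) * (q - z)^-1)).
  by apply: filterS (near_neq wz) => q /phiE.
exact: (cderM (cderB fw (cder_cst (f z) w)) dP).
Qed.

Lemma near_disc z w r : cabs (w - z) < r -> \forall q \near w, cabs (q - z) < r.
Proof.
move=> wr; apply/nbhs_cabsP; exists (r - cabs (w - z)); first by rewrite subr_gt0.
by move=> q h; have := cabs_triangle w q z; lra.
Qed.

(** The slope [f z / z] is at most [1 / r'] on the circle of radius [r']. The maximum principle is
    applied with the factor [z], which vanishes at the origin, the only point where
    differentiability of the slope is not known. *)
Theorem schwarz f r r' c : 0 < r' -> r' < r ->
  (forall z, cabs z < r -> exists d, cder f z d) ->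
  (forall z, cabs z < r -> cabs (f z) < 1) ->
  f 0 = 0 -> cder f 0 c -> cabs c * r' <= 1.
Proof.
move=> r'0 rr df f1 f0 /cder_quotient[phi [cphi <- fE phiE]].
rewrite -ler_pdivlMr// div1r.
have kr z : cdisc 0 r' z -> cabs z < r.
  by rewrite /cdisc /= subr0 => h; exact: le_lt_trans h rr.
have dphi z : cabs z < r -> z != 0 -> exists d, cder phi z d.
  by move=> /df[d fd] z0; exact: quotient_cder z0 phiE fd.
have key z : cdisc 0 r' z -> z != 0 -> cabs (phi z) <= r'^-1.
  apply: (@maximum_principle_factor _ (cdisc 0 r') [set z | r' <= cabs z] phi id).
  - exact: cdisc_compact.
  - by rewrite invr_ge0 ltW.
  - move=> w wK; have [->|w0] := eqVneq w 0; first exact: cphi.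
    by have [d /cder_cont] := dphi w (kr w wK) w0.
  - by move=> w _; exact: ccont_id.
  - move=> w wK wr; have w0 : w != 0 by rewrite -cabs_gt0; exact: lt_le_trans wr.
    rewrite phiE// f0 !subr0 cabsM cabsV -[leRHS]mul1r.
    apply: ler_pM; rewrite ?cabs_ge0 ?invr_ge0 ?cabs_ge0//.
      by apply/ltW/f1/kr.
    by rewrite lef_pV2 ?posrE// cabs_gt0.
  - move=> w wK /negP; rewrite -ltNge => wr.
    have [->|w0] := eqVneq w 0; [by left|right; split].
    + by apply: filterE => q; exists 1; exact: cder_id.
    + have wr' : cabs (w - 0) < r' by rewrite subr0.
      apply: filterS (filterI (near_disc wr') (near_neq w0)) => q [q1 q2].
      by apply: dphi => //; apply: kr; rewrite /cdisc /=; exact: ltW.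
    + have wr' : cabs (w - 0) < r' by rewrite subr0.
      by apply: filterS (near_disc wr') => q /ltW.
apply: cto_le => //; apply/nbhs_cabsP; exists r' => // w wr w0.
by apply: key => //; rewrite /cdisc /=; exact: ltW.
Qed.

(** Along the segment from [z] to [w], a zero derivative makes the increments of [f] on short
    parameter intervals at most [e] times their length; bisection adds them up. *)
Lemma cder0_cst f z r w : (forall q, cabs (q - z) < r -> cder f q 0) ->
  cabs (w - z) < r -> f w = f z.
Proof.
move=> df wr; pose v := w - z; pose gam (t : R) : C := z + (t%:C)%C * v.
have gamB s t : gam s - gam t = ((s - t)%:C)%C * v.
  rewrite /gam; have -> : ((s - t)%:C)%C = (s%:C)%C - (t%:C)%C :> C.
    by rewrite -[RHS]/(Complex (s - t) (0 - 0)) subrr.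
  by ring.
have gam_in (t : R) : 0 <= t <= 1 -> cabs (gam t - z) < r.
  move=> t01; rewrite /gam addrC addKr cabsM cabs_real.
  have t1 : `|t| <= 1 by rewrite ler_norml; lra.
  by apply: le_lt_trans wr; rewrite ler_piMl ?cabs_ge0.
suff H (e : R) : 0 < e -> cabs (f (gam (0 + 1)) - f (gam 0)) <= e * 1.
  apply/eqP; rewrite -subr_eq0 -cabs_eq0 eq_le cabs_ge0 andbT.
  apply/ler_addgt0Pl => e e0; rewrite addr0; have := H e e0.
  have -> : gam (0 + 1) = w by rewrite /gam add0r -[(1%:C)%C]/(1 : C) mul1r /v addrC subrK.
  have -> : gam 0 = z by rewrite /gam -[(0%:C)%C]/(0 : C) mul0r addr0.
  by rewrite mulr1.
move=> e0; apply: (@rect_bisect _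
  (fun x y s h => cabs (f (gam (x + s)) - f (gam x)) <= e * s) 0 0 1 0) => //.
  move=> x' y' w' h' _ _ _ _ _ _ p1 p2 _ _; rewrite addrA.
  apply: le_trans (cabs_triangle (f (gam (x' + w'))) _ _) _.
  by rewrite mulrDr; exact: lerD.
move=> a b; rewrite add0r => a01 _.
have [phi [cphi phi0] fE] := df _ (gam_in a a01).
have ev : 0 < e / (cabs v + 1) by rewrite divr_gt0// ltr_wpDl ?cabs_ge0.
have /ccontP/(_ _ ev)[d d0 dP] := cphi.
exists (d / (cabs v + 1)); first by rewrite divr_gt0// ltr_wpDl ?cabs_ge0.
move=> x y s h s0 _ x0 _ x1 _ xa _ sd _.
have v1 : 0 < cabs v + 1 by rewrite ltr_wpDl ?cabs_ge0.
have est t : `|t - a| <= s -> cabs (f (gam t) - f (gam a)) <= e * `|t - a|.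
  move=> ts; rewrite fE addrC addKr cabsM gamB cabsM cabs_real.
  have td : cabs (gam t - gam a) < d.
    rewrite gamB cabsM cabs_real; apply: (@le_lt_trans _ _ (s * (cabs v + 1))).
      by apply: ler_pM; rewrite ?cabs_ge0// lerDl.
    by rewrite -ltr_pdivlMr.
  have := ltW (dP _ td); rewrite phi0 subr0 => pe.
  rewrite mulrCA mulrC; apply: ler_wpM2r => //.
  apply: (@le_trans _ _ (e / (cabs v + 1) * (cabs v + 1))).
    by apply: ler_pM; rewrite ?cabs_ge0// lerDl.
  by rewrite divfK// gt_eqF.
apply: le_trans (cabs_triangle (f (gam a)) _ _) _.
have n1 : `|x + s - a| = x + s - a by rewrite ger0_norm//; lra.
have n2 : `|x - a| = a - x by rewrite distrC ger0_norm//; lra.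
have e1 := est (x + s) ltac:(rewrite n1; lra).
have e2 := est x ltac:(rewrite n2; lra).
rewrite (cabsB (f (gam a))); apply: le_trans (lerD e1 e2) _.
rewrite n1 n2 -mulrDr; have -> : x + s - a + (a - x) = s by ring.
exact: lexx.
Qed.

(* With the factor [D1 (g w)], which vanishes at the critical values of [f], the
   maximum principle bounds the slopes of [g] elsewhere. So the derivative of [f]
   is bounded away from 0 where it is nonzero; if it vanishes at [z], then it
   vanishes near [z] and [f] is not injective. *)
Theorem inverse_cder_neq0 f g (S V : set C) z c :
  (forall z, S z -> \forall w \near z, S w) ->
  (forall w, V w -> \forall w' \near w, V w') ->
  (forall z, S z -> exists d, cder f z d) ->
  (forall z, S z -> V (f z) /\ g (f z) = z) ->
  (forall w, V w -> [/\ S (g w), f (g w) = w & ccont g w]) ->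
  S z -> cder f z c -> c != 0.
Proof.
move=> oS oV df fSV gVS zS fc; apply/eqP => c0; rewrite {}c0 in fc.
have hf : hol_near f z by apply: filterS (oS z zS) => q /df.
have [r [B [D1 [D2 [r0 B0 HD]]]]] := hol_near_deriv hf.
have zr : cabs (z - z) < r by rewrite subrr cabs0.
have D1z : D1 z = 0 by have [h _ _ _] := HD z zr; exact: cder_unique h fc.
pose w0 := f z; have [w0V gw0] := fSV z zS.
have [_ _ cgw0] := gVS w0 w0V.
have [rho rho0 rhoP] : exists2 rho : R, 0 < rho & forall w, cabs (w - w0) < rho ->
    V w /\ cabs (g w - z) < r.
  apply/nbhs_cabsP; apply: filterI; first exact: oV.
  by have := cgw0 r r0; rewrite /w0 gw0.
pose Q := rho / 2; have Q0 : 0 < Q by rewrite divr_gt0.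
have KP w : cdisc w0 Q w -> V w /\ cabs (g w - z) < r.
  by move=> h; apply: rhoP; apply: le_lt_trans h _; rewrite /Q; lra.
(* On the circle of radius [Q] about [w0], a slope of [g] based at a point within [Q / 2] of [w0]
   has numerator at most [2 * r] and denominator at least [Q / 2]. *)
pose m := 4 * r / Q; have m0 : 0 < m by rewrite divr_gt0// mulr_gt0.
have dg w : cabs (w - w0) < rho -> D1 (g w) != 0 -> cder g w (1 / D1 (g w)).
  move=> wr Dw; have [wV gwr] := rhoP w wr; have [h _ _ _] := HD _ gwr.
  have [_ _ cgw] := gVS w wV.
  apply: (cder_lift h Dw (cder_id w) cgw).
  by apply: filterS (oV w wV) => q /gVS[].
have cD1g w : cabs (w - w0) < rho -> cto (nbhs w) (fun w => D1 (g w)) (D1 (g w)).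
  move=> wr; have [wV gwr] := rhoP w wr; have [_ h _ _] := HD _ gwr.
  by have [_ _ cgw] := gVS w wV; exact: (cto_comp (nbhs_filter w) cgw (cder_cont h)).
have near_D1 w : cabs (w - w0) < rho -> D1 (g w) != 0 ->
    \forall q \near w, cabs (q - w0) < rho /\ D1 (g q) != 0.
  move=> wr Dw; apply: filterI; first exact: near_disc.
  exact: (ccont_neq0 (cD1g w wr) Dw).
have key w1 : cabs (w1 - w0) < Q / 2 -> D1 (g w1) != 0 -> 1 <= m * cabs (D1 (g w1)).
  move=> w1Q Dw1; have w1r : cabs (w1 - w0) < rho by rewrite /Q in w1Q; lra.
  have [u [cu uw1 gE uE]] := cder_quotient (dg w1 w1r Dw1).
  have um w : cdisc w0 Q w -> D1 (g w) * (w - w1) != 0 -> cabs (u w) <= m.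
    apply: (@maximum_principle_factor _ (cdisc w0 Q) [set w | Q <= cabs (w - w0)] u
      (fun w => D1 (g w) * (w - w1))).
    - exact: cdisc_compact.
    - exact: ltW.
    - move=> q qK; have [->|qw] := eqVneq q w1; first exact: cu.
      have [qV _] := KP q qK; have [_ _ cgq] := gVS q qV.
      rewrite /ccont uE//.
      apply: (@cto_eq_near _ _ _ (nbhs_filter q) (fun q => (g q - g w1) * (q - w1)^-1)).
        by apply: filterS (near_neq qw) => q' /uE.
      apply: (@ctoM _ _ _ (nbhs_filter q)).
        apply: (@ctoB _ _ _ (nbhs_filter q)) => //.
        exact: (@cto_cst _ _ _ (nbhs_filter q)).
      by have [d /cder_cont] := cderV_sub qw.
    - move=> q qK; apply: (@ctoM _ _ _ (nbhs_filter q)).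
        by apply: cD1g; apply: le_lt_trans qK _; rewrite /Q; lra.
      apply: (@ctoB _ _ _ (nbhs_filter q)); first exact: ccont_id.
      exact: (@cto_cst _ _ _ (nbhs_filter q)).
    - move=> q qK /= qQ.
      have qw1 : Q / 2 <= cabs (q - w1).
        by have := cabs_triangle w1 q w0; lra.
      have qw : q != w1 by rewrite -subr_eq0 -cabs_gt0; lra.
      rewrite uE// cabsM cabsV ler_pdivrMr; last by rewrite cabs_gt0 subr_eq0.
      have [_ h1] := KP q qK; have [_ h2] := rhoP w1 w1r.
      have h3 : cabs (g q - g w1) <= 2 * r.
        by have := cabs_triangle z (g q) (g w1); rewrite (cabsB z); lra.
      apply: (le_trans h3).
      have -> : 2 * r = m * (Q / 2) by rewrite /m; field; rewrite gt_eqF.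
      by rewrite ler_pM2l.
    - move=> q qK /negP; rewrite -ltNge => qQ.
      have qr : cabs (q - w0) < rho by rewrite /Q in qQ; lra.
      have [->|qw] := eqVneq q w1; first by left; rewrite subrr mulr0.
      have [->|Dq] := eqVneq (D1 (g q)) 0; first by left; rewrite mul0r.
      right; split.
      + apply: filterS (near_D1 q qr Dq) => q' [q'r Dq'].
        have [_ gq'r] := rhoP q' q'r; have [_ h _ _] := HD _ gq'r.
        eexists; apply: (cderM (f := fun w => D1 (g w)) (g := fun w => w - w1)).
          exact: (cder_comp (dg q' q'r Dq') h).
        exact: (cderB (cder_id q') (cder_cst w1 q')).
      + apply: filterS (filterI (near_D1 q qr Dq) (near_neq qw)) => q' [[q'r Dq'] q'w].
        exact: (quotient_cder q'w uE (dg q' q'r Dq')).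
      + by apply: filterS (near_disc qQ) => q' /ltW.
  have : cabs (u w1) <= m.
    apply: cto_le => //.
    apply: filterS (filterI (near_D1 w1 w1r Dw1) (near_disc w1Q)) => q [[qr Dq] qQ] qw.
    apply: um; last by rewrite mulf_neq0 ?subr_eq0.
    by rewrite /cdisc /=; lra.
  rewrite uw1 cabsM cabs1 mul1r cabsV -[_^-1]mul1r ler_pdivrMr// cabs_gt0//.
have m20 : 0 < 1 / m by rewrite divr_gt0.
have cD1 : ccont D1 z by have [_ h _ _] := HD z zr; exact: cder_cont h.
have cf : ccont f z by exact: cder_cont fc.
have Q20 : 0 < Q / 2 by rewrite divr_gt0.
have [d d0 dP] : exists2 d : R, 0 < d & forall q, cabs (q - z) < d ->
    (cabs (D1 q - D1 z) < 1 / m /\ cabs (f q - f z) < Q / 2) /\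
    (S q /\ cabs (q - z) < r).
  apply/nbhs_cabsP; apply: filterI.
    by apply: filterI; [exact: cD1|exact: cf].
  by apply: filterI; [exact: oS|exact: near_disc].
(* Near [z] the modulus of [D1] is below [1 / m], by continuity from [D1 z = 0]; by [key] only the
   value 0 is left. *)
have D10 q : cabs (q - z) < d -> cder f q 0.
  move=> qd; have [[h1 h2] [qS qr]] := dP q qd; have [h _ _ _] := HD q qr.
  have [D0|D0] := eqVneq (D1 q) 0; first by rewrite D0 in h.
  have [_ gfq] := fSV q qS.
  have := key (f q) h2; rewrite gfq => /(_ D0).
  move: h1; rewrite D1z subr0 ltr_pdivlMr// mulrC => h1; lra.
pose z1 := z + ((d / 2)%:C)%C.
have z1z : cabs (z1 - z) = d / 2 by rewrite /z1 addrC addKr cabs_real ger0_norm//; lra.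
have z1d : cabs (z1 - z) < d by rewrite z1z; lra.
have fz1 := cder0_cst D10 z1d.
have [_ [z1S _]] := dP z1 z1d.
have [_ gz1] := fSV z1 z1S; have [_ gz] := fSV z zS.
have : cabs (z1 - z) = 0 by rewrite -gz1 fz1 gz subrr cabs0.
by rewrite z1z; lra.
Qed.

End SchwarzAndInverse.

(** * Covering maps and their composition with homeomorphisms *)

Section CoveringComposition.
Variables X Y Z : topologicalType.

(** Makes the inverse [g] of [p] on a sheet explicit. Continuity of [g] is asked at each point of
    [V], which agrees with continuity within [V] because [V] is open. *)
Definition local_sheet (D : set X) (p : X -> Y) (V : set Y) (S : set X) (g : Y -> X) :=
  [/\ open S, S `<=` D, forall x, S x -> V (p x) /\ g (p x) = x &
    forall v, V v -> [/\ S (g v), p (g v) = v & {for v, continuous g}]].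

Lemma within_open_continuous (U W : topologicalType) (A : set U) (f : U -> W) :
  open A -> {within A, continuous f} <-> forall x, A x -> {for x, continuous f}.
Proof.
move=> oA; rewrite continuous_open_subspace//; split.
  by move=> cf x xA; apply: cf; rewrite inE.
by move=> cf x; rewrite inE => xA; apply: cf.
Qed.

(** All sets being open, continuity within a set is continuity at its points; disjointness of sheets
    becomes uniqueness of the sheet through a point. *)
Lemma covering_mapP (D : set X) (A : set Y) (p : X -> Y) : open D ->
  covering_map D A p <->
  [/\ forall x, D x -> {for x, continuous p}, p @` D = A &
    forall y, A y -> exists (V : set Y) (F : set (set X)),
      [/\ open V, V y, V `<=` A &
        [/\ forall x, D x -> V (p x) -> exists2 S, F S & S x,
            forall S S' x, F S -> F S' -> S x -> S' x -> S = S' &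
            forall S, F S -> exists g, local_sheet D p V S g]]].
Proof.
move=> oD; split => -[cp pD cov].
  split => //; first exact/within_open_continuous.
  move=> y /cov[V [oV Vy VA [F [oF tF FV homeo]]]].
  exists V, F; split => //; split.
  - move=> x xD Vpx; have : (D `&` p @^-1` V) x by [].
    by rewrite -FV => -[S FS Sx]; exists S.
  - by move=> S S' x FS FS' Sx S'x; apply: tF => //; exists x.
  - move=> S FS; have SD : S `<=` D `&` p @^-1` V.
      by rewrite -FV => x Sx; exists S.
    have [bij _ [g [cg gp]]] := homeo S FS.
    exists g; split; first exact: oF.
    + by move=> x /SD[].
    + by move=> x Sx; split; [have [] := SD x Sx|exact: gp].
    + move=> v Vv; have [_ _ /(_ v Vv)[x Sx pxv]] := bij.
      rewrite -pxv gp//; split => //.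
      by move/(within_open_continuous _ oV) : cg => /(_ v Vv); rewrite -pxv.
split => //; first exact/within_open_continuous.
move=> y /cov[V [F [oV Vy VA [Fc Fd Fs]]]].
exists V; split => //; exists F; split.
- by move=> S /Fs[g []].
- by move=> S S' FS FS' [x [Sx S'x]]; exact: Fd FS FS' Sx S'x.
- apply/seteqP; split.
    move=> x [S FS Sx]; have [g [_ SD Sg _]] := Fs S FS.
    by split; [exact: SD|have [] := Sg x Sx].
  by move=> x [xD Vpx]; have [S FS Sx] := Fc x xD Vpx; exists S.
- move=> S FS; have [g [oS SD Sg gS]] := Fs S FS; split.
  + split.
    * by move=> x /Sg[].
    * move=> x x'; rewrite !inE => /Sg[_ gx] /Sg[_ gx'] E.
      by rewrite -gx E.
    * by move=> v /gS[Sgv pgv _]; exists (g v).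
  + by apply/(within_open_continuous _ oS) => x /SD/cp.
  + exists g; split; last by move=> x /Sg[].
    by apply/(within_open_continuous _ oV) => v /gS[].
Qed.

End CoveringComposition.

(** The sheets stay the same; the evenly covered neighbourhoods are transported by [n], the inverse
    of the homeomorphism [m]. *)
Lemma covering_post (X Y Z : topologicalType) (D : set X) (A : set Y) (B : set Z)
    (p : X -> Y) (m : Y -> Z) (n : Z -> Y) : open D -> open B ->
  (forall y, A y -> [/\ B (m y), n (m y) = y & {for y, continuous m}]) ->
  (forall z, B z -> [/\ A (n z), m (n z) = z & {for z, continuous n}]) ->
  covering_map D A p -> covering_map D B (m \o p).
Proof.
move=> oD oB mA nB /(covering_mapP _ _ oD)[cp pD cov].
have pA x : D x -> A (p x) by rewrite -pD => xD; exists x.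
apply/(covering_mapP _ _ oD); split.
- move=> x xD; apply: continuous_comp; first exact: cp.
  by have [] := mA _ (pA x xD).
- apply/seteqP; split.
    by move=> _ [x xD <-]; have [] := mA _ (pA x xD).
  move=> z /nB[Anz mnz _]; move: Anz; rewrite -pD => -[x xD px].
  by exists x => //=; rewrite px.
move=> z zB; have [Anz mnz _] := nB z zB.
have [V [F [oV Vn VA [Fc Fd Fs]]]] := cov _ Anz.
exists [set z' | B z' /\ V (n z')], F; split.
- rewrite openE => z' [Bz' Vnz']; have [_ _ cn] := nB z' Bz'.
  apply: filterI; first by move: oB; rewrite openE; exact.
  by apply: cn; move: oV; rewrite openE; exact.
- by [].
- by move=> z' [].
split => //.
  move=> x xD [Bz Vz]; have [_ nm _] := mA _ (pA x xD).
  by apply: Fc => //; rewrite -nm.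
move=> S FS; have [g [oS SD Sg gS]] := Fs S FS.
exists (g \o n); split => //.
  move=> x Sx; have [Vpx gpx] := Sg x Sx.
  have [Bm nm _] := mA _ (pA x (SD x Sx)).
  by rewrite /= nm; split.
move=> v [Bv Vnv]; have [Sgn pgn cg] := gS _ Vnv; have [_ mnv cn] := nB v Bv.
by split => //=; [rewrite pgn|exact: continuous_comp].
Qed.

(** The evenly covered neighbourhoods stay the same; the sheets are pulled back by [phi]. *)
Lemma covering_pre (X Y : topologicalType) (D : set X) (A : set Y)
    (p : X -> Y) (phi psi : X -> X) : open D ->
  (forall x, D x -> [/\ D (phi x), psi (phi x) = x & {for x, continuous phi}]) ->
  (forall x, D x -> [/\ D (psi x), phi (psi x) = x & {for x, continuous psi}]) ->
  covering_map D A p -> covering_map D A (p \o phi).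
Proof.
move=> oD phiD psiD /(covering_mapP _ _ oD)[cp pD cov].
apply/(covering_mapP _ _ oD); split.
- move=> x xD; have [phix _ cphi] := phiD x xD.
  by apply: continuous_comp => //; exact: cp.
- rewrite -pD; apply/seteqP; split.
    by move=> _ [x /phiD[phix _ _] <-]; exists (phi x).
  by move=> _ [x /psiD[psix E _] <-]; exists (psi x) => //=; rewrite E.
move=> y yA; have [V [F [oV Vy VA [Fc Fd Fs]]]] := cov y yA.
exists V, ((fun S : set X => [set x | D x /\ S (phi x)]) @` F); split => //; split.
- move=> x xD Vx; have [Dphi _ _] := phiD x xD; have [S FS Sx] := Fc _ Dphi Vx.
  by exists [set x | D x /\ S (phi x)] => //; exists S.
- move=> _ _ x [S FS <-] [S' FS' <-] [xD Sx] [_ S'x].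
  by rewrite (Fd S S' (phi x)).
move=> _ [S FS <-]; have [g [oS SD Sg gS]] := Fs S FS.
exists (psi \o g); split.
- rewrite openE => x [xD Sx]; have [_ _ cphi] := phiD x xD.
  apply: filterI; first by move: oD; rewrite openE; exact.
  by apply: cphi; move: oS; rewrite openE; exact.
- by move=> x [].
- move=> x [xD Sx]; have [Vx gx] := Sg _ Sx; have [_ E _] := phiD x xD.
  by rewrite /= gx.
move=> v Vv; have [Sgv pgv cg] := gS v Vv.
have [Dpsi E cpsi] := psiD _ (SD _ Sgv).
by split; rewrite /= ?E//; exact: continuous_comp.
Qed.

(** * Lifting through a covering by the disc, and comparison of derivatives *)

Section Lifting.
Variable R : realType.
Local Notation C := (Cplane R).
Local Notation D := (@unit_disc R).
Implicit Types (p q f g : C -> C) (w x y z : C) (A V S : set C).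

(** The principle behind Lebesgue numbers and uniform continuity: a scale that works near each point
    of a compact set, and may be decreased, can be chosen once for all. The filter argument runs
    over the scales [1 / (n + 1)]. *)
Lemma compact_uniform (K : set C) (P : R -> C -> Prop) : compact K ->
  (forall (e e' : R) y, 0 < e' -> e' <= e -> P e y -> P e' y) ->
  (forall y, K y -> exists2 d : R, 0 < d & forall y', cabs (y' - y) < d -> P d y') ->
  exists2 e : R, 0 < e & forall y, K y -> P e y.
Proof.
move=> /compact_near_coveringP cK Pmono Ploc.
have H : \forall n \near \oo, K `<=` P n.+1%:R^-1.
  apply: (cK nat \oo (fun n y => P n.+1%:R^-1 y)) => y Ky.
  have [d d0 dP] := Ploc y Ky.
  have [N NP] : exists N : nat, d^-1 < N%:R.
    exists (Num.truncn `|d^-1|).+1; apply: le_lt_trans (ler_norm _) _.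
    exact: truncnS_gt.
  exists ([set y' | cabs (y' - y) < d], [set n | (N <= n)%N]).
    split => /=; last by exists N.
    by apply/nbhs_cabsP; exists d.
  move=> [y' n] [/= yd Nn]; apply: (Pmono d); rewrite ?invr_gt0//.
    rewrite -[leRHS]invrK lef_pV2 ?posrE ?invr_gt0//.
    by apply: le_trans (ltW NP) _; rewrite ler_nat; exact: leqW.
  exact: dP.
have [N _ NP] := H; exists N.+1%:R^-1; first by rewrite invr_gt0.
by apply: NP => /=.
Qed.

Lemma open_cabs (A : set C) : open A <->
  forall z, A z -> \forall w \near z, A w.
Proof. by rewrite openE. Qed.

Lemma unit_disc_open : open D.
Proof.
apply/open_cabs => z z1.
have zD : cabs (z - 0) < 1 by rewrite subr0.
change (nbhs z D); apply: filterS (near_disc zD) => w; rewrite subr0.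
exact.
Qed.

Definition sheet p V S g : Prop := [/\ open S, S `<=` D,
  forall x, S x -> V (p x) /\ g (p x) = x &
  forall v, V v -> [/\ S (g v), p (g v) = v & ccont g v]].

Definition evenly_covered p V : Prop := open V /\
  exists F : set (set C),
    [/\ forall x, D x -> V (p x) -> exists2 S, F S & S x,
        forall S S' x, F S -> F S' -> S x -> S' x -> S = S' &
        forall S, F S -> exists g, sheet p V S g].

Lemma covering_evenly A p y : covering_map D A p -> A y ->
  exists V, [/\ V y, V `<=` A & evenly_covered p V].
Proof.
move=> /(covering_mapP _ _ unit_disc_open)[_ _ cov].
move=> /cov[V [F [oV Vy VA [Fc Fd Fs]]]].
exists V; split => //; split => //; exists F; split => //.
move=> S /Fs[g [oS SD Sg gS]]; exists g; split => //.
by move=> v /gS[h1 h2 /continuous_ccont].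
Qed.

Lemma covering_cont A p z : covering_map D A p -> D z -> ccont p z.
Proof.
move=> /(covering_mapP _ _ unit_disc_open)[cp _ _] zD.
exact/continuous_ccont/cp.
Qed.

(** On the sheet through [z] the covering has a continuous inverse, so the result on injective
    functions applies. *)
Lemma covering_cder_neq0 A p z c : covering_map D A p ->
  (forall w, D w -> exists d, cder p w d) -> D z -> cder p z c -> c != 0.
Proof.
move=> cov dp zD pc.
have Apz : A (p z) by have [_ <- _] := cov; exists z.
have [V [Vpz VA [oV [F [Fc _ Fs]]]]] := covering_evenly cov Apz.
have [S FS Sz] := Fc z zD Vpz.
have [g [oS SD Sg gS]] := Fs S FS.
apply: (@inverse_cder_neq0 _ p g S V z c) => //.
by move=> w /SD/dp.
Qed.

(** Connectedness of the unit interval, by bisection: on a short parameter interval the path stays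
    in one open sheet, and two sheets that share a point coincide. *)
Lemma path_sheet p V F S S1 g (gam : R -> C) :
  (forall x, D x -> V (p x) -> exists2 S, F S & S x) ->
  (forall S S' x, F S -> F S' -> S x -> S' x -> S = S') ->
  (forall S, F S -> open S) -> F S1 ->
  (forall t : R, 0 <= t <= 1 -> [/\ D (g (gam t)), V (p (g (gam t)))
     & cto (nbhs t) (fun s => g (gam s)) (g (gam t))]) ->
  S1 (g (gam 0)) -> S1 (g (gam 1)).
Proof.
move=> Fc Fd Fo FS1 gP S0.
have [H _] : S1 (g (gam 0)) <-> S1 (g (gam (0 + 1))); last by rewrite add0r in H; exact: H.
refine (@rect_bisect R (fun x y w h : R => S1 (g (gam x)) <-> S1 (g (gam (x + w))))
  0 0 1 0 ler01 (lexx 0) _ _).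
  by move=> x y w h _ _ _ _ _ _ p1 p2 _ _; rewrite addrA p1.
move=> a b; rewrite add0r => a01 _.
have [aD aV ac] := gP a a01; have [S2 FS2 S2a] := Fc _ aD aV.
have /nbhs_cabsP[e e0 eP] := (proj1 (open_cabs S2) (Fo _ FS2)) _ S2a.
have /nbhs_normP[d d0 dP] := ac e e0.
exists d; first exact: d0.
move=> x y w h w0 _ x0 _ x1 _ xa _ wd _.
have S2x : S2 (g (gam x)) by apply/eP/dP; rewrite /ball_/= ltr_norml; lra.
have S2xw : S2 (g (gam (x + w))) by apply/eP/dP; rewrite /ball_/= ltr_norml; lra.
by split => S1x; [rewrite (Fd S1 S2 (g (gam x)))|rewrite (Fd S1 S2 (g (gam (x + w))))].
Qed.

(* [f1 w] is the point over [q1 w] in the sheet through [f w]; it does not depend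
   on the choice of the evenly covered neighbourhood because discs are connected. *)
Lemma lift_step p (K X : set C) (eta : R) f q0 q1 : 0 < eta ->
  (forall y, K y -> exists V, (forall y', cabs (y' - y) < 2 * eta -> V y') /\
     evenly_covered p V) ->
  (forall z, D z -> ccont p z) ->
  (forall w, X w -> [/\ D (f w), ccont f w, p (f w) = q0 w & K (q0 w)]) ->
  (forall w, X w -> ccont q0 w) ->
  (forall w, X w -> ccont q1 w /\ cabs (q1 w - q0 w) < eta) ->
  open X ->
  exists f1, forall w, X w -> [/\ D (f1 w), ccont f1 w, p (f1 w) = q1 w &
    q1 w = q0 w -> f1 w = f w].
Proof.
move=> eta0 leb cp fX cq0 q1X oX.
(* [G x] is the inverse of [p] on the sheet through [x]. It is chosen separately for each [x], so
   the continuity of [w |-> G (f w) (q1 w)] is the real content. *)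
have [G GP] : {G : C -> C -> C & forall x, D x -> K (p x) -> exists V F S,
   [/\ forall y', cabs (y' - p x) < 2 * eta -> V y', open V,
   [/\ forall x, D x -> V (p x) -> exists2 S, F S & S x,
        forall S S' x, F S -> F S' -> S x -> S' x -> S = S' &
        forall S, F S -> exists g, sheet p V S g],
   F S /\ S x & sheet p V S (G x)]}.
  apply: (@choice _ _ (fun x g => D x -> K (p x) -> exists V F S,
   [/\ forall y', cabs (y' - p x) < 2 * eta -> V y', open V,
   [/\ forall x, D x -> V (p x) -> exists2 S, F S & S x,
        forall S S' x, F S -> F S' -> S x -> S' x -> S = S' &
        forall S, F S -> exists g, sheet p V S g],
   F S /\ S x & sheet p V S g])) => x.
  have [xD|nx] := pselect (D x); last by exists id.
  have [Kx|nx] := pselect (K (p x)); last by exists id.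
  have [V [bV [oV [F [Fc Fd Fs]]]]] := leb _ Kx.
  have Vpx : V (p x) by apply: bV; rewrite subrr cabs0 mulr_gt0.
  have [S FS Sx] := Fc x xD Vpx; have [g gS] := Fs S FS.
  by exists g => _ _; exists V, F, S; split.
exists (fun w => G (f w) (q1 w)) => w1 w1X.
have [fD cf pf Kq] := fX w1 w1X.
have Kpf : K (p (f w1)) by rewrite pf.
have [V1 [F1 [S1 [bV1 oV1 [Fc1 Fd1 Fs1] [FS1 S1x] [oS1 S1D Sg1 gS1]]]]] := GP _ fD Kpf.
have [cq1 q1q0] := q1X w1 w1X.
have V1q1 : V1 (q1 w1) by apply: bV1; rewrite pf; lra.
have [Sgq pgq cgq] := gS1 _ V1q1.
split; [exact: S1D|..|exact: pgq|]; last first.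
  by move=> ->; rewrite -pf; have [] := Sg1 _ S1x.
apply: (@cto_eq_near _ _ _ (nbhs_filter w1) (fun w => G (f w1) (q1 w))); last first.
  exact: (cto_comp (nbhs_filter w1) cq1 cgq).
have nS1 : \forall w \near w1, S1 (f w).
  exact: (ccont_near cf (proj1 (open_cabs S1) oS1 _ S1x)).
have nX := proj1 (open_cabs X) oX _ w1X.
have nq0 : \forall w \near w1, cabs (q0 w - q0 w1) < eta by exact: cq0.
apply: filterS (filterI (filterI nS1 nX) nq0) => w [[S1w wX] wq0].
have [fDw cfw pfw Kqw] := fX w wX.
have Kpfw : K (p (f w)) by rewrite pfw.
have [V [F [S [bV oV [Fc Fd Fs] [FS Sx] [oS SD Sg gS]]]]] := GP _ fDw Kpfw.
have [cq1w q1q0w] := q1X w wX.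
have q1V : V (q1 w) by apply: bV; rewrite pfw; lra.
pose gam (t : R) : C := p (f w) + (t%:C)%C * (q1 w - p (f w)).
have gamB (t : R) : 0 <= t <= 1 -> cabs (gam t - p (f w)) < eta.
  move=> t01; rewrite /gam addrC addKr cabsM cabs_real.
  have t1 : `|t| <= 1 by rewrite ler_norml; lra.
  rewrite pfw; apply: le_lt_trans q1q0w; rewrite ler_piMl ?cabs_ge0//.
have gam0 : gam 0 = p (f w) by rewrite /gam -[(0%:C)%C]/(0 : C) mul0r addr0.
have gam1 : gam 1 = q1 w by rewrite /gam -[(1%:C)%C]/(1 : C) mul1r addrC subrK.
have gamV (t : R) : 0 <= t <= 1 -> V (gam t).
  by move=> /gamB h; apply: bV; lra.
(* The segment stays within [eta] of [p (f w)], itself within [eta] of [p (f w1)]: here the discs of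
   radius [2 * eta] are used. *)
have gamV1 (t : R) : 0 <= t <= 1 -> V1 (gam t).
  move=> /gamB h; apply: bV1; have := cabs_triangle (p (f w)) (gam t) (p (f w1)).
  rewrite {2}pfw pf; lra.
have cgam (t : R) : cto (nbhs t) gam (gam t).
  apply: (@ctoD _ _ _ (nbhs_filter t)).
    exact: (@cto_cst _ _ _ (nbhs_filter t)).
  apply: (@ctoM _ _ _ (nbhs_filter t)); first exact: cto_Complexl.
  exact: (@cto_cst _ _ _ (nbhs_filter t)).
have : S1 (G (f w) (gam 1)).
  apply: (@path_sheet p V1 F1 S1 S1 (G (f w)) gam) => //.
  - by move=> S' /Fs1[g []].
  - move=> t t01; have [h1 h2 h3] := gS _ (gamV t t01); split.
    + exact: SD.
    + by rewrite h2; exact: gamV1.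
    + exact: (cto_comp (nbhs_filter t) (cgam t) h3).
  - by rewrite gam0; have [_ ->] := Sg _ Sx.
rewrite gam1 => S1G; have [_ h] := Sg1 _ S1G.
by have [_ h2 _] := gS _ q1V; rewrite h2 in h.
Qed.

Lemma continuous_image_compact (K : set C) f : compact K ->
  (forall z, K z -> ccont f z) -> compact (f @` K).
Proof.
move=> cK cf; apply: continuous_compact => //.
apply: continuous_in_subspaceT => z; rewrite inE => zK.
exact/continuous_ccont/cf.
Qed.

(** Radial homotopy: [w |-> f (k / N * w)] is lifted for successive [k], from the constant lift for
    [k = 0] up to [f] itself. The radius [r < 1] provides a compact disc, hence a Lebesgue number
    for its image and uniform continuity of [f]. *)
Lemma lift_exists A p f (r : R) : covering_map D A p ->
  (forall z, D z -> ccont f z) -> (forall z, D z -> A (f z)) ->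
  p 0 = f 0 -> 0 < r -> r < 1 ->
  exists g, forall w, cabs w < r -> [/\ D (g w), ccont g w, p (g w) = f w & g 0 = 0].
Proof.
move=> cov cf fA pf0 r0 r1.
have KD z : cdisc 0 r z -> D z.
  by rewrite /cdisc /unit_disc /= subr0 => h; exact: le_lt_trans h r1.
pose K := f @` cdisc 0 r.
have cK : compact K.
  by apply: continuous_image_compact; [exact: cdisc_compact|move=> z /KD/cf].
have [eta' eta'0 etaP] : exists2 e : R, 0 < e & forall y, K y ->
    exists V, (forall y', cabs (y' - y) < e -> V y') /\ evenly_covered p V.
  apply: (@compact_uniform K (fun e y => exists V, (forall y', cabs (y' - y) < e -> V y')
    /\ evenly_covered p V)) => //.
    move=> e e' y e'0 e'e [V [bV eV]]; exists V; split => // y' h; apply: bV; lra.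
  move=> y [z /KD zD <-]; have [V [Vy _ eV]] := covering_evenly cov (fA z zD).
  have [oV _] := eV; have /nbhs_cabsP[d d0 dP] := proj1 (open_cabs V) oV _ Vy.
  exists (d / 2); first by rewrite divr_gt0.
  move=> y' y'd; exists V; split => // y'' h; apply: dP.
  have := cabs_triangle y' y'' (f z); lra.
pose eta := eta' / 2; have eta0 : 0 < eta by rewrite divr_gt0.
have leb y : K y -> exists V, (forall y', cabs (y' - y) < 2 * eta -> V y') /\
     evenly_covered p V.
  by move=> /etaP; have -> : eta' = 2 * eta by rewrite /eta; field.
have [del del0 delP] : exists2 e : R, 0 < e & forall z, cdisc 0 r z ->
    forall z', cabs (z' - z) < e -> cabs (f z' - f z) < eta.
  apply: (@compact_uniform (cdisc 0 r) (fun e z => forall z', cabs (z' - z) < e ->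
    cabs (f z' - f z) < eta)).
  - exact: cdisc_compact.
  - by move=> e e' z e'0 e'e H z' h; apply: H; lra.
  - move=> z /KD zD; have e2 : 0 < eta / 2 by rewrite divr_gt0.
    have /ccontP/(_ _ e2)[d d0 dP] := cf z zD.
    exists (d / 2); first by rewrite divr_gt0.
    move=> z' z'd z'' h; have h1 := dP z' ltac:(lra).
    have h2 := dP z'' ltac:(have := cabs_triangle z' z'' z; lra).
    have := cabs_triangle (f z) (f z'') (f z'); rewrite (cabsB (f z) (f z')); lra.
(* Two consecutive rescalings of a point of the disc differ by at most [1 / N < del]. *)
have [N NP] : exists N : nat, del^-1 < N%:R.
  exists (Num.truncn `|del^-1|).+1; apply: le_lt_trans (ler_norm _) _.
  exact: truncnS_gt.
have N0 : 0 < N%:R :> R by apply: lt_trans NP; rewrite invr_gt0.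
pose sc (k : nat) : C := ((k%:R / N%:R)%:C)%C.
have sc_abs k : cabs (sc k) = k%:R / N%:R.
  by rewrite cabs_real ger0_norm// divr_ge0.
pose X : set C := [set w | cabs w < r].
have oX : open X.
  apply/open_cabs => w wr.
  have wr' : cabs (w - 0) < r by rewrite subr0.
  change (nbhs w X); apply: filterS (near_disc wr') => q; rewrite subr0.
  exact.
have scX k w : (k <= N)%N -> X w -> X (sc k * w).
  move=> kN wX; rewrite /X /= cabsM sc_abs; apply: le_lt_trans wX.
  by rewrite ler_piMl ?cabs_ge0// ler_pdivrMr// mul1r ler_nat.
have XD w : X w -> cdisc 0 r w by rewrite /X /cdisc /= subr0 => /ltW.
have step k : (k <= N)%N -> exists g, forall w, X w ->
    [/\ D (g w), ccont g w, p (g w) = f (sc k * w) & g 0 = 0].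
  elim: k => [|k IH] kN.
    exists (fun=> 0) => w _; split => //.
    - by change (cabs (0 : C) < 1); rewrite cabs0.
    - exact: (@cto_cst _ _ _ (nbhs_filter w)).
    - by rewrite pf0 /sc mul0r -[(0%:C)%C]/(0 : C) mul0r.
  have kN' : (k <= N)%N := ltnW kN.
  have [g gP] := IH kN'.
  have csc j w : (j <= N)%N -> X w -> ccont (fun w => f (sc j * w)) w.
    move=> jN wX; apply: (@cto_comp _ _ _ (nbhs_filter w) (fun w => sc j * w)).
      apply: (@ctoM _ _ _ (nbhs_filter w)); last exact: ccont_id.
      exact: (@cto_cst _ _ _ (nbhs_filter w)).
    by apply/cf/KD/XD/scX.
  have [g1 g1P] := @lift_step p K X eta g (fun w => f (sc k * w))
    (fun w => f (sc k.+1 * w)) eta0 leb (fun z zD => covering_cont cov zD)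
    (fun w wX => let: And4 a b c d := gP w wX in
       And4 a b c (ex_intro2 _ _ (sc k * w) (XD _ (scX k w kN' wX)) erefl))
    (fun w wX => csc k w kN' wX)
    ltac:(move=> w wX; split; [exact: csc|apply: delP; [exact/XD/scX|];
      rewrite -mulrBl cabsM;
      have -> : sc k.+1 - sc k = ((N%:R^-1)%:C)%C by
        rewrite /sc -[LHS]/(Complex (_ - _) (0 - 0)) subrr -mulrBl -natr1 addrC addKr mul1r];
      rewrite cabs_real ger0_norm ?invr_ge0//;
      apply: (@le_lt_trans _ _ N%:R^-1);
      [by rewrite ler_piMr ?invr_ge0// ltW// (lt_trans wX)//|
       by rewrite -[ltRHS]invrK ltf_pV2 ?posrE ?invr_gt0//]) oX.
  exists g1 => w wX; have [h1 h2 h3 h4] := g1P w wX; split => //.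
  (* All rescalings agree at 0, so the last clause of [lift_step] keeps the value of the lift
     there. *)
  have X0 : X 0 by change (cabs (0 : C) < r); rewrite cabs0.
  have [_ _ _ ->] := g1P 0 X0; last by rewrite !mulr0.
  by have [] := gP 0 X0.
have [g gP] := step N (leqnn N).
exists g => w wX; have [h1 h2 h3 h4] := gP w wX; split => //.
by rewrite h3 /sc divff ?gt_eqF// -[(1%:C)%C]/(1 : C) mul1r.
Qed.

(** The lift of [q] through [p] fixes 0 and has derivative [b / a] there. It is available only on
    smaller discs, so Schwarz's lemma gives [|b / a| * r <= 1] for each [r < 1], and [r] tends to
    1. *)
Theorem covering_deriv_le A p q a b : covering_map D A p -> covering_map D A q ->
  (forall z, D z -> exists c, cder p z c) -> (forall z, D z -> exists c, cder q z c) ->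
  p 0 = q 0 -> cder p 0 a -> cder q 0 b -> cabs b <= cabs a.
Proof.
move=> cp cq dp dq pq pa qb.
have D0 : D 0 by change (cabs (0 : C) < 1); rewrite cabs0.
have a0 : a != 0 := covering_cder_neq0 cp dp D0 pa.
have a1 : 0 < cabs a by rewrite cabs_gt0.
have key (r : R) : 0 < r -> r < 1 -> cabs (b / a) * r <= 1.
  move=> r0 r1; pose r2 := (r + 1) / 2.
  have r20 : 0 < r2 by rewrite /r2; lra.
  have r21 : r2 < 1 by rewrite /r2; lra.
  have rr2 : r < r2 by rewrite /r2; lra.
  have qA z : D z -> A (q z) by move=> zD; have [_ <- _] := cq; exists z.
  have [g gP] := lift_exists cp (fun z zD => covering_cont cq zD) qA pq r20 r21.
  have inD w : cabs w < r2 -> D w by rewrite /unit_disc /= => h; lra.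
  have dg w c : cabs w < r2 -> cder q w c -> forall d, cder p (g w) d ->
      cder g w (c / d).
    move=> wr qc d pd; have [gD cg pg _] := gP w wr.
    apply: (cder_lift pd (covering_cder_neq0 cp dp gD pd) qc cg).
    have wr' : cabs (w - 0) < r2 by rewrite subr0.
    by apply: filterS (near_disc wr') => w'; rewrite subr0 => /gP[].
  have r2' : cabs (0 : C) < r2 by rewrite cabs0.
  have [_ _ _ g0] := gP 0 r2'.
  apply: (@schwarz _ g r2 r) => //.
  - move=> w wr; have [gD _ _ _] := gP w wr.
    have [c qc] := dq w (inD w wr); have [d pd] := dp _ gD.
    by exists (c / d); exact: dg.
  - by move=> w /gP[].
  - by apply: dg => //; rewrite g0.
rewrite -(mul1r (cabs a)) -ler_pdivrMr// -cabsV -cabsM.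
(* The radius used is [1 / (1 + e)], which gives [|b / a| <= 1 + e]. *)
apply/ler_addgt0Pl => e e0.
have e1 : 0 < 1 + e by lra.
have := key (1 + e)^-1; rewrite invr_gt0 => /(_ e1).
rewrite invf_lt1// ltrDl => /(_ e0).
by rewrite ler_pdivrMr// mul1r addrC.
Qed.

End Lifting.

(** * Charts of the sphere, affine maps and automorphisms of the disc *)

Section SphereCharts.
Variable R : realType.
Local Notation C := (Cplane R).
Local Notation S := (Csphere R).
Local Notation D := (@unit_disc R).
Implicit Types (a b c u v w y z k l : C).

(** The Moebius map [1 / (z - a)]: it sends the puncture [a] to infinity and infinity to [0], so
    that coverings of the punctured sphere become plane-valued. At [Some a] the value is the junk
    [0]. *)
Definition to_plane a (x : S) : C := if x is Some z then (z - a)^-1 else 0.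
Definition of_plane a (y : C) : S := if y == 0 then None else Some (a + y^-1).

Lemma nbhs_SomeP (z : C) (U : set S) :
  nbhs (Some z : S) U <-> \forall w \near z, U (Some w).
Proof. by []. Qed.

Lemma nbhs_NoneP (U : set S) : nbhs (None : S) U <->
  U None /\ exists M : R, forall z, M < cabs z -> U (Some z).
Proof.
split.
  move=> [K [cK clK] KU]; split; first by apply: KU; right.
  have [M MP] : exists M : R, forall z, K z -> cabs z <= M.
    have [K0|/set0P[w Kw]] := eqVneq K set0.
      by exists 0 => z; rewrite K0.
    have [z Kz zP] := @compact_max R (fun z => cabs z) K cK (ex_intro _ w Kw)
      (fun z _ => @cvg_cabs R z).
    by exists (cabs z).
  exists M => z Mz; apply: KU; left; exists z => // /MP.
  by rewrite leNgt Mz.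
move=> [UN [M MP]]; exists (cdisc 0 M).
  by split; [exact: cdisc_compact|exact: cdisc_closed].
move=> _ [[z nz <-]|->//]; apply: MP.
by rewrite ltNge; apply/negP; move: nz; rewrite /cdisc /= subr0.
Qed.

Lemma to_planeK a x : x <> Some a -> of_plane a (to_plane a x) = x.
Proof.
rewrite /of_plane /to_plane; case: x => [z|] xa; last by rewrite eqxx.
have za : z - a != 0.
  by rewrite subr_eq0; apply/eqP => E; apply: xa; rewrite E.
by rewrite invr_eq0 (negbTE za) invrK addrC subrK.
Qed.

Lemma of_planeK a y : to_plane a (of_plane a y) = y.
Proof.
rewrite /of_plane /to_plane; case: eqVneq => [->//|y0].
by rewrite addrC addKr invrK.
Qed.

Lemma of_plane_neq a y : of_plane a y <> Some a.
Proof.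
rewrite /of_plane; case: eqVneq => // y0 [] /eqP.
by rewrite -subr_eq0 addrC addKr invr_eq0 (negbTE y0).
Qed.

Lemma to_plane_cont a x : x <> Some a -> {for x, continuous (to_plane a)}.
Proof.
case: x => [z|] xa U.
  have za : z != a by apply/eqP => E; apply: xa; rewrite E.
  have [d /cder_cont /continuous_ccont cz] := cderV_sub za.
  by move=> /cz.
move=> /nbhs_cabsP[d d0 dU]; apply/nbhs_NoneP; split.
  by apply: dU; rewrite subrr cabs0.
exists (cabs a + d^-1) => z zM; apply: dU; rewrite /to_plane subr0 cabsV.
have h : d^-1 < cabs (z - a) by have := ler_cabsB z a; lra.
rewrite -[ltRHS]invrK ltf_pV2 ?posrE ?invr_gt0//.
by apply: lt_trans h; rewrite invr_gt0.
Qed.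

Lemma of_plane_cont a y : {for y, continuous (of_plane a)}.
Proof.
move=> U; have [->|y0] := eqVneq y 0.
  rewrite {1}/of_plane eqxx => /nbhs_NoneP[UN [M MU]].
  have k0 : 0 < `|M| + cabs a + 1 by rewrite ltr_wpDl// addr_ge0 ?cabs_ge0.
  apply/nbhs_cabsP; exists (`|M| + cabs a + 1)^-1; first by rewrite invr_gt0.
  move=> w; rewrite subr0 => wM /=; rewrite /of_plane; case: eqVneq => // w0.
  apply: MU; have := ler_cabsB w^-1 (- a); rewrite opprK addrC cabsN.
  have : `|M| + cabs a + 1 < cabs w^-1.
    rewrite cabsV -[ltLHS]invrK ltf_pV2 ?posrE ?invr_gt0 ?cabs_gt0//.
  have := ler_norm M; rewrite [a + _]addrC; lra.
rewrite {1}/of_plane (negbTE y0) => /nbhs_SomeP nU.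
have cy : ccont (fun w => a + w^-1) y.
  apply: (@ctoD _ _ _ (nbhs_filter y)).
    exact: (@cto_cst _ _ _ (nbhs_filter y)).
  by apply: (@ctoV _ _ _ (nbhs_filter y)) => //; exact: ccont_id.
have n1 := ccont_near cy nU; have n2 := near_neq y0.
change (nbhs y (fun w => U (of_plane a w))).
apply: filterS (filterI n1 n2) => w [Uw w0].
by rewrite /of_plane (negbTE w0).
Qed.

Lemma open_setC2 u v : open (~` [set u; v] : set C).
Proof.
apply/open_cabs => z nz.
have [zu zv] : z != u /\ z != v.
  by split; apply/eqP => E; apply: nz; rewrite E; [left|right].
change (nbhs z (~` [set u; v] : set C)).
apply: filterS (filterI (near_neq zu) (near_neq zv)) => w [/eqP wu /eqP wv].
by case.
Qed.

Lemma open_thrice a b c : open (thrice_punctured_sphere a b c).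
Proof.
rewrite openE => -[z|] nz.
  have [za zb zc] : [/\ z != a, z != b & z != c].
    split; apply/eqP => E; apply: nz; rewrite E; [by left; left|by left; right|by right].
  apply/nbhs_SomeP.
  apply: filterS (filterI (near_neq za) (filterI (near_neq zb) (near_neq zc))).
  by move=> w [/eqP wa [/eqP wb /eqP wc]] [[[]|[]]|[]].
apply/nbhs_NoneP; split; first by move=> [[]|].
exists (cabs a + cabs b + cabs c) => z zM.
have ha := cabs_ge0 a; have hb := cabs_ge0 b; have hc := cabs_ge0 c.
by move=> [[[E]|[E]]|[E]]; move: zM; rewrite E; lra.
Qed.

Definition plane_cover u v (P : C -> C) : Prop :=
  covering_map D (~` [set u; v]) P /\ forall w, D w -> exists d, cder P w d.

Lemma to_plane_set a b c : a <> b -> a <> c -> forall x,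
  thrice_punctured_sphere a b c x ->
  [/\ (~` [set (b - a)^-1; (c - a)^-1] : set C) (to_plane a x),
    of_plane a (to_plane a x) = x & {for x, continuous (to_plane a)}].
Proof.
move=> ab ac x nx.
have xa : x <> Some a by move=> E; apply: nx; left; left.
have xb : x <> Some b by move=> E; apply: nx; left; right.
have xc : x <> Some c by move=> E; apply: nx; right.
split; [|exact: to_planeK|exact: to_plane_cont].
have key (e : C) : a <> e -> x <> Some e -> to_plane a x <> (e - a)^-1.
  move=> ae xe E; apply: xe; rewrite -(to_planeK xa) E /of_plane.
  have ea : e - a != 0 by rewrite subr_eq0; apply/eqP => /esym.
  by rewrite invr_eq0 (negbTE ea) invrK addrC subrK.
by move=> [] /key; [apply|apply].
Qed.

Lemma of_plane_set a b c : a <> b -> a <> c -> forall y,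
  (~` [set (b - a)^-1; (c - a)^-1] : set C) y ->
  [/\ thrice_punctured_sphere a b c (of_plane a y),
    to_plane a (of_plane a y) = y & {for y, continuous (of_plane a)}].
Proof.
move=> ab ac y ny; split; [|exact: of_planeK|exact: of_plane_cont].
have key (e : C) : of_plane a y = Some e -> y = (e - a)^-1.
  by move=> E; rewrite -(of_planeK a y) E.
move=> [[|]|].
- exact: of_plane_neq.
- by move=> /key E; apply: ny; left.
- by move=> /key E; apply: ny; right.
Qed.

(** Holomorphy is checked in the two charts: at a finite value by differentiating [1 / (z - a)], at
    infinity through [1 / (z - a) = t / (1 - a t)] with [t = 1 / z]. *)
Lemma sphere_to_plane a b c z p : a <> b -> a <> c ->
  holomorphic_covering (thrice_punctured_sphere a b c) z p ->
  [/\ plane_cover (b - a)^-1 (c - a)^-1 (to_plane a \o p),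
      (to_plane a \o p) 0 = (z - a)^-1, z != a &
      exists d, cder (@chart_fin R \o p) 0 d /\
        cder (to_plane a \o p) 0 (- d / (z - a) ^+ 2)].
Proof.
move=> ab ac [cov hol p0].
have D0 : D 0 by change (cabs (0 : C) < 1); rewrite cabs0.
have pA w : D w -> thrice_punctured_sphere a b c (p w).
  by move=> wD; have [_ <- _] := cov; exists w.
have pa w : D w -> p w <> Some a by move=> /pA nx E; apply: nx; left; left.
have za : z != a by apply/eqP => E; apply: (pa 0 D0); rewrite p0 E.
have fin_near w z' : D w -> p w = Some z' ->
    \forall q \near w, (to_plane a \o p) q = ((@chart_fin R \o p) q - a)^-1.
  move=> wD pw; have [cp _ _] := hol w wD.
  have : \forall q \near w, p q <> None.
    apply: (cp (fun x => x <> None)); rewrite pw.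
    by apply/nbhs_SomeP; exact: filterE.
  by apply: filterS => q; rewrite /= /to_plane /chart_fin; case: (p q).
have cder_fin w z' d : D w -> p w = Some z' -> cder (@chart_fin R \o p) w d ->
    cder (to_plane a \o p) w (- d / (z' - a) ^+ 2).
  move=> wD pw pd; have fn := fin_near w z' wD pw.
  apply: (@cder_eq_near _ (fun q => ((@chart_fin R \o p) q - a)^-1)).
    by apply: filterS fn => q ->.
  have z'E : (@chart_fin R \o p) w = z' by rewrite /= pw.
  have z'a : z' - a != 0.
    by rewrite subr_eq0; apply/eqP => E; apply: (pa w wD); rewrite pw E.
  have := @cderV _ (fun q => (@chart_fin R \o p) q - a) w (d - 0).
  rewrite z'E subr0; apply => //.
  by rewrite -[X in cder _ _ X]subr0; exact: (cderB pd (cder_cst a w)).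
split.
- split.
    apply: (covering_post _ _ (to_plane_set ab ac) (of_plane_set ab ac) cov).
      exact: unit_disc_open.
    exact: open_setC2.
  move=> w wD; have [cp hf hi] := hol w wD.
  case pw : (p w) => [z'|].
    have [d pd] : exists d, cder (@chart_fin R \o p) w d.
      by apply/derivable_cder/hf; rewrite pw.
    by eexists; exact: (cder_fin w z' d wD pw pd).
  have [d pd] : exists d, cder (@chart_inf R \o p) w d.
    by apply/derivable_cder/hi.
  have iw : (@chart_inf R \o p) w = 0 by rewrite /= pw.
  have den : 1 - a * (@chart_inf R \o p) w != 0 by rewrite iw mulr0 subr0 oner_neq0.
  have [e eP] : exists e, cder (fun q => (1 - a * (@chart_inf R \o p) q)^-1) w e.
    eexists; apply: (@cderV _ (fun q => 1 - a * (@chart_inf R \o p) q)) => //.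
    exact: (cderB (cder_cst 1 w) (cderM (cder_cst a w) pd)).
  eexists; apply: (@cder_eq_near _
    (fun q => (@chart_inf R \o p) q * (1 - a * (@chart_inf R \o p) q)^-1)).
    (* The value [Some 0] is avoided because [chart_inf] is [0] there by the convention on inverses,
       and the relation between the charts may fail. *)
    have n1 : \forall q \near w, p q <> Some 0 /\ p q <> Some a.
      apply: (cp (fun x => x <> Some 0 /\ x <> Some a)); rewrite pw.
      apply/nbhs_NoneP; split => //; exists (cabs a) => z' z'a.
      have := cabs_ge0 a => a0.
      by split => -[E]; move: z'a; rewrite E ?cabs0; lra.
    apply: filterS n1 => q []; rewrite /= /chart_inf /to_plane.
    case: (p q) => [z'|_ _]; last by rewrite mul0r.
    move=> z0 z'a.
    have z'0 : z' != 0 by apply/eqP => E; apply: z0; rewrite E.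
    have z'a' : z' - a != 0 by rewrite subr_eq0; apply/eqP => E; apply: z'a; rewrite E.
    by field; rewrite z'0 z'a'.
  exact: (cderM pd eP).
- by rewrite /= p0.
- by [].
have [cp hf _] := hol 0 D0.
have [d pd] : exists d, cder (@chart_fin R \o p) 0 d.
  by apply/derivable_cder/hf; rewrite p0.
by exists d; split => //; exact: cder_fin.
Qed.

(** Near a zero of [P] the chart at infinity reads [1 / (a + 1 / P) = P / (1 + a P)]. *)
Lemma plane_to_sphere a b c (P : C -> C) y d : a <> b -> a <> c ->
  plane_cover (b - a)^-1 (c - a)^-1 P -> P 0 = y -> y != 0 -> cder P 0 d ->
  holomorphic_covering (thrice_punctured_sphere a b c) (a + y^-1) (of_plane a \o P)
  /\ cder (@chart_fin R \o (of_plane a \o P)) 0 (- d / y ^+ 2).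
Proof.
move=> ab ac [cov dP] P0 y0 Pd.
have cP w : D w -> ccont P w by move=> /dP[e /cder_cont].
have cder_fin w e : D w -> P w != 0 -> cder P w e ->
    cder (@chart_fin R \o (of_plane a \o P)) w (- e / (P w) ^+ 2).
  move=> wD Pw Pe.
  apply: (@cder_eq_near _ (fun q => a + (P q)^-1)).
    apply: filterS (ccont_neq0 (cP w wD) Pw) => q Pq.
    by rewrite /= /of_plane (negbTE Pq).
  rewrite -[X in cder _ _ X]add0r.
  exact: (cderD (cder_cst a w) (cderV Pw Pe)).
have D0 : D 0 by change (cabs (0 : C) < 1); rewrite cabs0.
split; last by rewrite -P0; apply: cder_fin => //; rewrite P0.
split; last by rewrite /= P0 /of_plane (negbTE y0).
  apply: (covering_post _ _ (of_plane_set ab ac) (to_plane_set ab ac) cov).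
    exact: unit_disc_open.
  exact: open_thrice.
move=> w wD; have [e Pe] := dP w wD; split.
- apply: continuous_comp; last exact: of_plane_cont.
  exact/continuous_ccont/cP.
- move=> nw; have Pw : P w != 0.
    by apply/eqP => Pw; apply: nw; rewrite /= /of_plane Pw eqxx.
  by apply/derivable_cder; eexists; exact: cder_fin Pe.
- move=> nw; have Pw : P w = 0.
    by move: nw; rewrite /= /of_plane; case: eqVneq.
  apply/derivable_cder.
  have den : 1 + a * P w != 0 by rewrite Pw mulr0 addr0 oner_neq0.
  have dden := cderD (cder_cst 1 w) (cderM (cder_cst a w) Pe).
  eexists; apply: (@cder_eq_near _ (fun q => P q * (1 + a * P q)^-1)).
    have n1 : \forall q \near w, 1 + a * P q != 0.
      exact: (ccont_neq0 (cder_cont dden) den).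
    apply: filterS n1 => q n1; rewrite /= /of_plane /chart_inf.
    case: eqVneq => [->|Pq]; first by rewrite mul0r.
    have -> : a + (P q)^-1 = (1 + a * P q) / P q by field.
    by rewrite invf_div.
  exact: (cderM Pe (@cderV _ (fun q => 1 + a * P q) _ _ den dden)).
Qed.

Lemma plane_cover_affine u v k l (P : C -> C) : k != 0 -> plane_cover u v P ->
  plane_cover (k * u + l) (k * v + l) (fun w => k * P w + l).
Proof.
move=> k0 [cov dP]; split; last first.
  move=> w /dP[d Pd]; eexists.
  exact: (cderD (cderM (cder_cst k w) Pd) (cder_cst l w)).
have caff (k' l' y : C) : {for y, continuous (fun w => k' * w + l')}.
  apply/continuous_ccont.
  exact: (cder_cont (cderD (cderM (cder_cst k' y) (cder_id y)) (cder_cst l' y))).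
have inj : injective (fun w : C => k * w + l).
  by move=> x y /= /addIr; exact: mulfI.
apply: (@covering_post _ _ _ D (~` [set u; v]) _ P (fun w => k * w + l)
  (fun w => k^-1 * w + (- k^-1 * l))) => //.
- exact: unit_disc_open.
- exact: open_setC2.
- move=> y ny; split; [|by field|exact: caff].
  by move=> [] /inj E; apply: ny; [left|right].
- move=> y ny; split; [|by field|exact: caff].
  move=> [] E; apply: ny; [left|right]; rewrite -E; by field.
Qed.

Definition disc_aut w (t : C) : C := (t + w) / (1 + (w^*)%C * t).

Lemma conj_mul w : (w^*)%C * w = ((cabs w ^+ 2)%:C)%C :> C.
Proof.
rewrite cabs_sqr; case: w => x y.
by rewrite -[LHS]/(Complex (x * x - (- y) * y) (x * y + (- y) * x)) /=;
  congr Complex; ring.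
Qed.

(** For [w] and [t] in the disc the right-hand side is positive, which shows both that the
    denominator of [disc_aut] is nonzero and that the disc is preserved. *)
Lemma disc_aut_norm w t :
  cabs (1 + (w^*)%C * t) ^+ 2 - cabs (t + w) ^+ 2 =
  (1 - cabs w ^+ 2) * (1 - cabs t ^+ 2).
Proof.
rewrite !cabs_sqr; case: w t => [x y] [s r].
rewrite -[1 + _]/(Complex (1 + (x * s - (- y) * r)) (0 + (x * r + (- y) * s))).
by rewrite -[Complex s r + _]/(Complex (s + x) (r + y)) /=; ring.
Qed.

Lemma sqr_lt1 w : D w -> cabs w ^+ 2 < 1.
Proof. by move=> w1; rewrite expr_lt1 ?cabs_ge0. Qed.

Lemma disc_aut_den w t : D w -> D t -> 1 + (w^*)%C * t != 0.
Proof.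
move=> /sqr_lt1 w1 /sqr_lt1 t1; apply/eqP => E.
have := disc_aut_norm w t; rewrite E cabs0 expr0n /= sub0r.
have h : 0 < (1 - cabs w ^+ 2) * (1 - cabs t ^+ 2) by rewrite mulr_gt0 ?subr_gt0.
by have := exprn_ge0 2 (cabs_ge0 (t + w)); lra.
Qed.

Lemma disc_aut_in w t : D w -> D t -> D (disc_aut w t).
Proof.
move=> wD tD; rewrite /unit_disc /= -[X in X < _]/(cabs (disc_aut w t)).
have den := disc_aut_den wD tD.
rewrite /disc_aut cabsM cabsV ltr_pdivrMr ?cabs_gt0// mul1r.
rewrite -(ltr_pXn2r (n := 2)) ?nnegrE ?cabs_ge0// -subr_gt0 disc_aut_norm.
by rewrite mulr_gt0// subr_gt0 sqr_lt1.
Qed.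

Lemma disc_opp w : D w -> D (- w).
Proof. by move=> h; change (cabs (- w) < 1); rewrite cabsN. Qed.

Lemma disc_autK w t : D w -> D t -> disc_aut (- w) (disc_aut w t) = t.
Proof.
move=> wD tD; have den := disc_aut_den wD tD.
have w2 : 1 - (w^*)%C * w != 0.
  rewrite conj_mul; apply/eqP => /eqP; rewrite subr_eq0 => /eqP[/eqP].
  by rewrite gt_eqF// sqr_lt1.
have den2 := disc_aut_den (disc_opp wD) (disc_aut_in wD tD).
move: den2; rewrite /disc_aut raddfN => den2.
field; rewrite den /=.
by have -> : 1 + (w^*)%C * t + - (w^*)%C * (t + w) = 1 - (w^*)%C * w by ring.
Qed.

Lemma disc_aut_cderE w t : D w -> D t ->
  cder (disc_aut w) t (1 * (1 + (w^*)%C * t)^-1 +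
    (t + w) * (- (w^*)%C / (1 + (w^*)%C * t) ^+ 2)).
Proof.
move=> wD tD; have den := disc_aut_den wD tD.
have h1 : cder (fun t => t + w) t 1.
  by rewrite -[X in cder _ _ X]addr0; exact: (cderD (cder_id t) (cder_cst w t)).
have h2 : cder (fun t => 1 + (w^*)%C * t) t (w^*)%C.
  have := cderD (cder_cst 1 t) (cderM (cder_cst (w^*)%C t) (cder_id t)).
  by rewrite mul0r mulr1 !add0r.
exact: (cderM h1 (@cderV _ (fun t => 1 + (w^*)%C * t) _ _ den h2)).
Qed.

Lemma disc_aut_cder w t : D w -> D t -> exists d, cder (disc_aut w) t d.
Proof. by move=> wD tD; eexists; exact: disc_aut_cderE. Qed.

Lemma disc_aut_cder0 w : D w -> cder (disc_aut w) 0 (((1 - cabs w ^+ 2)%:C)%C).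
Proof.
move=> wD; have D0 : D 0 by change (cabs (0 : C) < 1); rewrite cabs0.
have := disc_aut_cderE wD D0.
rewrite mulr0 addr0 add0r expr1n !divr1 mulrN mulrC conj_mul.
suff -> : 1 - ((cabs w ^+ 2)%:C)%C = ((1 - cabs w ^+ 2)%:C)%C :> C by [].
by rewrite -[LHS]/(Complex (1 - _) (0 - 0)) subrr.
Qed.

(** Moves the base point of a covering from [P 0] to [P w], so that one covering serves for all base
    points. *)
Lemma plane_cover_aut u v w (P : C -> C) : D w -> plane_cover u v P ->
  plane_cover u v (P \o disc_aut w).
Proof.
move=> wD [cov dP]; split; last first.
  move=> t tD; have [d1 h1] := disc_aut_cder wD tD.
  have [d2 h2] := dP _ (disc_aut_in wD tD).
  by eexists; exact: (cder_comp h1 h2).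
have cont v' t : D v' -> D t -> {for t, continuous (disc_aut v')}.
  by move=> vD tD; have [d /cder_cont /continuous_ccont] := disc_aut_cder vD tD.
have nD := disc_opp wD.
apply: (@covering_pre _ _ D _ P (disc_aut w) (disc_aut (- w))) => //.
- exact: unit_disc_open.
- by move=> t tD; split; [exact: disc_aut_in|exact: disc_autK|exact: cont].
- move=> t tD; split; [exact: disc_aut_in| |exact: cont].
  by have := disc_autK nD tD; rewrite opprK.
Qed.

End SphereCharts.

(** * The density of thrice punctured spheres and its local Lipschitz property *)

Section Density.
Variable R : realType.
Local Notation C := (Cplane R).
Local Notation D := (@unit_disc R).
Implicit Types (a b c u v w y z : C).

Lemma plane_cover_deriv_eq u v (P Q : C -> C) d e : plane_cover u v P ->
  plane_cover u v Q -> P 0 = Q 0 -> cder P 0 d -> cder Q 0 e -> cabs d = cabs e.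
Proof.
move=> [cP dP] [cQ dQ] PQ Pd Qe; apply/eqP; rewrite eq_le.
by rewrite (covering_deriv_le cP cQ dP dQ PQ Pd Qe)
  (covering_deriv_le cQ cP dQ dP (esym PQ) Qe Pd).
Qed.

(** The set in [hyp_density] is a singleton: in the chart [1 / (z - a)] two coverings based at [z]
    have derivatives of equal modulus, and both chart derivatives carry the same nonzero factor. *)
Lemma rho3_eq a b c z p d : a <> b -> a <> c ->
  holomorphic_covering (thrice_punctured_sphere a b c) z p ->
  cder (@chart_fin R \o p) 0 d -> rho3 a b c z = 1 / cabs d.
Proof.
move=> ab ac hp pd; rewrite /rho3 /hyp_density.
apply: xget_subset1; first by exists p; split => //; rewrite (derive_cder pd).
move=> r1 r2 [p1 [h1 ->]] [p2 [h2 ->]].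
have [cov1 e1 za [d1 [pd1 Pd1]]] := sphere_to_plane ab ac h1.
have [cov2 e2 _ [d2 [pd2 Pd2]]] := sphere_to_plane ab ac h2.
rewrite (derive_cder pd1) (derive_cder pd2).
have := plane_cover_deriv_eq cov1 cov2 (etrans e1 (esym e2)) Pd1 Pd2.
rewrite !cabsM !cabsN => /mulIf -> //.
by rewrite cabs_eq0 invr_eq0 expf_eq0 subr_eq0 (negbTE za) andbF.
Qed.

(* The Moebius map sending [a], [b], [c] to [oo], [0], [1], and its derivative. *)
Definition mob a b c z : C := ((b - z) * (c - a)) * ((z - a)^-1 * (b - c)^-1).
Definition dmob a b c z : C :=
  ((c - a) * (b - a)) * ((b - c)^-1 * ((z - a)^-1 * (z - a)^-1)).

(** In the chart [1 / (z - a)] the sphere is the plane minus two points, an affine image of the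
    plane minus [0] and [1]; [mob] is the chart followed by the inverse affine map. Recentring the
    disc at [w] produces the factor [1 - |w| ^ 2]. *)
Lemma rho3_formula a b c z w (P : C -> C) d : a <> b -> b <> c -> a <> c ->
  z <> a -> plane_cover 0 1 P -> D w -> P w = mob a b c z -> cder P w d ->
  rho3 a b c z = cabs (dmob a b c z) * ((1 - cabs w ^+ 2) * cabs d)^-1.
Proof.
move=> ab bc ac za cov wD Pw Pd.
have za0 : z - a != 0 by rewrite subr_eq0; apply/eqP.
have ba0 : b - a != 0 by rewrite subr_eq0; apply/eqP => /esym.
have ca0 : c - a != 0 by rewrite subr_eq0; apply/eqP => /esym.
have bc0 : b - c != 0 by rewrite subr_eq0; apply/eqP.
(* The affine map [k y + l] carries [0] and [1] to the images of [b] and [c] in the chart. *)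
pose l := (b - a)^-1; pose k := (c - a)^-1 - l.
have kE : k = (b - c) * ((c - a)^-1 * (b - a)^-1).
  by rewrite /k /l; field; rewrite ba0 ca0.
have k0 : k != 0 by rewrite kE !mulf_neq0 ?invr_eq0.
have cov1 := plane_cover_affine l k0 cov.
have E1 : k * 0 + l = (b - a)^-1 by rewrite mulr0 add0r.
have E2 : k * 1 + l = (c - a)^-1 by rewrite mulr1 subrK.
rewrite E1 E2 in cov1; have cov2 := plane_cover_aut wD cov1.
have D0 : D 0 by change (cabs (0 : C) < 1); rewrite cabs0.
have aut0 : disc_aut w 0 = w by rewrite /disc_aut mulr0 addr0 divr1 add0r.
have Q0 : ((fun w => k * P w + l) \o disc_aut w) 0 = (z - a)^-1.
  rewrite /= aut0 Pw /mob kE /l; field.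
  by rewrite ba0 za0 bc0 ca0.
have Qd : cder ((fun w => k * P w + l) \o disc_aut w) 0
    (k * d * ((1 - cabs w ^+ 2)%:C)%C).
  apply: (@cder_comp _ (disc_aut w) (fun w => k * P w + l)); first exact: disc_aut_cder0.
  rewrite aut0.
  have -> : k * d = 0 * P w + k * d + 0 by rewrite mul0r add0r addr0.
  exact: (cderD (cderM (cder_cst k w) Pd) (cder_cst l w)).
have y0 : (z - a)^-1 != 0 by rewrite invr_eq0.
have [hol hd] := plane_to_sphere ab ac cov2 Q0 y0 Qd.
rewrite invrK addrC subrK in hol.
rewrite (rho3_eq ab ac hol hd) /dmob kE !(cabsM, cabsN, cabsV, cabsX) cabs_real.
have w1 : 0 < 1 - cabs w ^+ 2 by rewrite subr_gt0 sqr_lt1.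
have d0 : d != 0 by case: cov => cP dP; exact: (covering_cder_neq0 cP dP wD Pd).
rewrite ger0_norm ?(ltW w1)//.
have n1 : cabs (z - a) != 0 by rewrite cabs_eq0.
have n2 : cabs (b - a) != 0 by rewrite cabs_eq0.
have n3 : cabs (c - a) != 0 by rewrite cabs_eq0.
have n4 : cabs (b - c) != 0 by rewrite cabs_eq0.
have n5 : cabs d != 0 by rewrite cabs_eq0.
have n6 : 1 - cabs w ^+ 2 != 0 by rewrite gt_eqF.
move: (cabs (z - a)) (cabs (b - a)) (cabs (c - a)) (cabs (b - c)) (cabs d)
  (1 - cabs w ^+ 2) n1 n2 n3 n4 n5 n6 => x1 x2 x3 x4 x5 x6 n1 n2 n3 n4 n5 n6.
by field; rewrite n1 n2 n3 n4 n5 n6.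
Qed.

Lemma rho3_zero a b c z : a <> b -> b <> c -> a <> c ->
  ~ (exists P : C -> C, plane_cover 0 1 P) -> rho3 a b c z = 0.
Proof.
move=> ab bc ac nP; apply: xgetPN => r [p [hp _]]; apply: nP.
have [cov _ _ _] := sphere_to_plane ab ac hp.
have ba0 : b - a != 0 by rewrite subr_eq0; apply/eqP => /esym.
have ca0 : c - a != 0 by rewrite subr_eq0; apply/eqP => /esym.
have bc0 : b - c != 0 by rewrite subr_eq0; apply/eqP.
pose k := (b - a) * (c - a) / (b - c).
have k0 : k != 0 by rewrite !mulf_neq0 ?invr_eq0.
have := plane_cover_affine (- (k / (b - a))) k0 cov.
have -> : k * (b - a)^-1 - k / (b - a) = 0 by rewrite subrr.
have -> : k * (c - a)^-1 - k / (b - a) = 1.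
  by rewrite /k; field; rewrite ba0 ca0 bc0.
by move=> H; eexists; exact: H.
Qed.

Definition lift_data (P : C -> C) y w d := [/\ D w, P w = y & cder P w d].

Lemma inverse_le (m s t : R) : 0 < m -> m <= s -> m <= t ->
  `|s^-1 - t^-1| <= `|s - t| / m ^+ 2.
Proof.
move=> m0 ms mt; have s0 : 0 < s := lt_le_trans m0 ms.
have t0 : 0 < t := lt_le_trans m0 mt.
have -> : s^-1 - t^-1 = (t - s) / (s * t) by field; rewrite !gt_eqF.
rewrite normrM distrC ler_wpM2l// normfV ger0_norm ?mulr_ge0 ?(ltW s0) ?(ltW t0)//.
rewrite lef_pV2 ?posrE ?mulr_gt0 ?exprn_gt0// expr2.
by apply: ler_pM => //; exact: ltW.
Qed.

(** A single local inverse [g] of [P] supplies the lifts of both points. The estimate is phrased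
    through lifts because these are what [rho3_formula] takes. *)
Lemma density_lipschitz (P : C -> C) y0 : plane_cover 0 1 P ->
  (~` [set 0; 1] : set C) y0 ->
  exists (r L : R), [/\ 0 < r, 0 < L & forall y y', cabs (y - y0) < r ->
    cabs (y' - y0) < r -> exists w d w' d', [/\ lift_data P y w d,
      lift_data P y' w' d',
      `|((1 - cabs w ^+ 2) * cabs d)^-1 - ((1 - cabs w' ^+ 2) * cabs d')^-1|
         <= L * cabs (y - y') &
      `|((1 - cabs w ^+ 2) * cabs d)^-1| <= L]].
Proof.
move=> [cov dP] ny0.
have [V [Vy0 VA [oV [F [Fc Fd Fs]]]]] := covering_evenly cov ny0.
have [w0 w0D Pw0] : (P @` D) y0 by have [_ -> _] := cov.
have [S FS Sw0] : exists2 S, F S & S w0 by apply: Fc => //; rewrite Pw0.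
have [g [oS SD Sg gS]] := Fs S FS.
have gy0 : g y0 = w0 by rewrite -Pw0; have [] := Sg w0 Sw0.
have hP : hol_near P w0.
  by apply: filterS (proj1 (open_cabs D) (@unit_disc_open R) w0 w0D) => w /dP.
have [r1 [B [D1 [D2 [r10 B0 HD]]]]] := hol_near_deriv hP.
have hg : hol_near g y0.
  apply: filterS (proj1 (open_cabs V) oV y0 Vy0) => y Vy.
  have [Sgy Pgy cg] := gS y Vy.
  have [d Pd] := dP _ (SD _ Sgy).
  exists (1 / d); apply: (cder_lift Pd (covering_cder_neq0 cov dP (SD _ Sgy) Pd)
    (cder_id y) cg).
  by apply: filterS (proj1 (open_cabs V) oV y Vy) => y' /gS[].
have [r2 [B' [E1 [E2 [r20 B'0 HE]]]]] := hol_near_deriv hg.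
have cgy0 : ccont g y0 by have [] := gS y0 Vy0.
have [r3 r30 r3P] : exists2 r : R, 0 < r & forall y, cabs (y - y0) < r ->
    V y /\ cabs (g y - w0) < r1.
  apply/nbhs_cabsP; apply: filterI; first exact: (proj1 (open_cabs V) oV y0 Vy0).
  by rewrite -gy0; exact: cgy0.
pose rr := Num.min r2 r3.
have rr0 : 0 < rr by rewrite lt_min r20 r30.
(* The reciprocal of the density at [y]. *)
pose Fn y := (1 - cabs (g y) ^+ 2) * cabs (D1 (g y)).
have Fpos y : cabs (y - y0) < rr -> 0 < Fn y /\ lift_data P y (g y) (D1 (g y)).
  rewrite lt_min => /andP[_ /r3P[Vy gy]]; have [Sgy Pgy _] := gS y Vy.
  have [h _ _ _] := HD _ gy; have gD := SD _ Sgy.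
  split; last by split.
  by rewrite mulr_gt0 ?subr_gt0 ?sqr_lt1// cabs_gt0 (covering_cder_neq0 cov dP gD h).
(* The variation of [P'] contributes [B], that of [1 - |g| ^ 2] contributes [2 * B], each multiplied
   by the Lipschitz constant [B'] of [g]. *)
pose L0 := 3 * B * B'.
have L00 : 0 <= L0 by rewrite !mulr_ge0.
have Flip y y' : cabs (y - y0) < rr -> cabs (y' - y0) < rr ->
    `|Fn y - Fn y'| <= L0 * cabs (y - y').
  rewrite !lt_min => /andP[y2 y3] /andP[y'2 y'3].
  have [Vy gy] := r3P y y3; have [Vy' gy'] := r3P y' y'3.
  have gyD : cabs (g y) < 1 by have [/SD] := gS y Vy.
  have gy'D : cabs (g y') < 1 by have [/SD] := gS y' Vy'.
  have [_ _ _ /(_ y y2)[gl _]] := HE y' y'2.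
  have [_ _ Db' /(_ _ gy)[_ Dl]] := HD _ gy'.
  have [_ _ Db _] := HD _ gy.
  have l1 : `|cabs (g y) - cabs (g y')| <= cabs (g y - g y').
    rewrite ler_norml ler_cabsB andbT lerNl opprB cabsB; exact: ler_cabsB.
  have l2 : `|cabs (D1 (g y)) - cabs (D1 (g y'))| <= cabs (D1 (g y) - D1 (g y')).
    rewrite ler_norml ler_cabsB andbT lerNl opprB cabsB; exact: ler_cabsB.
  have a0 := cabs_ge0 (g y); have b0 := cabs_ge0 (g y').
  have u0 := cabs_ge0 (D1 (g y)); have v0 := cabs_ge0 (D1 (g y')).
  rewrite /Fn.
  have {}l1 := le_trans l1 gl.
  have {}l2 := le_trans l2 (le_trans Dl (ler_wpM2l B0 gl)).
  set t := B' * cabs (y - y') in l1 l2 *.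
  have t0 : 0 <= t by exact: le_trans (normr_ge0 _) l1.
  have -> : L0 * cabs (y - y') = 3 * B * t by rewrite /L0 /t; ring.
  move: l1 l2 a0 b0 u0 v0 gyD gy'D Db Db' B0.
  move: (cabs (g y)) (cabs (g y')) (cabs (D1 (g y))) (cabs (D1 (g y'))) (B).
  clear -t0; move: (t) t0 => {}t t0 p q m n K l1 l2 p0 q0 m0 n0 p1 q1 mK nK K0.
  have -> : (1 - p ^+ 2) * m - (1 - q ^+ 2) * n =
    (1 - p ^+ 2) * (m - n) - ((p - q) * ((p + q) * n)) by ring.
  apply: le_trans (ler_normB _ _) _; rewrite !normrM.
  have h1 : `|1 - p ^+ 2| <= 1.
    by rewrite ler_norml; have := exprn_ge0 2 p0; have := exprn_ile1 2 p0 (ltW p1); lra.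
  have h2 : `|1 - p ^+ 2| * `|m - n| <= 1 * (K * t) by apply: ler_pM.
  have h3 : `|p + q| * `|n| <= 2 * K.
    by apply: ler_pM => //; rewrite ger0_norm//; lra.
  have h4 : `|p - q| * (`|p + q| * `|n|) <= t * (2 * K).
    by apply: ler_pM => //; rewrite mulr_ge0.
  by apply: le_trans (lerD h2 h4) _; rewrite le_eqVlt; apply/orP; left; apply/eqP; ring.
have y0rr : cabs (y0 - y0) < rr by rewrite subrr cabs0.
have [F0 _] := Fpos y0 y0rr.
(* Within [m / (L0 + 1)] of [y0] the Lipschitz bound cannot bring [Fn] below half of its central
   value, which makes passing to the reciprocal Lipschitz. *)
pose m := Fn y0 / 2; have m0 : 0 < m by rewrite divr_gt0.
have L1 : 0 < L0 + 1 by rewrite ltr_wpDl.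
exists (Num.min rr (m / (L0 + 1))), (L0 / m ^+ 2 + m^-1); split.
- by rewrite lt_min rr0 divr_gt0.
- by rewrite ltr_wpDl ?invr_gt0// divr_ge0// exprn_ge0// ltW.
have low y : cabs (y - y0) < Num.min rr (m / (L0 + 1)) -> cabs (y - y0) < rr /\ m <= Fn y.
  rewrite lt_min => /andP[yr]; rewrite ltr_pdivlMr// => ym; split => //.
  have := Flip y y0 yr y0rr; rewrite ler_norml => /andP[h _].
  have := cabs_ge0 (y - y0) => c0.
  have : Fn y0 = m + m by rewrite /m; field.
  move: h ym; rewrite mulrDr mulr1 (mulrC _ L0); move: (L0 * _) => ll; lra.
move=> y y' /low[yr my] /low[y'r my'].
have [Fy ly] := Fpos y yr; have [Fy' ly'] := Fpos y' y'r.
exists (g y), (D1 (g y)), (g y'), (D1 (g y')); split => //.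
  apply: le_trans (inverse_le m0 my my') _.
  rewrite ler_pdivrMr ?exprn_gt0//; apply: le_trans (Flip y y' yr y'r) _.
  have -> : (L0 / m ^+ 2 + m^-1) * cabs (y - y') * m ^+ 2 = (L0 + m) * cabs (y - y').
    by field; rewrite gt_eqF.
  by rewrite ler_wpM2r ?cabs_ge0// lerDl ltW.
have Fm : (Fn y)^-1 <= m^-1 by rewrite lef_pV2.
rewrite -/(Fn y) ger0_norm ?invr_ge0 ?(ltW Fy)//; apply: le_trans Fm _.
by rewrite lerDr divr_ge0// exprn_ge0// ltW.
Qed.

Lemma closed_cabs_ge p (m : R) : closed [set y : C | m <= cabs (y - p)].
Proof.
apply: closed_cabsP => y /negP; rewrite -ltNge => ym.
exists (m - cabs (y - p)); first by rewrite subr_gt0.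
move=> w wy; apply/negP; rewrite -ltNge.
by have := cabs_triangle y w p; lra.
Qed.

(** One number plays three parts, [e] as radius and its inverse as Lipschitz constant and as bound:
    the property survives decreasing [e], as [compact_uniform] requires. *)
Lemma density_lipschitz_uniform (P : C -> C) (m M : R) : plane_cover 0 1 P -> 0 < m ->
  exists2 e : R, 0 < e & forall y, m <= cabs y -> m <= cabs (y - 1) -> cabs y <= M ->
   forall y', cabs (y' - y) < e -> exists w d w' d', [/\ lift_data P y w d,
      lift_data P y' w' d',
      `|((1 - cabs w ^+ 2) * cabs d)^-1 - ((1 - cabs w' ^+ 2) * cabs d')^-1|
         <= e^-1 * cabs (y - y') &
      `|((1 - cabs w ^+ 2) * cabs d)^-1| <= e^-1].
Proof.
move=> cov m0.
pose K : set C := [set y | m <= cabs (y - 0)] `&` [set y | m <= cabs (y - 1)] `&` cdisc 0 M.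
have cK : compact K.
  apply: (@subclosed_compact _ _ (cdisc 0 M)); [|exact: cdisc_compact|by move=> y []].
  by apply: closedI; [apply: closedI; exact: closed_cabs_ge|exact: cdisc_closed].
pose Q (e : R) y := forall y', cabs (y' - y) < e -> exists w d w' d', [/\ lift_data P y w d,
      lift_data P y' w' d',
      `|((1 - cabs w ^+ 2) * cabs d)^-1 - ((1 - cabs w' ^+ 2) * cabs d')^-1|
         <= e^-1 * cabs (y - y') &
      `|((1 - cabs w ^+ 2) * cabs d)^-1| <= e^-1].
have [e e0 eP] : exists2 e : R, 0 < e & forall y, K y -> Q e y.
  apply: (compact_uniform cK).
    move=> e e' y e'0 ee' H y' y'y.
    have e0 : 0 < e := lt_le_trans e'0 ee'.
    have ei : e^-1 <= e'^-1 by rewrite lef_pV2.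
    have [w [d [w' [d' [h1 h2 h3 h4]]]]] := H y' (lt_le_trans y'y ee').
    exists w, d, w', d'; split => //; last exact: le_trans ei.
    by apply: le_trans h3 _; rewrite ler_wpM2r ?cabs_ge0.
  move=> y0 [[K1 K2] K3].
  have ny0 : (~` [set 0; 1] : set C) y0.
    by move=> [] E; [move: K1|move: K2]; rewrite /= E subrr cabs0; lra.
  have [r [L [r0 L0 H]]] := density_lipschitz cov ny0.
  have e0 : 0 < Num.min (r / 2) L^-1 by rewrite lt_min divr_gt0// invr_gt0.
  have [er eL] : Num.min (r / 2) L^-1 <= r / 2 /\ L <= (Num.min (r / 2) L^-1)^-1.
    split; first by rewrite ge_min lexx.
    by rewrite -[leLHS]invrK lef_pV2 ?posrE ?invr_gt0// ge_min lexx orbT.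
  exists (Num.min (r / 2) L^-1) => // y yy0 y' y'y.
  have yr : cabs (y - y0) < r by lra.
  have y'r : cabs (y' - y0) < r by have := cabs_triangle y y' y0; lra.
  have [w [d [w' [d' [h1 h2 h3 h4]]]]] := H y y' yr y'r.
  exists w, d, w', d'; split => //; last exact: le_trans eL.
  by apply: le_trans h3 _; rewrite ler_wpM2r ?cabs_ge0.
exists e => // y y1 y2 y3; apply: eP.
by split; [split|]; rewrite /cdisc /= ?subr0.
Qed.

(* [eps] is kept separate from [k] so that the constants do not depend on it. *)
Definition close (eps M k : R) (x y : C) :=
  [/\ cabs x <= M, cabs y <= M & cabs (x - y) <= k * eps].

Lemma closeM eps M1 k1 M2 k2 (x x' y y' : C) : 0 <= eps ->
  close eps M1 k1 x x' -> close eps M2 k2 y y' ->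
  close eps (M1 * M2) (k1 * M2 + M1 * k2) (x * y) (x' * y').
Proof.
move=> e0 [x1 x2 x3] [y1 y2 y3].
split; rewrite ?cabsM; try (apply: ler_pM; rewrite ?cabs_ge0//).
have -> : x * y - x' * y' = (x - x') * y + x' * (y - y') by ring.
apply: le_trans (cabsD _ _) _; rewrite !cabsM mulrDl.
have -> : k1 * M2 * eps = (k1 * eps) * M2 by ring.
have -> : M1 * k2 * eps = M1 * (k2 * eps) by ring.
by apply: lerD; apply: ler_pM; rewrite ?cabs_ge0.
Qed.

Lemma closeV eps m M k (x x' : C) : 0 < m -> m <= cabs x -> m <= cabs x' ->
  close eps M k x x' -> close eps m^-1 (k / m ^+ 2) x^-1 x'^-1.
Proof.
move=> m0 mx mx' [x1 x2 x3].
have x0 : 0 < cabs x := lt_le_trans m0 mx.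
have x'0 : 0 < cabs x' := lt_le_trans m0 mx'.
split; rewrite ?cabsV ?lef_pV2//.
have -> : x^-1 - x'^-1 = (x' - x) * (x * x')^-1.
  by field; rewrite -!cabs_eq0 !gt_eqF.
rewrite cabsM cabsV cabsM cabsB.
have -> : k / m ^+ 2 * eps = (k * eps) * (m ^+ 2)^-1 by ring.
apply: ler_pM; rewrite ?invr_ge0 ?mulr_ge0 ?cabs_ge0//.
rewrite lef_pV2 ?posrE ?mulr_gt0 ?exprn_gt0// expr2.
by apply: ler_pM => //; exact: ltW.
Qed.

Lemma close_sub eps M (x x' y y' : C) : cabs (x - x') <= eps -> cabs (y - y') <= eps ->
  cabs (x - y) <= M -> cabs (x' - y') <= M -> close eps M 2 (x - y) (x' - y').
Proof.
move=> xx yy h1 h2; split => //.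
have -> : x - y - (x' - y') = (x - x') - (y - y') by ring.
by apply: le_trans (cabsD _ _) _; rewrite cabsN; lra.
Qed.

(** This factorization bounds [mob] away from [1], as its definition bounds it away from [0]. *)
Lemma mob_sub1 a b c z : z <> a -> b <> c ->
  mob a b c z - 1 = ((z - c) * (a - b)) * ((z - a)^-1 * (b - c)^-1).
Proof.
move=> za bc; rewrite /mob; field.
by rewrite !subr_eq0; apply/andP; split; apply/eqP.
Qed.

(** All that the constants may use about a configuration: the compact set enters the estimate only
    through [m] and [M]. *)
Definition separated (m M : R) a b c z :=
  [/\ [/\ m <= cabs (a - b), m <= cabs (b - c) & m <= cabs (c - a)],
      [/\ m <= cabs (z - a), m <= cabs (z - b) & m <= cabs (z - c)],
      [/\ cabs (a - b) <= M, cabs (b - c) <= M & cabs (c - a) <= M] &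
      [/\ cabs (z - a) <= M, cabs (z - b) <= M & cabs (z - c) <= M]].

(** For separated configurations the values of [mob] lie in a fixed compact subset of the plane
    minus [0] and [1], where the uniform Lipschitz property applies; [mob] and [dmob] are themselves
    Lipschitz in [a], [b], [c]. Both constants are fixed before the configurations. *)
Lemma rho3_perturb (m M : R) : 0 < m ->
  exists k e : R, 0 < e /\ forall (eps : R) a b c a' b' c' z,
   0 < eps -> eps < e -> cabs (a - a') <= eps -> cabs (b - b') <= eps ->
   cabs (c - c') <= eps -> separated m M a b c z -> separated m M a' b' c' z ->
   `|rho3 a b c z - rho3 a' b' c' z| <= k * eps.
Proof.
move=> m0.
have neq a b : m <= cabs (a - b) -> a <> b.
  by move=> h E; move: h; rewrite E subrr cabs0; lra.
have [[P cov]|nP] := pselect (exists P : C -> C, plane_cover 0 1 P); last first.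
  exists 0, 1; split => // eps a b c a' b' c' z _ _ _ _ _ [[ab bc ca] _ _ _]
    [[ab' bc' ca'] _ _ _].
  rewrite !rho3_zero ?subr0 ?normr0 ?mul0r//;
    by [exact: neq|apply/nesym; exact: neq].
have dif eps M' a a' b b' : cabs (a - a') <= eps -> cabs (b - b') <= eps ->
  cabs (a - b) <= M' -> cabs (a' - b') <= M' -> close eps M' 2 (a - b) (a' - b').
  exact: close_sub.
have [k1 H1] : exists k1 : R, forall (eps : R) a b c a' b' c' z, 0 < eps ->
   cabs (a - a') <= eps -> cabs (b - b') <= eps ->
   cabs (c - c') <= eps -> separated m M a b c z -> separated m M a' b' c' z ->
   cabs (mob a b c z - mob a' b' c' z) <= k1 * eps.
  (* The constant is left to unification: it is the one that [closeM] and [closeV] assemble along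
     the factors of [mob]. *)
  eexists => eps a b c a' b' c' z e0 aa bb cc
    [[ab bc ca] [za zb zc] [ab2 bc2 ca2] [za2 zb2 zc2]]
    [[ab' bc' ca'] [za' zb' zc'] [ab2' bc2' ca2'] [za2' zb2' zc2']].
  have zz : cabs (z - z) <= eps by rewrite subrr cabs0 ltW.
  rewrite cabsB in zb2; rewrite cabsB in zb2'.
  have [_ _ h] := closeM (ltW e0)
    (closeM (ltW e0) (dif _ _ _ _ _ _ bb zz zb2 zb2') (dif _ _ _ _ _ _ cc aa ca2 ca2'))
    (closeM (ltW e0) (closeV m0 za za' (dif _ _ _ _ _ _ zz aa za2 za2'))
      (closeV m0 bc bc' (dif _ _ _ _ _ _ bb cc bc2 bc2'))).
  exact: h.
have [k2 [k3 H2]] : exists k2 k3 : R, forall (eps : R) a b c a' b' c' z, 0 < eps ->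
   cabs (a - a') <= eps -> cabs (b - b') <= eps ->
   cabs (c - c') <= eps -> separated m M a b c z -> separated m M a' b' c' z ->
   close eps k3 k2 (dmob a b c z) (dmob a' b' c' z).
  eexists; eexists => eps a b c a' b' c' z e0 aa bb cc
    [[ab bc ca] [za zb zc] [ab2 bc2 ca2] [za2 zb2 zc2]]
    [[ab' bc' ca'] [za' zb' zc'] [ab2' bc2' ca2'] [za2' zb2' zc2']].
  have zz : cabs (z - z) <= eps by rewrite subrr cabs0 ltW.
  rewrite cabsB in ab2; rewrite cabsB in ab2'.
  have iza := closeV m0 za za' (dif _ _ _ _ _ _ zz aa za2 za2').
  have h := closeM (ltW e0)
    (closeM (ltW e0) (dif _ _ _ _ _ _ cc aa ca2 ca2') (dif _ _ _ _ _ _ bb aa ab2 ab2'))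
    (closeM (ltW e0) (closeV m0 bc bc' (dif _ _ _ _ _ _ bb cc bc2 bc2'))
      (closeM (ltW e0) iza iza)).
  exact: h.
(* Lower bound for both [mob] and [mob - 1]: two factors at least [m], and two inverses of
   differences of modulus at most [|M| + 1], a number that is positive whatever [M]. *)
pose m1 := (m * m) * ((`|M| + 1)^-1 * (`|M| + 1)^-1).
have M0 : 0 < `|M| + 1 by rewrite ltr_wpDl.
have m10 : 0 < m1 by rewrite !mulr_gt0 ?invr_gt0.
have [e e0 eP] := @density_lipschitz_uniform P m1 ((M * M) * (m^-1 * m^-1)) cov m10.
have MM : M <= `|M| + 1 by apply: le_trans (ler_norm M) _; rewrite lerDl.
have k10 : 0 < `|k1| + 1 by rewrite ltr_wpDl.
exists (k2 * e^-1 + k3 * (e^-1 * k1)), (e / (`|k1| + 1)).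
split; first by rewrite divr_gt0.
move=> eps a b c a' b' c' z eps0; rewrite ltr_pdivlMr// => epse aa bb cc s s'.
have {}H1 := H1 _ _ _ _ _ _ _ _ eps0 aa bb cc s s'.
have [_ d1 d2] := H2 _ _ _ _ _ _ _ _ eps0 aa bb cc s s'.
have [[ab bc ca] [za zb zc] [ab2 bc2 ca2] [za2 zb2 zc2]] := s.
have [[ab' bc' ca'] [za' zb' zc'] _ _] := s'.
have inv_ge (t : C) : m <= cabs t -> cabs t <= M -> (`|M| + 1)^-1 <= cabs t^-1 <= m^-1.
  move=> mt tM; have t0 := lt_le_trans m0 mt.
  by rewrite cabsV !lef_pV2 ?posrE// mt (le_trans tM MM).
have /andP[iza iza2] := inv_ge _ za za2.
have /andP[ibc ibc2] := inv_ge _ bc bc2.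
have iM0 : 0 <= (`|M| + 1)^-1 by rewrite invr_ge0 ltW.
have m0' := ltW m0.
have y1 : m1 <= cabs (mob a b c z).
  rewrite /mob !cabsM (cabsB b z).
  by apply: ler_pM; rewrite ?mulr_ge0//; apply: ler_pM; rewrite ?mulr_ge0.
have y2 : m1 <= cabs (mob a b c z - 1).
  rewrite mob_sub1; [|exact: neq|exact: neq]; rewrite !cabsM.
  by apply: ler_pM; rewrite ?mulr_ge0//; apply: ler_pM; rewrite ?mulr_ge0.
have y3 : cabs (mob a b c z) <= (M * M) * (m^-1 * m^-1).
  rewrite /mob !cabsM (cabsB b z).
  by apply: ler_pM; rewrite ?mulr_ge0 ?cabs_ge0//; apply: ler_pM; rewrite ?cabs_ge0.
have yy' : cabs (mob a' b' c' z - mob a b c z) < e.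
  rewrite cabsB; apply: le_lt_trans H1 _; apply: le_lt_trans epse.
  rewrite mulrC ler_wpM2l ?(ltW eps0)//; apply: le_trans (ler_norm _) _.
  by rewrite lerDl.
have [w [d [w' [d' [[wD Pw Pd] [w'D Pw' Pd'] h1 h2]]]]] := eP _ y1 y2 y3 _ yy'.
rewrite (rho3_formula (neq _ _ ab) (neq _ _ bc) (nesym (neq _ _ ca)) (neq _ _ za) cov wD Pw Pd).
rewrite (rho3_formula (neq _ _ ab') (neq _ _ bc') (nesym (neq _ _ ca')) (neq _ _ za') cov w'D Pw' Pd').
have e'0 : 0 <= e^-1 by rewrite invr_ge0 ltW.
move: h1 h2; set s1 := (_ * _)^-1; set s2 := (_ * _)^-1 => h1 h2.
have -> : cabs (dmob a b c z) * s1 - cabs (dmob a' b' c' z) * s2 =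
  (cabs (dmob a b c z) - cabs (dmob a' b' c' z)) * s1 + cabs (dmob a' b' c' z) * (s1 - s2).
  by ring.
apply: le_trans (ler_normD _ _) _; rewrite !normrM mulrDl.
have -> : k2 * e^-1 * eps = (k2 * eps) * e^-1 by ring.
have -> : k3 * (e^-1 * k1) * eps = k3 * (e^-1 * (k1 * eps)) by ring.
apply: lerD; apply: ler_pM => //.
- apply: le_trans d2; rewrite ler_norml ler_cabsB andbT lerNl opprB cabsB.
  exact: ler_cabsB.
- by rewrite ger0_norm ?cabs_ge0.
- by apply: le_trans h1 _; rewrite ler_wpM2l.
Qed.

End Density.

(** * Hausdorff distance, relabelling and the choice of constants *)

Section Conclusion.
Variable R : realType.
Local Notation C := (Cplane R).
Implicit Types (a b c z : C).

Lemma set_dist_nonneg (A B : set C) :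
  lbound [set cabs (z - w) | z in A & w in B] (0 : R).
Proof. by move=> _ [z _ [w _ <-]]; exact: cabs_ge0. Qed.

Lemma set_dist_le (A B : set C) z w : A z -> B w -> set_dist A B <= cabs (z - w).
Proof.
move=> zA wB; apply: ge_inf; first by exists 0; exact: set_dist_nonneg.
by exists z => //; exists w.
Qed.

Lemma set_nbhd_ex (r : R) (B : set C) z : B !=set0 -> set_nbhd r B z ->
  exists2 w, B w & cabs (z - w) < r.
Proof.
move=> [w0 Bw0] /=; rewrite /set_nbhd /= /set_dist => /inf_lt[].
  by exists (cabs (z - w0)), z => //; exists w0.
by move=> _ [z' -> [w Bw <-]] h; exists w.
Qed.

(** An admissible radius has to be supplied, because the infimum of an empty set of radii would be
    0. *)
Lemma hausdorff_ex (A B : set C) (eps : R) z : (exists r : R, [/\ 0 < r,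
    A `<=` set_nbhd r B & B `<=` set_nbhd r A]) -> B !=set0 ->
  hausdorff_dist A B < eps -> A z -> exists2 w, B w & cabs (z - w) < eps.
Proof.
move=> ne B0 /inf_lt[//|r [r0 AB _] re] zA.
have [w Bw zw] := set_nbhd_ex B0 (AB z zA).
by exists w => //; exact: lt_trans re.
Qed.

Lemma hausdorff_triple a b c a' b' c' (eps : R) :
  hausdorff_dist [set a; b; c] [set a'; b'; c'] < eps ->
  forall z, [set a; b; c] z -> exists2 w, [set a'; b'; c'] w & cabs (z - w) < eps.
Proof.
move=> H z; apply: hausdorff_ex H; last by exists a'; left; left.
(* An admissible radius: it exceeds the distance from any point of the first triple to [a'] and from
   any point of the second to [a]. *)
pose r := 1 + (cabs (a - a') + cabs (b - a') + cabs (c - a')) +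
  (cabs (a' - a) + cabs (b' - a) + cabs (c' - a)).
have p1 := cabs_ge0 (a - a'); have p2 := cabs_ge0 (b - a').
have p3 := cabs_ge0 (c - a'); have p4 := cabs_ge0 (a' - a).
have p5 := cabs_ge0 (b' - a); have p6 := cabs_ge0 (c' - a).
exists r; split; first by rewrite /r; lra.
  move=> w hw; apply: (@le_lt_trans _ _ (cabs (w - a'))).
    by apply: set_dist_le => //; left; left.
  by case: hw => [[|]|] ->; rewrite /r; lra.
move=> w hw; apply: (@le_lt_trans _ _ (cabs (w - a))).
  by apply: set_dist_le => //; left; left.
by case: hw => [[|]|] ->; rewrite /r; lra.
Qed.

(** Three distinct members of a triple exhaust it, and the density depends on the set of punctures
    only. *)
Lemma rho3_perm a b c a' b' c' z :
  [set a'; b'; c'] a -> [set a'; b'; c'] b -> [set a'; b'; c'] c ->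
  a <> b -> b <> c -> a <> c -> rho3 a' b' c' z = rho3 a b c z.
Proof.
move=> ha hb hc ab bc ac; rewrite /rho3; congr hyp_density.
rewrite /thrice_punctured_sphere; congr (~` _).
case: ha => [[|]|] /= ea; case: hb => [[|]|] /= eb; case: hc => [[|]|] /= ec; subst;
  try (by exfalso; congruence);
  by apply/seteqP; split => x [[|]|] /= ->;
    first [by left; left|by left; right|by right].
Qed.

Lemma compact_separated (K : set C) a b c : compact K -> K `<=` ~` [set a; b; c] ->
  exists2 m : R, 0 < m & forall z, K z ->
    [/\ m <= cabs (z - a), m <= cabs (z - b) & m <= cabs (z - c)].
Proof.
move=> cK Kn; apply: (compact_uniform cK (P := fun m z =>
    [/\ m <= cabs (z - a), m <= cabs (z - b) & m <= cabs (z - c)])).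
  by move=> e e' y _ ee' [h1 h2 h3]; split; exact: le_trans ee' _.
move=> y Ky.
have pos p : [set a; b; c] p -> 0 < cabs (y - p).
  by move=> hp; rewrite cabs_gt0 subr_eq0; apply/eqP => E; apply: (Kn y Ky); rewrite E.
have pa : 0 < cabs (y - a) by apply: pos; left; left.
have pb : 0 < cabs (y - b) by apply: pos; left; right.
have pc : 0 < cabs (y - c) by apply: pos; right.
pose t := Num.min (cabs (y - a)) (Num.min (cabs (y - b)) (cabs (y - c))) / 2.
have t0 : 0 < Num.min (cabs (y - a)) (Num.min (cabs (y - b)) (cabs (y - c))).
  by rewrite !lt_min pa pb pc.
have [ta [tb tc]] : 2 * t <= cabs (y - a) /\ 2 * t <= cabs (y - b) /\ 2 * t <= cabs (y - c).
  have -> : 2 * t = Num.min (cabs (y - a)) (Num.min (cabs (y - b)) (cabs (y - c))).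
    by rewrite /t; field.
  by rewrite !ge_min !lexx !orbT.
exists t; first by rewrite divr_gt0.
move=> y' yy'; rewrite cabsB in yy'.
have ha := cabs_triangle y' y a; have hb := cabs_triangle y' y b.
have hc := cabs_triangle y' y c.
by split; lra.
Qed.

Lemma compact_bounded_dist (K : set C) a b c : compact K ->
  exists A : R, forall w p, K w -> [set a; b; c] p -> cabs (w - p) <= A.
Proof.
move=> cK; have [->|/set0P[z zK]] := eqVneq K set0; first by exists 0.
have [w wK wP] := @compact_max R (fun w => cabs w) K cK (ex_intro _ z zK)
  (fun w _ => @cvg_cabs R w).
exists (cabs w + (cabs a + cabs b + cabs c)) => y q yK hq.
apply: le_trans (cabsD _ _) _; rewrite cabsN; apply: lerD; first exact: wP.
have := cabs_ge0 a; have := cabs_ge0 b; have := cabs_ge0 c.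
by case: hq => [[|]|] ->; lra.
Qed.

Lemma cabs_perturb (p q p' q' : C) (eps : R) :
  cabs (p - p') < eps -> cabs (q - q') < eps ->
  cabs (p - q) - 2 * eps <= cabs (p' - q') <= cabs (p - q) + 2 * eps.
Proof.
move=> hp hq.
have t1 := cabs_triangle p' p q; have t2 := cabs_triangle q' p' q.
have t3 := cabs_triangle p p' q'; have t4 := cabs_triangle q p q'.
rewrite (cabsB q' q) in t2; rewrite (cabsB p' p) in t3.
by apply/andP; split; lra.
Qed.

(** Lets the linear estimate imply the one with the logarithmic factor. *)
Lemma ln_inv_ge1 (eps : R) : 0 < eps -> eps < expR (-1) -> 1 <= ln (1 / eps).
Proof.
move=> e0 e1; rewrite -[leLHS](@expRK R) ler_ln ?posrE ?expR_gt0 ?divr_gt0//.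
rewrite div1r -[leLHS]invrK -expRN lef_pV2 ?posrE ?expR_gt0//.
exact: ltW.
Qed.

(** The five quantities are free real numbers, and the constant is chosen before the points and the
    compact set: this expresses that it depends on nothing else. *)
Lemma rho3_continuity (s d x1 x2 x3 : R) : exists Cst : R,
  forall (a b c : Cplane R) (K : set (Cplane R)),
    a <> b -> b <> c -> a <> c ->
    compact K -> K `<=` ~` [set a; b; c] ->
    sup [set cabs (w - p) | w in K & p in [set a; b; c]] = s ->
    set_dist K [set a; b; c] = d ->
    cabs (a - b) = x1 -> cabs (b - c) = x2 -> cabs (a - c) = x3 ->
    exists eps0 : R, 0 < eps0 /\
      forall eps : R, 0 < eps -> eps < eps0 ->
      forall a' b' c' : Cplane R,
        hausdorff_dist [set a; b; c] [set a'; b'; c'] < eps ->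
        forall z : Cplane R, K z ->
          `| rho3 a b c z - rho3 a' b' c' z | < Cst * eps * ln (1 / eps).
Proof.
pose m0 := Num.min d (Num.min x1 (Num.min x2 x3)); pose m := m0 / 2.
(* The sum dominates each distance involved; [2 * m] leaves room for a perturbation by
   [2 * eps < m]. *)
pose M := s + x1 + x2 + x3 + 2 * m.
(* Numbers that are not all positive come from no configuration with a point in [K], so any constant
   serves. *)
have [[d0 x10 x20 x30]|npos] := pselect [/\ 0 < d, 0 < x1, 0 < x2 & 0 < x3]; last first.
  exists 0 => a b c K ab bc ac cK Kn sE dE e1 e2 e3.
  exists 1; split => // eps _ _ a' b' c' _ z zK; exfalso; apply: npos.
  have [mu mu0 muP] := compact_separated cK Kn.
  have pos (p q : C) : p <> q -> 0 < cabs (p - q).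
    by move=> pq; rewrite cabs_gt0 subr_eq0; apply/eqP.
  split; rewrite -?e1 -?e2 -?e3; [|exact: pos|exact: pos|exact: pos].
  apply: (lt_le_trans mu0); rewrite -dE; apply: lb_le_inf.
    by exists (cabs (z - a)), z => //; exists a => //; left; left.
  by move=> _ [w /muP[h1 h2 h3] [p hp <-]]; case: hp => [[|]|] ->.
have m00 : 0 < m0 by rewrite !lt_min d0 x10 x20 x30.
have mp : 0 < m by rewrite divr_gt0.
have [md [m1 [m2 m3]]] : 2 * m <= d /\ 2 * m <= x1 /\ 2 * m <= x2 /\ 2 * m <= x3.
  have -> : 2 * m = m0 by rewrite /m; field.
  by rewrite /m0 !ge_min !lexx !orbT.
have lo (t : R) : 2 * m <= t -> m <= t by lra.
have lo1 (t t' eps : R) : 2 * m <= t -> eps < m / 2 -> t - 2 * eps <= t' -> m <= t'.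
  by lra.
have up : 0 <= s -> [/\ x1 <= s + x1 + x2 + x3, x2 <= s + x1 + x2 + x3,
    x3 <= s + x1 + x2 + x3 & s <= s + x1 + x2 + x3] by split; lra.
have upM (t : R) : t <= s + x1 + x2 + x3 -> t <= M by rewrite /M; lra.
have upM1 (t t' eps : R) : t <= s + x1 + x2 + x3 -> eps < m / 2 ->
    t' <= t + 2 * eps -> t' <= M by rewrite /M; lra.
have [k [e [e0 H]]] := rho3_perturb M mp.
(* The added 1 makes the final inequality strict. *)
exists (`|k| + 1) => a b c K ab bc ac cK Kn sE dE e1 e2 e3.
(* The three entries ensure the range of [rho3_perturb], a separation that survives moving the
   punctures, and [ln (1 / eps) >= 1]. *)
pose eps0 := Num.min (Num.min e (m / 2)) (expR (-1)).
exists eps0; split; first by rewrite !lt_min e0 divr_gt0// expR_gt0.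
move=> eps epsp; rewrite !lt_min => /andP[/andP[epse epsm] epsx] a' b' c' Haus z zK.
have near := hausdorff_triple Haus.
have [a1 a1P aa1] := near a (or_introl (or_introl erefl)).
have [b1 b1P bb1] := near b (or_introl (or_intror erefl)).
have [c1 c1P cc1] := near c (or_intror erefl).
have [A AP] := compact_bounded_dist a b c cK.
have zs p : [set a; b; c] p -> d <= cabs (z - p) <= s.
  move=> hp; rewrite -dE set_dist_le//= -sE; apply: ub_le_sup; last first.
    by exists z => //; exists p.
  by exists A => _ [w wK [q hq <-]]; exact: AP.
have /andP[za1 za2] := zs a (or_introl (or_introl erefl)).
have /andP[zb1 zb2] := zs b (or_introl (or_intror erefl)).
have /andP[zc1 zc2] := zs c (or_intror erefl).
have zz : cabs (z - z) < eps by rewrite subrr cabs0.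
have /andP[pab1 pab2] := cabs_perturb aa1 bb1.
have /andP[pbc1 pbc2] := cabs_perturb bb1 cc1.
have /andP[pca1 pca2] := cabs_perturb cc1 aa1.
have /andP[pza1 pza2] := cabs_perturb zz aa1.
have /andP[pzb1 pzb2] := cabs_perturb zz bb1.
have /andP[pzc1 pzc2] := cabs_perturb zz cc1.
rewrite (cabsB c a) e3 in pca1 pca2; rewrite e1 in pab1 pab2; rewrite e2 in pbc1 pbc2.
have s0 : 0 <= s := le_trans (cabs_ge0 _) za2.
have [u1 u2 u3 us] := up s0.
have sep : separated m M a b c z.
  rewrite /separated (cabsB c a) e1 e2 e3; split; split; try exact: lo; try exact: upM.
  - exact/lo/(le_trans md).
  - exact/lo/(le_trans md).
  - exact/lo/(le_trans md).
  - exact/upM/(le_trans za2).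
  - exact/upM/(le_trans zb2).
  - exact/upM/(le_trans zc2).
have sep1 : separated m M a1 b1 c1 z.
  split; split.
  - exact: lo1 m1 epsm pab1.
  - exact: lo1 m2 epsm pbc1.
  - exact: lo1 m3 epsm pca1.
  - exact: lo1 (le_trans md za1) epsm pza1.
  - exact: lo1 (le_trans md zb1) epsm pzb1.
  - exact: lo1 (le_trans md zc1) epsm pzc1.
  - exact: upM1 u1 epsm pab2.
  - exact: upM1 u2 epsm pbc2.
  - exact: upM1 u3 epsm pca2.
  - exact: upM1 (le_trans za2 us) epsm pza2.
  - exact: upM1 (le_trans zb2 us) epsm pzb2.
  - exact: upM1 (le_trans zc2 us) epsm pzc2.
have neq (p q : C) : m <= cabs (p - q) -> p <> q.
  by move=> h E; move: h; rewrite E subrr cabs0 leNgt mp.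
(* Separation makes the nearby points [a1], [b1], [c1] distinct, so they are [a'], [b'], [c'] in
   some order. *)
have [[s1 s2 s3] _ _ _] := sep1.
rewrite (rho3_perm z a1P b1P c1P (neq _ _ s1) (neq _ _ s2) (nesym (neq _ _ s3))).
have := H eps a b c a1 b1 c1 z epsp epse (ltW aa1) (ltW bb1) (ltW cc1) sep sep1.
move=> /le_lt_trans; apply.
have kk : k * eps < (`|k| + 1) * eps.
  by rewrite ltr_pM2r//; apply: le_lt_trans (ler_norm k) _; rewrite ltrDl.
apply: (lt_le_trans kk); rewrite ler_peMr ?mulr_ge0 ?addr_ge0 ?(ltW epsp)//.
exact: ln_inv_ge1.
Qed.

End Conclusion.

Theorem theorem2 (R : realType) :
  exists Cst : R -> R -> R -> R -> R -> R,
  forall (a b c : Cplane R) (K : set (Cplane R)),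
    a <> b -> b <> c -> a <> c ->
    compact K -> K `<=` ~` [set a; b; c] ->
    exists eps0 : R, 0 < eps0 /\
      forall eps : R, 0 < eps -> eps < eps0 ->
      forall a' b' c' : Cplane R,
        hausdorff_dist [set a; b; c] [set a'; b'; c'] < eps ->
        forall z : Cplane R, K z ->
          `| rho3 a b c z - rho3 a' b' c' z | <
            Cst (sup [set cabs (w - p) | w in K & p in [set a; b; c]])
                (set_dist K [set a; b; c])
                (cabs (a - b)) (cabs (b - c)) (cabs (a - c))
            * eps * ln (1 / eps).
Proof.
(* Choice over quintuples of reals turns the constants into a function of the five quantities. *)
have [F FP] := choice (fun t : R * R * R * R * R =>
  rho3_continuity t.1.1.1.1 t.1.1.1.2 t.1.1.2 t.1.2 t.2).
exists (fun s d x1 x2 x3 => F (s, d, x1, x2, x3)) => a b c K ab bc ac cK Kn.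
exact: (FP (_, _, _, _, _) a b c K ab bc ac cK Kn erefl erefl erefl erefl erefl).
Qed.
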